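(* Let $K$ be a field. There is an algorithm which, given an FI-Rep of a bipersistence module $M$, i.e. a pair of bigraded matrices $([f],[g])$ representing the morphisms in a chain complex $X\xrightarrow{f}Y\xrightarrow{g}Z$ of finitely generated free bipersistence modules with $M\cong \ker g/\operatorname{im} f$, computes a minimal presentation of $M$ (as a labeled matrix) using $$O(|X|^3+|Y|^3+|Z|^3)\ \text{time}\quad\text{and}\quad O(|X|^2+|Y|^2+|Z|^2)\ \text{memory}.$$ Likewise, there is an algorithm which, given the same input, computes the bigraded Betti numbers $\beta_0^M,\beta_1^M,\beta_2^M$ within the same time and memory bounds.
   Context: A bipersistence module is a $K[x_1,x_2]$-module $M$ with a vector space decomposition $M=\bigoplus_{\mathbf z\in\mathbb Z^2}M_{\mathbf z}$ such that $x_iM_{\mathbf z}\subset M_{\mathbf z+\mathbf e_i}$. Morphisms are module homomorphisms preserving grades. $\mathbb Z^2$ carries the product partial order. A bipersistence module is free if it is isomorphic to a direct sum of modules $Q^{\mathbf g}$, $\mathbf g\in\mathbb Z^2$, where $Q^{\mathbf g}_{\mathbf z}=K$ if $\mathbf g\le\mathbf z$ and $0$ otherwise, with identity maps between the copies of $K$. A basis of a free module $F$ is a minimal homogeneous generating set; $|F|$ denotes its cardinality. For a homogeneous element $b$, $\mathrm{gr}(b)$ is its grade. Given an ordered basis $B$ of a finitely generated free module $F$ and $v\in F_{\mathbf z}$, $[v]^B\in K^{|B|}$ is the unique vector with $[v]^B_i=0$ if $\mathrm{gr}(B_i)\not\le\mathbf z$ and $v=\sum_{i:\mathrm{gr}(B_i)\le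 \mathbf z}[v]^B_i x^{\mathbf z-\mathrm{gr}(B_i)}B_i$. A morphism $\gamma:F\to F'$ of finitely generated free modules with ordered bases $B,B'$ is represented by the matrix over $K$ whose $j$-th column is $[\gamma(B_j)]^{B'}$, with $j$-th column labeled by $\mathrm{gr}(B_j)$ and $i$-th row labeled by $\mathrm{gr}(B'_i)$. A bigraded matrix is a matrix over $K$ with each column labeled by an element of $\mathbb Z^2$, the labels appearing in colexicographical order. An FI-Rep of $M$ is the pair $([f],[g])$ of bigraded matrices (only column labels are kept) representing $f$ and $g$ with respect to ordered bases of $X,Y,Z$, where those of $X$ and $Y$ are colexicographically ordered by grade. A presentation of $M$ is a morphism $\partial:F\to F'$ of free modules with $\operatorname{coker}\partial\cong M$ (or a labeled matrix representing it). For a module $N$, $IN\subset N$ is the submodule generated by the images of all maps $N_{\mathbf y}\to N_{\mathbf z}$ (multiplication by $x^{\mathbf z-\mathbf y}$) with $\mathbf y<\mathbf z$. A free resolution $\cdots\to F_2\xrightarrow{\partial_2}F_1\xrightarrow{\partial_1}F_0$ of $M$ is minimal if $\operatorname{im}\partial_i\subset IF_{i-1}$ for all $i$. A presentation is minimal if it extends to (is the last map $\partial_1$ of) a minimal resolution. The bigraded Betti number $\beta_i^M(\mathbf z)$ is $\dim (F_i/IF_i)_{\mathbf z}$ for a minimal resolution $F_\bullet$ of $M$, equivalently the number of elements of grade $\mathbf z$ in a basis of $F_i$; for bipersistence modules it vanishes for $i>2$. Cost model: an elementary arithmetic operation in $K$ takes $O(1)$ time and storing an element of $K$ takes $O(1)$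 memory (and likewise for labels in $\mathbb Z^2$). *)

(* Defs.v *)
From HB Require Import structures.
From mathcomp Require Import all_boot all_order all_algebra.
From mathcomp Require Import generic_quotient ring_quotient.
From mathcomp Require Import boolp.

Set Implicit Arguments.
Unset Strict Implicit.
Unset Printing Implicit Defensive.

Import GRing.Theory.
Local Open Scope ring_scope.
Local Open Scope quotient_scope.

Definition grade : Type := (int * int)%type.

Definition gle (y z : grade) : bool := (y.1 <= z.1) && (y.2 <= z.2).
Definition glt (y z : grade) : bool := (y != z) && gle y z.

Definition colex (y z : grade) : bool :=
  (y.2 < z.2) || ((y.2 == z.2) && (y.1 <= z.1)).

Section LinearAlgebra.
Variable K : fieldType.

Record subspace (V : lmodType K) (S : submodClosed V) : Type :=
  Subspace { subspace_val : V; _ : subspace_val \in S }.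
HB.instance Definition _ V S := [isSub for @subspace_val V S].
HB.instance Definition _ V S := [Choice of @subspace V S by <:].
HB.instance Definition _ V S := [SubChoice_isSubLmodule of @subspace V S by <:].

(* {ideal_quot _} is only an abelian group, the quotient by a subset closed under
   subtraction; scaling by K is added to it. *)
Definition lsub (V : lmodType K) (S : submodClosed V) : {pred V} :=
  fun v => v \in S.
Lemma lsub_closed (V : lmodType K) (S : submodClosed V) :
  Algebra.zmod_closed (lsub S).
Proof.
split=> [|u v]; rewrite -!topredE /= /lsub ?rpred0 // => uS vS.
by rewrite rpredD // -scaleN1r rpredZ.
Qed.
HB.instance Definition _ (V : lmodType K) (S : submodClosed V) :=
  GRing.isZmodClosed.Build V (lsub S) (lsub_closed S).

Definition lquot (V : lmodType K) (S : submodClosed V) : Type :=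
  {ideal_quot (lsub S)}.
HB.instance Definition _ (V : lmodType K) (S : submodClosed V) :=
  GRing.Zmodule.on (lquot S).

Section QuotientSpace.
Variables (V : lmodType K) (S : submodClosed V).

Definition lproj (v : V) : lquot S := \pi_({ideal_quot (lsub S)}) v.
Definition lrepr (u : lquot S) : V := repr (u : {ideal_quot (lsub S)}).

Lemma lreprK u : lproj (lrepr u) = u.
Proof. exact: reprK. Qed.

Lemma lproj_eq v w : (lproj v = lproj w) <-> (v - w \in S).
Proof.
have -> : (v - w \in S) = (v - w \in lsub S) by [].
by rewrite Quotient.idealrBE; split=> /eqP.
Qed.

Lemma lprojD v w : lproj (v + w) = lproj v + lproj w.
Proof. exact: (raddfD \pi_({ideal_quot (lsub S)})). Qed.

Definition lquot_scale (a : K) (u : lquot S) : lquot S := lproj (a *: lrepr u).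

Lemma lquot_scaleE a v : lquot_scale a (lproj v) = lproj (a *: v).
Proof.
by apply/lproj_eq; rewrite -scalerBr rpredZ //; apply/lproj_eq/lreprK.
Qed.

Lemma lquot_scaleA a b u :
  lquot_scale a (lquot_scale b u) = lquot_scale (a * b) u.
Proof. by rewrite -[u]lreprK !lquot_scaleE scalerA. Qed.
Lemma lquot_scale1 : left_id 1 lquot_scale.
Proof. by move=> u; rewrite -[u]lreprK lquot_scaleE scale1r. Qed.
Lemma lquot_scaleDr : right_distributive lquot_scale +%R.
Proof.
move=> a u v; rewrite -[u]lreprK -[v]lreprK -lprojD !lquot_scaleE.
by rewrite scalerDr lprojD.
Qed.
Lemma lquot_scaleDl u : {morph lquot_scale^~ u : a b / a + b}.
Proof. by move=> a b; rewrite -[u]lreprK !lquot_scaleE scalerDl lprojD. Qed.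

HB.instance Definition _ := GRing.Zmodule_isLmodule.Build K (lquot S)
  lquot_scaleA lquot_scale1 lquot_scaleDr lquot_scaleDl.

Lemma lproj_linear : linear lproj.
Proof. by move=> a v w; rewrite lprojD -lquot_scaleE. Qed.
HB.instance Definition _ := GRing.isLinear.Build K V (lquot S) _ lproj
  lproj_linear.

End QuotientSpace.

Definition has_dim (V : lmodType K) (n : nat) : Prop :=
  exists phi : {linear V -> 'rV[K]_n}, bijective phi.

Section FiniteProduct.
Variables (I : finType) (V : I -> lmodType K).

Definition lprod : Type := {dffun forall i : I, V i}.
HB.instance Definition _ := Choice.on lprod.
Implicit Types u v w : lprod.

Definition lprod0 : lprod := [ffun i => (0 : V i)].
Definition lprod_opp u : lprod := [ffun i => - u i].
Definition lprod_add u v : lprod := [ffun i => u i + v i].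
Definition lprod_scale (a : K) u : lprod := [ffun i => a *: u i].

Lemma lprod_addA : associative lprod_add.
Proof. by move=> u v w; apply/ffunP=> i; rewrite !ffunE addrA. Qed.
Lemma lprod_addC : commutative lprod_add.
Proof. by move=> u v; apply/ffunP=> i; rewrite !ffunE addrC. Qed.
Lemma lprod_add0 : left_id lprod0 lprod_add.
Proof. by move=> u; apply/ffunP=> i; rewrite !ffunE add0r. Qed.
Lemma lprod_addN : left_inverse lprod0 lprod_opp lprod_add.
Proof. by move=> u; apply/ffunP=> i; rewrite !ffunE addNr. Qed.
HB.instance Definition _ := GRing.isZmodule.Build lprod
  lprod_addA lprod_addC lprod_add0 lprod_addN.

Lemma lprod_scaleA a b u :
  lprod_scale a (lprod_scale b u) = lprod_scale (a * b) u.
Proof. by apply/ffunP=> i; rewrite !ffunE scalerA. Qed.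
Lemma lprod_scale1 : left_id 1 lprod_scale.
Proof. by move=> u; apply/ffunP=> i; rewrite !ffunE scale1r. Qed.
Lemma lprod_scaleDr : right_distributive lprod_scale +%R.
Proof. by move=> a u v; apply/ffunP=> i; rewrite !ffunE scalerDr. Qed.
Lemma lprod_scaleDl u : {morph lprod_scale^~ u : a b / a + b}.
Proof. by move=> a b; apply/ffunP=> i; rewrite !ffunE scalerDl. Qed.
HB.instance Definition _ := GRing.Zmodule_isLmodule.Build K lprod
  lprod_scaleA lprod_scale1 lprod_scaleDr lprod_scaleDl.

End FiniteProduct.

(* A Z^2-graded K[x_1,x_2]-module, given by its homogeneous components and by
   the multiplications by monomials x^(z-y) from grade y to grade z. *)
Record bipmod : Type := Bipmod {
  bcomp :> grade -> lmodType K;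
  btr : forall y z, gle y z -> {linear bcomp y -> bcomp z};
  btr_id : forall z (h : gle z z) v, btr h v = v;
  btr_comp : forall x y z (hxy : gle x y) (hyz : gle y z) (hxz : gle x z) v,
    btr hyz (btr hxy v) = btr hxz v }.
Arguments btr {b y z} h.

Record bmor (M N : bipmod) : Type := Bmor {
  bmap :> forall z, {linear M z -> N z};
  bmap_tr : forall y z (h : gle y z) v, bmap z (btr h v) = btr h (bmap y v) }.

Definition biso (M N : bipmod) : Prop :=
  exists f : bmor M N, forall z, bijective (f z).

(* Multiplication by x^(z-y); the value is irrelevant when y is not below z. *)
Definition xmul (M : bipmod) (y z : grade) (v : M y) : M z :=
  match @idP (gle y z) with ReflectT h => btr h v | ReflectF _ => 0 end.

Record bsub (M : bipmod) : Type := Bsub {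
  bsubP :> forall z, submodClosed (M z);
  bsub_tr : forall y z (h : gle y z) v, v \in bsubP y -> btr h v \in bsubP z }.

Section SubQuot.
Variables (M : bipmod) (S : bsub M).

Definition sub_tr_fun y z (h : gle y z) (v : subspace (S y)) : subspace (S z) :=
  Subspace (bsub_tr h (valP v)).
Lemma sub_tr_linear y z (h : gle y z) : linear (sub_tr_fun h).
Proof. by move=> a u v; apply: val_inj; rewrite /= linearP. Qed.
HB.instance Definition _ y z (h : gle y z) :=
  GRing.isLinear.Build K (subspace (S y)) (subspace (S z)) _ (sub_tr_fun h)
    (sub_tr_linear h).
Lemma sub_tr_id z (h : gle z z) v : sub_tr_fun h v = v.
Proof. by apply: val_inj; apply: btr_id. Qed.
Lemma sub_tr_comp x y z (hxy : gle x y) (hyz : gle y z) (hxz : gle x z) v :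
  sub_tr_fun hyz (sub_tr_fun hxy v) = sub_tr_fun hxz v.
Proof. by apply: val_inj; apply: btr_comp. Qed.

Definition bsubmod : bipmod :=
  @Bipmod (fun z => subspace (S z)) (fun y z h => sub_tr_fun h)
    sub_tr_id sub_tr_comp.

Definition quot_tr_fun y z (h : gle y z) (u : lquot (S y)) : lquot (S z) :=
  lproj (S z) (btr h (lrepr u)).
Lemma quot_tr_funE y z (h : gle y z) v :
  quot_tr_fun h (lproj (S y) v) = lproj (S z) (btr h v).
Proof.
apply/lproj_eq; rewrite -linearB; apply: bsub_tr; exact/lproj_eq/lreprK.
Qed.
Lemma quot_tr_linear y z (h : gle y z) : linear (quot_tr_fun h).
Proof.
move=> a u v; rewrite -[u]lreprK -[v]lreprK -linearP !quot_tr_funE.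
by rewrite !linearP.
Qed.
HB.instance Definition _ y z (h : gle y z) :=
  GRing.isLinear.Build K (lquot (S y)) (lquot (S z)) _ (quot_tr_fun h)
    (quot_tr_linear h).
Lemma quot_tr_id z (h : gle z z) v : quot_tr_fun h v = v.
Proof. by rewrite -[v]lreprK quot_tr_funE btr_id. Qed.
Lemma quot_tr_comp x y z (hxy : gle x y) (hyz : gle y z) (hxz : gle x z) v :
  quot_tr_fun hyz (quot_tr_fun hxy v) = quot_tr_fun hxz v.
Proof. by rewrite -[v]lreprK !quot_tr_funE (btr_comp _ _ hxz). Qed.

Definition bquot : bipmod :=
  @Bipmod (fun z => lquot (S z)) (fun y z h => quot_tr_fun h)
    quot_tr_id quot_tr_comp.

End SubQuot.

Section GeneratedSubmodule.
Variables (M : bipmod) (P : forall z, M z -> Prop).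

Definition gen_pred z : {pred M z} :=
  fun v => `[< forall S : bsub M,
                 (forall y (w : M y), P w -> w \in S y) -> v \in S z >].
Arguments gen_pred z : clear implicits.
Lemma gen_closed z : submod_closed (gen_pred z).
Proof.
split=> [|a u v /asboolP uP /asboolP vP]; apply/asboolP=> S PS.
  exact: rpred0.
by rewrite rpredD ?rpredZ ?uP ?vP.
Qed.
HB.instance Definition _ z :=
  GRing.isSubmodClosed.Build K (M z) (gen_pred z) (gen_closed z).
Lemma gen_tr y z (h : gle y z) v : v \in gen_pred y -> btr h v \in gen_pred z.
Proof. by move=> /asboolP vP; apply/asboolP=> S PS; apply/bsub_tr/vP. Qed.

Definition generated : bsub M := @Bsub M gen_pred gen_tr.
End GeneratedSubmodule.

(* The submodule IM generated by the images of all M_y -> M_z with y < z. *)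
Definition Isub (M : bipmod) : bsub M :=
  generated (fun z (v : M z) => exists y (h : gle y z) (w : M y),
    glt y z /\ v = btr h w).

Section KernelImage.
Variables (M N : bipmod) (f : bmor M N).

Definition ker_pred z : {pred M z} := fun v => f z v == 0.
Arguments ker_pred z : clear implicits.
Lemma ker_closed z : submod_closed (ker_pred z).
Proof.
split=> [|a u v]; rewrite !unfold_in ?linear0 //.
by move=> /eqP u0 /eqP v0; rewrite linearP u0 v0 scaler0 addr0.
Qed.
HB.instance Definition _ z :=
  GRing.isSubmodClosed.Build K (M z) (ker_pred z) (ker_closed z).
Lemma ker_tr y z (h : gle y z) v : v \in ker_pred y -> btr h v \in ker_pred z.
Proof. by rewrite !unfold_in bmap_tr => /eqP ->; rewrite linear0. Qed.
Definition bker : bsub M := @Bsub M ker_pred ker_tr.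

Definition im_pred z : {pred N z} := fun w => `[< exists v, w = f z v >].
Arguments im_pred z : clear implicits.
Lemma im_closed z : submod_closed (im_pred z).
Proof.
split=> [|a u v /asboolP[u' ->] /asboolP[v' ->]]; apply/asboolP.
  by exists 0; rewrite linear0.
by exists (a *: u' + v'); rewrite linearP.
Qed.
HB.instance Definition _ z :=
  GRing.isSubmodClosed.Build K (N z) (im_pred z) (im_closed z).
Lemma im_tr y z (h : gle y z) v : v \in im_pred y -> btr h v \in im_pred z.
Proof.
by move=> /asboolP[u ->]; apply/asboolP; exists (btr h u); rewrite bmap_tr.
Qed.
Definition bim : bsub N := @Bsub N im_pred im_tr.

Definition bcoker : bipmod := bquot bim.
End KernelImage.

(* The submodule S, restricted to a submodule of the submodule T. *)
Section Restriction.
Variables (M : bipmod) (S T : bsub M).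

Definition res_pred z : {pred bsubmod T z} :=
  fun v : subspace (T z) => val v \in S z.
Arguments res_pred z : clear implicits.
Lemma res_closed z : submod_closed (res_pred z).
Proof.
split=> [|a u v uS vS]; first exact: (rpred0 (S z)).
exact: (rpredD (rpredZ a (uS : val u \in S z)) (vS : val v \in S z)).
Qed.
HB.instance Definition _ z :=
  GRing.isSubmodClosed.Build K (bsubmod T z) (res_pred z) (res_closed z).
Lemma res_tr y z (h : gle y z) v : v \in res_pred y -> btr h v \in res_pred z.
Proof. exact: (@bsub_tr _ S _ _ h (val v)). Qed.
Definition bres : bsub (bsubmod T) := @Bsub (bsubmod T) res_pred res_tr.
End Restriction.

(* ker g / im f, meaningful when g o f = 0. *)
Definition bhomology (X Y Z : bipmod) (f : bmor X Y) (g : bmor Y Z) : bipmod :=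
  bquot (bres (bim f) (bker g)).

(* Q^g: row vectors of length 1 or 0, the all-ones matrix of the relevant size
   being the identity between two copies of K. *)
Section Free1.
Variable g : grade.

Definition Qcomp (z : grade) : lmodType K := 'rV[K]_(gle g z).
Definition Qtr y z (h : gle y z) : {linear Qcomp y -> Qcomp z} :=
  mulmxr (const_mx 1 : 'M[K]_(gle g y, gle g z)).

Lemma const_mx11 : const_mx 1 = 1%:M :> 'M[K]_1.
Proof. by apply/matrixP=> i j; rewrite !ord1 !mxE. Qed.
Lemma gle_trans x y z : gle x y -> gle y z -> gle x z.
Proof.
move=> /andP[a b] /andP[c d]; apply/andP.
by split; [apply: Order.POrderTheory.le_trans a c
          |apply: Order.POrderTheory.le_trans b d].
Qed.
Lemma Qtr_id z (h : gle z z) v : Qtr h v = v.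
Proof.
rewrite /Qtr /=; move: v; rewrite /Qcomp; case: (gle g z) => /= v.
  by rewrite const_mx11 mulmx1.
by apply/rowP; case.
Qed.
Lemma Qtr_comp x y z (hxy : gle x y) (hyz : gle y z) (hxz : gle x z) v :
  Qtr hyz (Qtr hxy v) = Qtr hxz v.
Proof.
have := fun h => @gle_trans g x y h hxy; have := fun h => @gle_trans g y z h hyz.
rewrite /Qtr /=; move: v; rewrite /Qcomp.
case: (gle g x); case: (gle g y); case: (gle g z) => //= v.
- by move=> _ _; rewrite const_mx11 !mulmx1.
- by move=> /(_ isT).
- by move=> _ /(_ isT).
- by move=> _ /(_ isT).
all: by move=> _ _; rewrite [v]thinmx0 !mul0mx.
Qed.

Definition Qmod : bipmod := Bipmod Qtr_id Qtr_comp.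
End Free1.

Section DirectSum.
Variables (I : finType) (M : I -> bipmod).

Definition dsum_comp (z : grade) : lmodType K := lprod (fun i => M i z).
Definition dsum_tr_fun y z (h : gle y z) (v : dsum_comp y) : dsum_comp z :=
  [ffun i => btr h (v i)] : lprod (fun i => M i z).
Lemma dsum_tr_linear y z (h : gle y z) : linear (dsum_tr_fun h).
Proof. by move=> a u v; apply/ffunP=> i; rewrite !ffunE linearP. Qed.
HB.instance Definition _ y z (h : gle y z) :=
  GRing.isLinear.Build K (dsum_comp y) (dsum_comp z) _ (dsum_tr_fun h)
    (dsum_tr_linear h).
Lemma dsum_tr_id z (h : gle z z) v : dsum_tr_fun h v = v.
Proof. by apply/ffunP=> i; rewrite !ffunE btr_id. Qed.
Lemma dsum_tr_comp x y z (hxy : gle x y) (hyz : gle y z) (hxz : gle x z) v :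
  dsum_tr_fun hyz (dsum_tr_fun hxy v) = dsum_tr_fun hxz v.
Proof. by apply/ffunP=> i; rewrite !ffunE (btr_comp _ _ hxz). Qed.

Definition bdsum : bipmod :=
  @Bipmod dsum_comp (fun y z h => dsum_tr_fun h) dsum_tr_id dsum_tr_comp.
End DirectSum.

(* Finitely generated free modules. *)
Definition bfree (F : bipmod) : Prop :=
  exists (n : nat) (g : 'I_n -> grade), biso F (bdsum (fun i => Qmod (g i))).

(* An ordered family of n homogeneous elements. *)
Record hfam (F : bipmod) (n : nat) : Type := Hfam {
  hgr : 'I_n -> grade;
  helt :> forall i, F (hgr i) }.

Inductive in_fam (F : bipmod) n (B : hfam F n) (A : {set 'I_n}) :
    forall y, F y -> Prop :=
  InFam i : i \in A -> in_fam B A (B i).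

Definition generates (F : bipmod) n (B : hfam F n) (A : {set 'I_n}) : Prop :=
  forall z (v : F z), v \in generated (in_fam B A) z.

Definition is_basis (F : bipmod) n (B : hfam F n) : Prop :=
  generates B setT /\ forall A : {set 'I_n}, A \proper setT -> ~ generates B A.

(* c = [v]^B *)
Definition is_coord (F : bipmod) n (B : hfam F n) z (v : F z) (c : 'cV[K]_n) :
    Prop :=
  (forall i, ~~ gle (hgr B i) z -> c i 0 = 0) /\
  v = \sum_(i | gle (hgr B i) z) c i 0 *: xmul z (B i).

Definition represents (F F' : bipmod) n m (gamma : bmor F F')
    (B : hfam F n) (B' : hfam F' m) (A : 'M[K]_(m, n)) : Prop :=
  forall j, is_coord B' (gamma _ (B j)) (col j A).

Record bigraded_mx (m n : nat) : Type := BigradedMx {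
  bmx :> 'M[K]_(m, n);
  clab : 'I_n -> grade;
  clab_colex : forall i j : 'I_n, (i <= j)%N -> colex (clab i) (clab j) }.

Definition is_FIRep nX nY nZ (f : bigraded_mx nY nX) (g : bigraded_mx nZ nY)
    (M : bipmod) : Prop :=
  exists (X Y Z : bipmod) (phi : bmor X Y) (gam : bmor Y Z)
         (BX : hfam X nX) (BY : hfam Y nY) (BZ : hfam Z nZ),
    [/\ bfree X, bfree Y & bfree Z] /\
    [/\ is_basis BX, is_basis BY & is_basis BZ] /\
    (hgr BX =1 clab f /\ hgr BY =1 clab g) /\
    (represents phi BX BY f /\ represents gam BY BZ g) /\
    (forall z v, gam z (phi z v) = 0) /\
    biso M (bhomology phi gam).

(* Resolutions by finitely generated free modules; those of a finitely
   generated module that are minimal are all of this kind. *)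
Record bchain : Type := Bchain {
  cmod :> nat -> bipmod;
  cdiff : forall i, bmor (cmod i.+1) (cmod i) }.

Definition is_resolution (F : bchain) (M : bipmod) : Prop :=
  [/\ forall i, bfree (F i),
      forall i z (v : F i.+1 z),
        v \in bim (cdiff F i.+1) z <-> v \in bker (cdiff F i) z
    & biso (bcoker (cdiff F 0)) M].

Definition is_minimal (F : bchain) : Prop :=
  forall i z (v : F i z), v \in bim (cdiff F i) z -> v \in Isub (F i) z.

(* A, with the given row and column labels, represents the last map
   F_1 -> F_0 of a minimal resolution of M. *)
Definition is_minimal_presentation m n (rlab : 'I_m -> grade)
    (collab : 'I_n -> grade) (A : 'M[K]_(m, n)) (M : bipmod) : Prop :=
  exists (F : bchain) (B1 : hfam (F 1%N) n) (B0 : hfam (F 0%N) m),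
    [/\ is_resolution F M, is_minimal F, is_basis B1 /\ is_basis B0,
        hgr B1 =1 collab /\ hgr B0 =1 rlab
      & represents (cdiff F 0) B1 B0 A].

(* n = beta_i^M(z) *)
Definition is_betti (M : bipmod) (i : nat) (z : grade) (n : nat) : Prop :=
  exists F : bchain,
    [/\ is_resolution F M, is_minimal F & has_dim (bquot (Isub (F i)) z) n].

End LinearAlgebra.

(* A random access machine with three memories, holding respectively natural
   numbers (sizes, loop counters and addresses), elements of K, and coordinates
   of labels.  It runs with a capacity S: accessing a cell of address at least
   S, or computing a natural number at least S, is a fault.  Hence S bounds the
   memory in use, and natural numbers are words of O(log S) bits, so that no
   data can be packed in them.  Elements of K are only subject to field
   operations and zero tests, and coordinates of labels to copy and comparison.
   Every elementary operation has unit cost. *)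

Inductive iexp : Type :=
  | INum of nat
  | IGet of iexp
  | IAdd of iexp & iexp
  | ISub of iexp & iexp
  | IMul of iexp & iexp.

Inductive kexp : Type :=
  | KZero
  | KOne
  | KGet of iexp
  | KAdd of kexp & kexp
  | KSub of kexp & kexp
  | KMul of kexp & kexp
  | KDiv of kexp & kexp.

Inductive bexp : Type :=
  | BLe of iexp & iexp
  | BZero of kexp
  | BLabLe of iexp & iexp (* compares the coordinates at two addresses *)
  | BNot of bexp
  | BAnd of bexp & bexp.

Inductive cmd : Type :=
  | Skip
  | ISet of iexp & iexp   (* address, value *)
  | KSet of iexp & kexp   (* address, value *)
  | LCopy of iexp & iexp  (* destination, source *)
  | Seq of cmd & cmd
  | If of bexp & cmd & cmd
  | While of bexp & cmd.

Section Machine.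
Variable K : fieldType.

Record state : Type := State {
  imem : nat -> nat;
  kmem : nat -> K;
  lmem : nat -> int }.

Definition upd (T : Type) (mem : nat -> T) (a : nat) (x : T) : nat -> T :=
  fun b => if b == a then x else mem b.

Definition obind2 (A B C : Type) (f : A -> B -> option C)
    (x : option A) (y : option B) : option C :=
  obind (fun a => obind (f a) y) x.

Section Semantics.
Variable S : nat.

Definition word (n : nat) : option nat := if (n < S)%N then Some n else None.

Fixpoint ieval (s : state) (e : iexp) : option nat :=
  match e with
  | INum n => word n
  | IGet a => obind (fun n => word (imem s n)) (ieval s a)
  | IAdd e1 e2 =>
      obind2 (fun m n => word (m + n)%N) (ieval s e1) (ieval s e2)
  | ISub e1 e2 =>
      obind2 (fun m n => word (m - n)%N) (ieval s e1) (ieval s e2)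
  | IMul e1 e2 =>
      obind2 (fun m n => word (m * n)%N) (ieval s e1) (ieval s e2)
  end.

Fixpoint keval (s : state) (e : kexp) : option K :=
  match e with
  | KZero => Some 0
  | KOne => Some 1
  | KGet a => omap (kmem s) (ieval s a)
  | KAdd e1 e2 => obind2 (fun x y => Some (x + y)) (keval s e1) (keval s e2)
  | KSub e1 e2 => obind2 (fun x y => Some (x - y)) (keval s e1) (keval s e2)
  | KMul e1 e2 => obind2 (fun x y => Some (x * y)) (keval s e1) (keval s e2)
  | KDiv e1 e2 =>
      obind2 (fun x y => if y == 0 then None else Some (x / y))
        (keval s e1) (keval s e2)
  end.

Fixpoint beval (s : state) (b : bexp) : option bool :=
  match b with
  | BLe e1 e2 => obind2 (fun m n => Some (m <= n)%N) (ieval s e1) (ieval s e2)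
  | BZero e => omap (fun x => x == 0) (keval s e)
  | BLabLe e1 e2 =>
      obind2 (fun m n => Some (lmem s m <= lmem s n)) (ieval s e1) (ieval s e2)
  | BNot b1 => omap negb (beval s b1)
  | BAnd b1 b2 => obind2 (fun x y => Some (x && y)) (beval s b1) (beval s b2)
  end.

Fixpoint isize (e : iexp) : nat :=
  match e with
  | INum _ => 1
  | IGet a => (isize a).+1
  | IAdd e1 e2 | ISub e1 e2 | IMul e1 e2 => (isize e1 + isize e2).+1
  end.

Fixpoint ksize (e : kexp) : nat :=
  match e with
  | KZero | KOne => 1
  | KGet a => (isize a).+1
  | KAdd e1 e2 | KSub e1 e2 | KMul e1 e2 | KDiv e1 e2 =>
      (ksize e1 + ksize e2).+1
  end.

Fixpoint bsize (b : bexp) : nat :=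
  match b with
  | BLe e1 e2 | BLabLe e1 e2 => (isize e1 + isize e2).+1
  | BZero e => (ksize e).+1
  | BNot b1 => (bsize b1).+1
  | BAnd b1 b2 => (bsize b1 + bsize b2).+1
  end.

(* exec c s s' t: started in s, c terminates without fault in s', in time t. *)
Inductive exec : cmd -> state -> state -> nat -> Prop :=
  | ExecSkip s : exec Skip s s 1
  | ExecISet s a e m n :
      ieval s a = Some m -> ieval s e = Some n ->
      exec (ISet a e) s (State (upd (imem s) m n) (kmem s) (lmem s))
        (isize a + isize e).+1
  | ExecKSet s a e m x :
      ieval s a = Some m -> keval s e = Some x ->
      exec (KSet a e) s (State (imem s) (upd (kmem s) m x) (lmem s))
        (isize a + ksize e).+1
  | ExecLCopy s a e m n :
      ieval s a = Some m -> ieval s e = Some n ->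
      exec (LCopy a e) s (State (imem s) (kmem s) (upd (lmem s) m (lmem s n)))
        (isize a + isize e).+1
  | ExecSeq c1 c2 s1 s2 s3 t1 t2 :
      exec c1 s1 s2 t1 -> exec c2 s2 s3 t2 ->
      exec (Seq c1 c2) s1 s3 (t1 + t2)%N
  | ExecIf b c1 c2 s s' (r : bool) t :
      beval s b = Some r -> exec (if r then c1 else c2) s s' t ->
      exec (If b c1 c2) s s' (bsize b + t).+1
  | ExecWhileF b c s :
      beval s b = Some false -> exec (While b c) s s (bsize b).+1
  | ExecWhileT b c s1 s2 s3 t1 t2 :
      beval s1 b = Some true ->
      exec c s1 s2 t1 -> exec (While b c) s2 s3 t2 ->
      exec (While b c) s1 s3 (bsize b + t1 + t2).+1.

End Semantics.

(* Matrices are stored in column-major order, a label in two cells. *)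
Definition mx_at (s : state) (base : nat) m n (A : 'M[K]_(m, n)) : Prop :=
  forall (i : 'I_m) (j : 'I_n), kmem s (base + j * m + i)%N = A i j.

Definition lab_at (s : state) (base : nat) n (l : 'I_n -> grade) : Prop :=
  forall j : 'I_n, (lmem s (base + j.*2)%N, lmem s (base + j.*2).+1) = l j.

(* The entries of f, then those of g; the labels of X, then those of Y; all the
   other cells hold 0. *)
Definition is_input nX nY nZ (f : bigraded_mx K nY nX) (g : bigraded_mx K nZ nY)
    (s : state) : Prop :=
  [/\ imem s =1 nth 0%N [:: nX; nY; nZ],
      mx_at s 0 f /\ mx_at s (nX * nY) g,
      forall a, (nX * nY + nY * nZ <= a)%N -> kmem s a = 0,
      lab_at s 0 (clab f) /\ lab_at s nX.*2 (clab g)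
    & forall a, ((nX + nY).*2 <= a)%N -> lmem s a = 0].

(* The numbers of rows and of columns are in the first two integer cells,
   followed by the addresses of the matrix, of its row labels and of its column
   labels. *)
Definition outputs_presentation (S : nat) (s : state) (M : bipmod K) : Prop :=
  let m := imem s 0 in let n := imem s 1 in
  exists (A : 'M[K]_(m, n)) (rlab : 'I_m -> grade) (collab : 'I_n -> grade),
    [/\ mx_at s (imem s 2) A /\ (imem s 2 + m * n <= S)%N,
        lab_at s (imem s 3) rlab /\ (imem s 3 + m.*2 <= S)%N,
        lab_at s (imem s 4) collab /\ (imem s 4 + n.*2 <= S)%N
      & is_minimal_presentation rlab collab A M].

(* The function beta_i^M, for i = 0, 1, 2, is output as the list of the pairs
   (z, beta_i^M(z)) for z in a finite set outside which it vanishes.  The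
   integer cells 3i, 3i+1, 3i+2 hold the length of the list, the address of its
   values and the address of its grades. *)
Definition outputs_betti (S : nat) (s : state) (M : bipmod K) : Prop :=
  forall i : nat, (i < 3)%N ->
    let n := imem s (3 * i) in
    let vbase := imem s (3 * i).+1 in let gbase := imem s (3 * i).+2 in
    exists gr : 'I_n -> grade,
      [/\ lab_at s gbase gr, injective gr,
          (vbase + n <= S)%N /\ (gbase + n.*2 <= S)%N,
          forall j : 'I_n, is_betti M i (gr j) (imem s (vbase + j)%N)
        & forall z, (forall j, gr j != z) -> is_betti M i z 0].

End Machine.

(* Main.v *)
Require Import Defs.
From HB Require Import structures.
From mathcomp Require Import all_boot all_order all_algebra.
From mathcomp Require Import boolp.
From mathcomp Require Import zify ring.

(**
The kernel of a matrix with colexicographically ordered columns is computed at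
all grades at once by inserting the columns one at a time, by increasing first
coordinate of their grades, into a system in which distinct nonzero columns
have distinct pivots.  If a column is reduced to zero when column a is inserted,
then the recorded column operations form a generator of the kernel, whose grade
has the first coordinate of a and the second coordinate of that column; by
triangularity these generators are a basis of the kernel at every grade.  In
particular the kernel is free.

Applied to g, this gives a basis of ker g.  Expressing the columns of f in this
basis (back substitution) gives a presentation of M, from which the entries
whose row and column have the same grade are eliminated.  A second insertion,
applied to the resulting matrix, gives its kernel; the columns that are reduced
to zero at their own insertion are the redundant relations, and discarding them
leaves a minimal presentation, extended by the other kernel elements to a
minimal resolution of length 2.  Each insertion visits every pivot once, hence
costs quadratic time.
*)

Set Implicit Arguments.
Unset Strict Implicit.
Unset Printing Implicit Defensive.

Import Order.TTheory GRing.Theory Num.Theory.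

(** * A structured language over the machine *)

(** Two orders compete. Columns arrive by first coordinate, yet the last column occurring in a
    kernel generator gives its second coordinate only if columns are added to columns of larger
    index alone. When the pivot met by the current column belongs to a later column, the two
    therefore exchange roles: the earlier one keeps the pivot and the later one is reduced further.
    Either way the column that goes on has a zero in the row just treated, so one scan of the rows,
    from the last to the first, completes an insertion. Columns once reduced to zero never change,
    which is why one system serves all grades. Since ties of the first coordinate are broken by
    index, a generator that arises at the insertion of a column other than its own last one has a
    grade strictly larger than all columns in it; this is the minimality of the resolution. Time is
    a matter of syntax: loops are bounded by N = |X| + |Y| + |Z| + 1 and nested at most three deep.
    On the algebraic side, a basis is defined as a minimal generating family, so that uniqueness of
    coordinates has to be proved. *)

Inductive iex : Type :=
  | Num of nat
  | Rg of nat
  | Ar of nat & iex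
  | Add of iex & iex
  | Sub of iex & iex
  | Mul of iex & iex.

Inductive kex : Type :=
  | KOn
  | KMt of nat & iex & iex
  | KLow of iex
  | KSb of kex & kex
  | KMl of kex & kex
  | KDv of kex & kex.

Inductive bex : Type :=
  | Le of iex & iex
  | KZ of kex
  | LabLe of nat & iex & nat & iex
  | Not of bex
  | And of bex & bex.

(** Loops are counted, so that they terminate and their nesting gives the running time. [SetLowI],
    [SetLowK], [LoadL] and [StoreL] (like [KLow]) reach the areas with absolute addresses, where
    input is found and output is left. *)
Inductive hcmd : Type :=
  | HSkip
  | SetR of nat & iex
  | SetA of nat & iex & iex
  | SetLowI of iex & iex
  | SetM of nat & iex & iex & kex
  | SetLowK of iex & kex
  | SetL of nat & iex & nat & iex
  | LoadL of nat & iex & iex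
  | StoreL of iex & nat & iex
  | HSeq of hcmd & hcmd
  | HIf of bex & hcmd & hcmd
  | For of nat & nat & hcmd.

Section Compile.

(* Register 9 holds a strict bound N on the dimensions of the matrices and on the
   lengths of the arrays.  Objects of the same kind are interleaved, so that they
   cannot overlap. *)
Definition rN : iexp := IGet (INum 9).
Definition aadr (a : nat) (e : iexp) : iexp :=
  IAdd (IAdd (INum (64 + a)) (IMul (INum 3) rN)) (IMul (INum 16) e).
Definition madr (q : nat) (i j : iexp) : iexp :=
  IAdd (IAdd (IMul rN rN) (INum q)) (IMul (INum 8) (IAdd (IMul j rN) i)).
Definition ladr (a : nat) (e : iexp) : iexp :=
  IAdd (IAdd (INum a) (IMul (INum 6) rN)) (IMul (INum 8) e).

Fixpoint compI (e : iex) : iexp :=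
  match e with
  | Num n => INum n
  | Rg r => IGet (INum r)
  | Ar a e => IGet (aadr a (compI e))
  | Add e1 e2 => IAdd (compI e1) (compI e2)
  | Sub e1 e2 => ISub (compI e1) (compI e2)
  | Mul e1 e2 => IMul (compI e1) (compI e2)
  end.

Fixpoint compK (e : kex) : kexp :=
  match e with
  | KOn => KOne
  | KMt q i j => KGet (madr q (compI i) (compI j))
  | KLow x => KGet (compI x)
  | KSb e1 e2 => KSub (compK e1) (compK e2)
  | KMl e1 e2 => KMul (compK e1) (compK e2)
  | KDv e1 e2 => KDiv (compK e1) (compK e2)
  end.

Fixpoint compB (e : bex) : bexp :=
  match e with
  | Le e1 e2 => BLe (compI e1) (compI e2)
  | KZ e => BZero (compK e)
  | LabLe a i b j => BLabLe (ladr a (compI i)) (ladr b (compI j))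
  | Not e => BNot (compB e)
  | And e1 e2 => BAnd (compB e1) (compB e2)
  end.

Fixpoint comp (c : hcmd) : cmd :=
  match c with
  | HSkip => Skip
  | SetR r e => ISet (INum r) (compI e)
  | SetA a i e => ISet (aadr a (compI i)) (compI e)
  | SetLowI x e => ISet (IAdd (INum 64) (compI x)) (compI e)
  | SetM q i j e => KSet (madr q (compI i) (compI j)) (compK e)
  | SetLowK x e => KSet (compI x) (compK e)
  | SetL a i b j => LCopy (ladr a (compI i)) (ladr b (compI j))
  | LoadL a i x => LCopy (ladr a (compI i)) (compI x)
  | StoreL x a i => LCopy (compI x) (ladr a (compI i))
  | HSeq c1 c2 => Seq (comp c1) (comp c2)
  | HIf b c1 c2 => If (compB b) (comp c1) (comp c2)
  | For r rn c =>
      Seq (ISet (INum r) (INum 0))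
        (While (BNot (BLe (IGet (INum rn)) (IGet (INum r))))
           (Seq (comp c) (ISet (INum r) (IAdd (IGet (INum r)) (INum 1)))))
  end.

(* The registers, arrays, matrices, label arrays and low areas that a program may
   write. *)
Fixpoint wrR (c : hcmd) : seq nat :=
  match c with
  | SetR r _ => [:: r]
  | HSeq c1 c2 | HIf _ c1 c2 => wrR c1 ++ wrR c2
  | For r _ c => r :: wrR c
  | _ => [::]
  end.
Fixpoint wrA (c : hcmd) : seq nat :=
  match c with
  | SetA a _ _ => [:: a]
  | HSeq c1 c2 | HIf _ c1 c2 => wrA c1 ++ wrA c2
  | For _ _ c => wrA c
  | _ => [::]
  end.
Fixpoint wrM (c : hcmd) : seq nat :=
  match c with
  | SetM q _ _ _ => [:: q]
  | HSeq c1 c2 | HIf _ c1 c2 => wrM c1 ++ wrM c2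
  | For _ _ c => wrM c
  | _ => [::]
  end.
Fixpoint wrL (c : hcmd) : seq nat :=
  match c with
  | SetL a _ _ _ | LoadL a _ _ => [:: a]
  | HSeq c1 c2 | HIf _ c1 c2 => wrL c1 ++ wrL c2
  | For _ _ c => wrL c
  | _ => [::]
  end.
Fixpoint wrLow (c : hcmd) : seq nat :=
  match c with
  | SetLowI _ _ => [:: 0]
  | SetLowK _ _ => [:: 1]
  | StoreL _ _ _ => [:: 2]
  | HSeq c1 c2 | HIf _ c1 c2 => wrLow c1 ++ wrLow c2
  | For _ _ c => wrLow c
  | _ => [::]
  end.

(** Register 9 is never written, since every computed address depends on it; a loop body writes
    neither the counter nor the bound, so that the number of iterations is known at entry. *)
Fixpoint wf (c : hcmd) : bool :=
  match c with
  | SetR r _ => (r < 64) && (r != 9)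
  | SetA a _ _ => a < 16
  | SetM q _ _ _ => q < 8
  | SetL a _ _ _ | LoadL a _ _ => a < 8
  | HSeq c1 c2 | HIf _ c1 c2 => wf c1 && wf c2
  | For r rn c =>
      [&& r < 64, rn < 64, r != 9, r != rn, r \notin wrR c, rn \notin wrR c
        & wf c]
  | _ => true
  end.

(* A bound on the running time when every loop makes at most N iterations. *)
Fixpoint cost (N : nat) (c : cmd) : nat :=
  match c with
  | Skip => 1
  | ISet a e | LCopy a e => (isize a + isize e).+1
  | KSet a e => (isize a + ksize e).+1
  | Seq c1 c2 => cost N c1 + cost N c2
  | If b c1 c2 => (bsize b + (cost N c1 + cost N c2)).+1
  | While b c => N * (bsize b + cost N c).+1 + (bsize b).+1
  end.

Fixpoint deg (c : cmd) : nat :=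
  match c with
  | Seq c1 c2 | If _ c1 c2 => maxn (deg c1) (deg c2)
  | While _ c => (deg c).+1
  | _ => 0
  end.

Fixpoint coef (c : cmd) : nat :=
  match c with
  | Skip => 1
  | ISet a e | LCopy a e => (isize a + isize e).+1
  | KSet a e => (isize a + ksize e).+1
  | Seq c1 c2 => coef c1 + coef c2
  | If b c1 c2 => (bsize b + (coef c1 + coef c2)).+1
  | While b c => (bsize b + coef c).+1 + (bsize b).+1
  end.

(** Reduces the running time to the nesting depth of the loops: [coef] depends on the syntax alone,
    and the final test of a loop is absorbed because [N] is positive. *)
Lemma cost_coef N c : 0 < N -> cost N c <= coef c * N ^ deg c.
Proof.
move=> N0; have P1 d : 0 < N ^ d by rewrite expn_gt0 N0.
elim: c => /= [|a e|a e|a e|c1 IH1 c2 IH2|b c1 IH1 c2 IH2|b c IH];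
  rewrite ?expn0 ?muln1 //.
- have [m1 m2] : cost N c1 <= coef c1 * N ^ maxn (deg c1) (deg c2) /\
      cost N c2 <= coef c2 * N ^ maxn (deg c1) (deg c2).
    split; [apply: leq_trans IH1 _|apply: leq_trans IH2 _];
    by rewrite leq_mul2l leq_pexp2l ?orbT // ?leq_maxl ?leq_maxr.
  nia.
- have [m1 m2] : cost N c1 <= coef c1 * N ^ maxn (deg c1) (deg c2) /\
      cost N c2 <= coef c2 * N ^ maxn (deg c1) (deg c2).
    split; [apply: leq_trans IH1 _|apply: leq_trans IH2 _];
    by rewrite leq_mul2l leq_pexp2l ?orbT // ?leq_maxl ?leq_maxr.
  have := P1 (maxn (deg c1) (deg c2)); nia.
- rewrite expnS; have := P1 (deg c); set X := N ^ deg c in IH *.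
  nia.
Qed.

End Compile.

(** * Abstract states and weakest preconditions *)

Section HighLevel.
Variable K : fieldType.
Local Notation state := (state K).

(* Registers, integer arrays, low integer cells (used for output), low field
   cells (input and output), matrices, low label cells, label arrays. *)
Record hst : Type := HSt {
  rg : nat -> nat;
  ar : nat -> nat -> nat;
  li : nat -> nat;
  lk : nat -> K;
  mt : nat -> nat -> nat -> K;
  ll : nat -> int;
  lb : nat -> nat -> int }.

Definition upd2 (T : Type) (f : nat -> nat -> T) a i x : nat -> nat -> T :=
  fun b j => if (b == a) && (j == i) then x else f b j.
Definition upd3 (T : Type) (f : nat -> nat -> nat -> T) a i j x :=
  fun b k l => if [&& b == a, k == i & l == j] then x else f b k l.

Definition setr r v H :=
  HSt (upd (rg H) r v) (ar H) (li H) (lk H) (mt H) (ll H) (lb H).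

Variables (N S : nat).
Hypothesis N0 : 0 < N.
Hypothesis hS : 200 * (N * N) <= S.

(** The areas tile the memories: registers, low cells and 16 arrays take 64 + 19 N integer cells;
    low cells and 8 matrices take 9 N^2 field cells; labels take 14 N cells. The constant 200 is
    thus ample. All integer cells stay below [S], even those outside every area, because reading a
    larger word is a fault. *)
Definition rep (H : hst) (s : state) : Prop :=
  [/\ [/\ forall r, r < 64 -> imem s r = rg H r,
          forall x, x < 3 * N -> imem s (64 + x) = li H x,
          forall a i, a < 16 -> i < N ->
            imem s (64 + a + 3 * N + 16 * i) = ar H a i,
          forall a, imem s a < S
        & imem s 9 = N],
      forall x, x < N * N -> kmem s x = lk H x,
      forall q i j, q < 8 -> i < N -> j < N ->
        kmem s (N * N + q + 8 * (j * N + i)) = mt H q i j,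
      forall x, x < 6 * N -> lmem s x = ll H x
    & forall a i, a < 8 -> i < N -> lmem s (a + 6 * N + 8 * i) = lb H a i].

Fixpoint ev (H : hst) (e : iex) : nat :=
  match e with
  | Num n => n
  | Rg r => rg H r
  | Ar a e => ar H a (ev H e)
  | Add e1 e2 => ev H e1 + ev H e2
  | Sub e1 e2 => ev H e1 - ev H e2
  | Mul e1 e2 => ev H e1 * ev H e2
  end.

Fixpoint ok (H : hst) (e : iex) : Prop :=
  match e with
  | Num n => n < S
  | Rg r => r < 64
  | Ar a e => [/\ a < 16, ok H e & ev H e < N]
  | Add e1 e2 => [/\ ok H e1, ok H e2 & ev H e1 + ev H e2 < S]
  | Sub e1 e2 => ok H e1 /\ ok H e2
  | Mul e1 e2 => [/\ ok H e1, ok H e2 & ev H e1 * ev H e2 < S]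
  end.

Fixpoint kev (H : hst) (e : kex) : K :=
  match e with
  | KOn => 1%R
  | KMt q i j => mt H q (ev H i) (ev H j)
  | KLow x => lk H (ev H x)
  | KSb e1 e2 => (kev H e1 - kev H e2)%R
  | KMl e1 e2 => (kev H e1 * kev H e2)%R
  | KDv e1 e2 => (kev H e1 / kev H e2)%R
  end.

Definition okM (H : hst) (q : nat) (i j : iex) : Prop :=
  [/\ q < 8, ok H i /\ ok H j, ev H i < N & ev H j < N].

Fixpoint kok (H : hst) (e : kex) : Prop :=
  match e with
  | KOn => True
  | KMt q i j => okM H q i j
  | KLow x => ok H x /\ ev H x < N * N
  | KSb e1 e2 | KMl e1 e2 => kok H e1 /\ kok H e2
  | KDv e1 e2 => [/\ kok H e1, kok H e2 & kev H e2 <> 0%R]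
  end.

Fixpoint bev (H : hst) (b : bex) : bool :=
  match b with
  | Le e1 e2 => ev H e1 <= ev H e2
  | KZ e => kev H e == 0%R
  | LabLe a i b j => (lb H a (ev H i) <= lb H b (ev H j))%R
  | Not b => ~~ bev H b
  | And b1 b2 => bev H b1 && bev H b2
  end.

Definition okL (H : hst) (a : nat) (i : iex) : Prop :=
  [/\ a < 8, ok H i & ev H i < N].

Fixpoint bok (H : hst) (b : bex) : Prop :=
  match b with
  | Le e1 e2 => ok H e1 /\ ok H e2
  | KZ e => kok H e
  | LabLe a i b j => okL H a i /\ okL H b j
  | Not b => bok H b
  | And b1 b2 => bok H b1 /\ bok H b2
  end.

Section WpFor.
Variables (wpb : (hst -> Prop) -> hst -> Prop) (r : nat) (Q : hst -> Prop).
(** The loop is unrolled as often as its bound register says at entry; under [wf] this is what the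
    compiled while loop does. *)
Fixpoint wpfor (k i : nat) (H : hst) : Prop :=
  if k is k'.+1 then wpb (fun H' => wpfor k' i.+1 (setr r i.+1 H')) H else Q H.
End WpFor.

Fixpoint wp (c : hcmd) (Q : hst -> Prop) (H : hst) : Prop :=
  match c with
  | HSkip => Q H
  | SetR r e => ok H e /\ Q (setr r (ev H e) H)
  | SetA a i e =>
      [/\ ok H i, ok H e, ev H i < N &
        Q (HSt (rg H) (upd2 (ar H) a (ev H i) (ev H e)) (li H) (lk H) (mt H)
             (ll H) (lb H))]
  | SetLowI x e =>
      [/\ ok H x, ok H e, ev H x < 3 * N &
        Q (HSt (rg H) (ar H) (upd (li H) (ev H x) (ev H e)) (lk H) (mt H)
             (ll H) (lb H))]
  | SetM q i j e =>
      [/\ okM H q i j, kok H e &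
        Q (HSt (rg H) (ar H) (li H) (lk H)
             (upd3 (mt H) q (ev H i) (ev H j) (kev H e)) (ll H) (lb H))]
  | SetLowK x e =>
      [/\ ok H x, ev H x < N * N, kok H e &
        Q (HSt (rg H) (ar H) (li H) (upd (lk H) (ev H x) (kev H e)) (mt H)
             (ll H) (lb H))]
  | SetL a i b j =>
      [/\ okL H a i, okL H b j &
        Q (HSt (rg H) (ar H) (li H) (lk H) (mt H) (ll H)
             (upd2 (lb H) a (ev H i) (lb H b (ev H j))))]
  | LoadL a i x =>
      [/\ okL H a i, ok H x, ev H x < 6 * N &
        Q (HSt (rg H) (ar H) (li H) (lk H) (mt H) (ll H)
             (upd2 (lb H) a (ev H i) (ll H (ev H x))))]
  | StoreL x a i =>
      [/\ okL H a i, ok H x, ev H x < 6 * N &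
        Q (HSt (rg H) (ar H) (li H) (lk H) (mt H)
             (upd (ll H) (ev H x) (lb H a (ev H i))) (lb H))]
  | HSeq c1 c2 => wp c1 (wp c2 Q) H
  | HIf b c1 c2 => bok H b /\ (if bev H b then wp c1 Q H else wp c2 Q H)
  | For r rn c => rg H rn <= N /\ wpfor (wp c) r Q (rg H rn) 0 (setr r 0 H)
  end.

Record same (c : hcmd) (H H' : hst) : Prop := Same {
  sameR : forall r, r \notin wrR c -> rg H' r = rg H r;
  sameA : forall a i, a \notin wrA c -> ar H' a i = ar H a i;
  sameI : forall x, 0 \notin wrLow c -> li H' x = li H x;
  sameK : forall x, 1 \notin wrLow c -> lk H' x = lk H x;
  sameM : forall q i j, q \notin wrM c -> mt H' q i j = mt H q i j;
  sameLl : forall x, 2 \notin wrLow c -> ll H' x = ll H x;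
  sameL : forall a i, a \notin wrL c -> lb H' a i = lb H a i }.

Lemma wp_conseq c (Q Q' : hst -> Prop) H :
  wp c Q H -> (forall H', Q H' -> Q' H') -> wp c Q' H.
Proof.
elim: c Q Q' H => /=.
- by move=> Q Q' H HQ HH; apply: HH.
- by move=> r e Q Q' H [? HQ] HH; split=> //; apply: HH.
- by move=> a i e Q Q' H [? ? ? HQ] HH; split=> //; apply: HH.
- by move=> x e Q Q' H [? ? ? HQ] HH; split=> //; apply: HH.
- by move=> q i j e Q Q' H [? ? HQ] HH; split=> //; apply: HH.
- by move=> x e Q Q' H [? ? ? HQ] HH; split=> //; apply: HH.
- by move=> a i b j Q Q' H [? ? HQ] HH; split=> //; apply: HH.
- by move=> a i x Q Q' H [? ? ? HQ] HH; split=> //; apply: HH.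
- by move=> a i x Q Q' H [? ? ? HQ] HH; split=> //; apply: HH.
- move=> c1 IH1 c2 IH2 Q Q' H HQ HH; apply: IH1 HQ _ => H1 HQ.
  exact: IH2 HQ HH.
- move=> b c1 IH1 c2 IH2 Q Q' H [ob HQ] HH; split=> //.
  by case: (bev H b) HQ => HQ; [apply: IH1 HQ HH|apply: IH2 HQ HH].
- move=> r rn c IH Q Q' H [le HQ] HH; split=> //.
  elim: (rg H rn) 0 (setr r 0 H) HQ => /= [|k IHk] i H1 HQ; first exact: HH.
  by apply: IH HQ _ => H2 HQ; apply: IHk.
Qed.

Lemma same_trans c H1 H2 H3 : same c H1 H2 -> same c H2 H3 -> same c H1 H3.
Proof.
move=> [a1 a2 a3 a4 a5 a6 a7] [b1 b2 b3 b4 b5 b6 b7].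
split=> *; [rewrite b1|rewrite b2|rewrite b3|rewrite b4|rewrite b5|rewrite b6
  |rewrite b7]; by auto.
Qed.

Lemma same_sub c d H H' :
  {subset wrR c <= wrR d} -> {subset wrA c <= wrA d} ->
  {subset wrM c <= wrM d} -> {subset wrL c <= wrL d} ->
  {subset wrLow c <= wrLow d} -> same c H H' -> same d H H'.
Proof.
move=> sR sA sM sL sW [a1 a2 a3 a4 a5 a6 a7].
split=> [r h|a i h|x h|x h|q i j h|x h|a i h];
  [apply: a1|apply: a2|apply: a3|apply: a4|apply: a5|apply: a6|apply: a7];
  apply: contra h; by auto.
Qed.

Lemma same_setr r i rn c H : same (For r rn c) H (setr r i H).
Proof. by split=> //= r'; rewrite inE negb_or /upd => /andP[/negbTE->]. Qed.

(** Thanks to this, a specification mentions only what its program changes; the rest follows from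
    [same], whose side conditions are decided by computing the lists of written objects. *)
Lemma wp_frame c Q H : wp c Q H -> wp c (fun H' => Q H' /\ same c H H') H.
Proof.
elim: c Q H => /=; rewrite /upd2 /upd3.
- by move=> Q H HQ.
- move=> r e Q H [? HQ]; split=> //; split=> //; split=> //= r'.
  by rewrite inE /upd => /negbTE->.
- move=> a i e Q H [? ? ? HQ]; split=> //; split=> //; split=> //= a' i'.
  by rewrite inE => /negbTE->.
- by move=> x e Q H [? ? ? HQ]; split=> //; split=> //; split.
- move=> q i j e Q H [? ? HQ]; split=> //; split=> //; split=> //= q' i' j'.
  by rewrite inE => /negbTE->.
- by move=> x e Q H [? ? ? HQ]; split=> //; split=> //; split.
- move=> a i b j Q H [? ? HQ]; split=> //; split=> //; split=> //= a' i'.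
  by rewrite inE => /negbTE->.
- move=> a i x Q H [? ? ? HQ]; split=> //; split=> //; split=> //= a' i'.
  by rewrite inE => /negbTE->.
- by move=> a i x Q H [? ? ? HQ]; split=> //; split=> //; split.
- move=> c1 IH1 c2 IH2 Q H /IH1 HQ; apply: wp_conseq HQ _ => H1 [/IH2 HQ s1].
  apply: wp_conseq HQ _ => H2 [? s2]; split=> //.
  apply: (@same_trans _ _ H1).
    by apply: same_sub s1 => /= x xc; rewrite mem_cat xc.
  by apply: same_sub s2 => /= x xc; rewrite mem_cat xc orbT.
- move=> b c1 IH1 c2 IH2 Q H [ob HQ]; split=> //.
  case: (bev H b) HQ => [/IH1|/IH2] HQ; apply: wp_conseq HQ _ => H1 [? s1];
    split=> //; apply: same_sub s1 => /= x xc; by rewrite mem_cat xc ?orbT.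
- move=> r rn c IH Q H [le HQ]; split=> //.
  elim: (rg H rn) 0 (setr r 0 H) (same_setr r 0 rn c H) HQ => /= [|k IHk] i H1.
    by split.
  move=> s1 /IH HQ; apply: wp_conseq HQ _ => H2 [HQ s2]; apply: IHk HQ.
  apply: same_trans s1 (same_trans _ (same_setr _ _ _ _ _)).
  by apply: same_sub s2 => //= x xc; rewrite inE xc orbT.
Qed.

Lemma wp_use c (Q Q' : hst -> Prop) H :
  wp c Q H -> (forall H', same c H H' -> Q H' -> Q' H') -> wp c Q' H.
Proof. by move=> /wp_frame HQ HH; apply: wp_conseq HQ _ => H' [? ?]; auto. Qed.

(** The frame since the entry of the loop is handed to every iteration, so that invariants only
    track what the loop modifies. *)
Lemma wp_for r rn c (Inv : nat -> hst -> Prop) Q H n :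
  wf (For r rn c) -> rg H rn = n -> n <= N -> Inv 0 (setr r 0 H) ->
  (forall i H1, i < n -> rg H1 r = i -> same (For r rn c) H H1 -> Inv i H1 ->
     wp c (fun H2 => Inv i.+1 (setr r i.+1 H2)) H1) ->
  (forall H1, rg H1 r = n -> same (For r rn c) H H1 -> Inv n H1 -> Q H1) ->
  wp (For r rn c) Q H.
Proof.
move=> /= /and5P[_ _ r9 rrn /and3P[rc rnc wfc]] -> nN I0 IS HQ; split=> //.
have: rg (setr r 0 H) r = 0 by rewrite /= /upd eqxx.
have: n + 0 = n by lia.
have := same_setr r 0 rn c H.
elim: {1 3}n 0 (setr r 0 H) I0 => /= [|k IHk] i H1 I1 s1 ni ri.
  by rewrite add0n in ni; rewrite ni in ri I1; apply: HQ.
have /wp_frame HQ2 : wp c (fun H2 => Inv i.+1 (setr r i.+1 H2)) H1.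
  by apply: IS => //; lia.
apply: wp_conseq HQ2 _ => H2 [I2 s2]; apply: IHk => //; last 2 first.
- by lia.
- by rewrite /= /upd eqxx.
apply: same_trans s1 (same_trans _ (same_setr _ _ _ _ _)).
by apply: same_sub s2 => //= x xc; rewrite inE xc orbT.
Qed.

Lemma wp_skip (Q : hst -> Prop) H : Q H -> wp HSkip Q H.
Proof. by []. Qed.

Lemma wp_seq c1 c2 (Q : hst -> Prop) H : wp c1 (wp c2 Q) H -> wp (HSeq c1 c2) Q H.
Proof. by []. Qed.

(** * Simulation by the machine *)

Section Soundness.
Variables (H : hst) (s : state).
Hypothesis Hs : rep H s.

Lemma ieval_rN : obind (fun n => word S (imem s n)) (word S 9) = Some N.
Proof.
have NS : N < S by nia.
case: Hs => -[_ _ _ _ h9] _ _ _ _; rewrite /word.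
have -> : 9 < S by nia.
by rewrite /= h9 NS.
Qed.

Lemma compI_ok e : ok H e -> ieval S s (compI e) = Some (ev H e) /\ ev H e < S.
Proof.
have [[hr _ ha hS' _] _ _ _ _] := Hs.
elim: e => [n|r|a e IH|e1 IH1 e2 IH2|e1 IH1 e2 IH2|e1 IH1 e2 IH2].
- by move=> /= nS; rewrite /word nS.
- move=> /= r64; have rS : r < S by nia.
  by rewrite /word rS /= -hr // hS'.
- move=> [a16 /IH[e1 e2] eN]; rewrite [ieval _ _ _]/= e1 ieval_rN /= /word.
  have [h1 [h2 h3]] : 64 + a < S /\ 3 * N < S /\ 16 * ev H e < S by nia.
  have [h4 [h5 h6]] :
    64 + a + 3 * N < S /\ 64 + a + 3 * N + 16 * ev H e < S /\ 16 < S by nia.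
  have h7 : 3 < S by lia.
  by do ?[rewrite ?h1 ?h2 ?h3 ?h4 ?h5 ?h6 ?h7 /=]; rewrite hS' -ha.
- by move=> [/IH1[e1' _] /IH2[e2' _] l] /=; rewrite e1' e2' /= /word l.
- move=> [/IH1[e1' e3] /IH2[e2' _]] /=; rewrite e1' e2' /= /word.
  by have -> : ev H e1 - ev H e2 < S by lia.
- by move=> [/IH1[e1' _] /IH2[e2' _] l] /=; rewrite e1' e2' /= /word l.
Qed.

Lemma compI_val e : ok H e -> ieval S s (compI e) = Some (ev H e).
Proof. by case/compI_ok. Qed.

Lemma aadr_val a e : a < 16 -> ok H e -> ev H e < N ->
  ieval S s (aadr a (compI e)) = Some (64 + a + 3 * N + 16 * ev H e).
Proof.
move=> a16 /compI_ok[e1 e2] eN; rewrite [ieval _ _ _]/= e1 ieval_rN /= /word.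
have [h1 [h2 h3]] : 64 + a < S /\ 3 * N < S /\ 16 * ev H e < S by nia.
have [h4 [h5 h6]] :
  64 + a + 3 * N < S /\ 64 + a + 3 * N + 16 * ev H e < S /\ 16 < S by nia.
have h7 : 3 < S by lia.
by do ?[rewrite ?h1 ?h2 ?h3 ?h4 ?h5 ?h6 ?h7 /=].
Qed.

Lemma ladr_val a e : okL H a e ->
  ieval S s (ladr a (compI e)) = Some (a + 6 * N + 8 * ev H e).
Proof.
move=> [a8 /compI_ok[e1 e2] eN]; rewrite [ieval _ _ _]/= e1 ieval_rN /= /word.
have [h1 [h2 h3]] : a < S /\ 6 * N < S /\ 8 * ev H e < S by nia.
have [h4 [h5 [h6 h7]]] : a + 6 * N < S /\ a + 6 * N + 8 * ev H e < S /\
  8 < S /\ 6 < S by nia.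
by do ?[rewrite ?h1 ?h2 ?h3 ?h4 ?h5 ?h6 ?h7 /=].
Qed.

Lemma madr_val q i j : okM H q i j ->
  ieval S s (madr q (compI i) (compI j)) =
    Some (N * N + q + 8 * (ev H j * N + ev H i)).
Proof.
move=> [q8 [/compI_ok[i1 i2] /compI_ok[j1 j2]] iN jN].
rewrite [ieval _ _ _]/= i1 j1 ieval_rN /= /word.
have hj : ev H j * N + ev H i < N * N by nia.
have [h1 [h2 h3]] : q < S /\ N * N < S /\ ev H j * N < S by nia.
have [h4 [h5 [h6 h7]]] : N * N + q < S /\ ev H j * N + ev H i < S /\
  8 < S /\ 8 * (ev H j * N + ev H i) < S by nia.
have h8 : N * N + q + 8 * (ev H j * N + ev H i) < S by nia.
by do ?[rewrite ?h1 ?h2 ?h3 ?h4 ?h5 ?h6 ?h7 ?h8 /=].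
Qed.

Lemma compK_val e : kok H e -> keval S s (compK e) = Some (kev H e).
Proof.
have [_ hlk hmt _ _] := Hs.
elim: e => [|q i j|x|e1 IH1 e2 IH2|e1 IH1 e2 IH2|e1 IH1 e2 IH2].
- by [].
- move=> o; have h := madr_val o.
  change (keval S s (compK (KMt q i j))) with
    (omap (kmem s) (ieval S s (madr q (compI i) (compI j)))).
  by rewrite h /=; case: o => q8 _ iN jN; rewrite hmt.
- by move=> [ox xN] /=; rewrite compI_val //= hlk.
- by move=> [o1 o2] /=; rewrite IH1 // IH2.
- by move=> [o1 o2] /=; rewrite IH1 // IH2.
- by move=> [o1 o2 nz] /=; rewrite IH1 // IH2 //=; case: eqP.
Qed.

Lemma compB_val b : bok H b -> beval S s (compB b) = Some (bev H b).
Proof.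
have [_ _ _ _ hlb] := Hs.
elim: b => [e1 e2|e|a i b j|b IH|b1 IH1 b2 IH2].
- by move=> [o1 o2] /=; rewrite !compI_val.
- by move=> o /=; rewrite compK_val.
- move=> [o1 o2]; have h1 := ladr_val o1; have h2 := ladr_val o2.
  change (beval S s (compB (LabLe a i b j))) with
    (obind2 (fun m n => Some (lmem s m <= lmem s n)%R)
       (ieval S s (ladr a (compI i))) (ieval S s (ladr b (compI j)))).
  rewrite h1 h2 /=.
  by case: o1 o2 => a8 _ iN [b8 _ jN]; rewrite !hlb.
- by move=> o /=; rewrite IH.
- by move=> [o1 o2] /=; rewrite IH1 // IH2.
Qed.

End Soundness.

Lemma rep_setr H s r v : rep H s -> r < 64 -> r != 9 -> v < S ->
  rep (setr r v H) (State (upd (imem s) r v) (kmem s) (lmem s)).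
Proof.
move=> [[h1 h2 h3 h4 h5] k1 k2 l1 l2] r64 r9 vS; split=> //; split=> /=.
- by move=> r' hr'; rewrite /upd; case: eqP => // _; apply: h1.
- by move=> x hx; rewrite /upd; case: eqP => [|_]; [lia|apply: h2].
- by move=> a i ha hi; rewrite /upd; case: eqP => [|_]; [lia|apply: h3].
- by move=> a; rewrite /upd; case: eqP.
- by rewrite /upd eq_sym (negbTE r9).
Qed.

Lemma idxN_inj i j i' j' : i < N -> i' < N -> j * N + i = j' * N + i' ->
  i = i' /\ j = j'.
Proof.
move=> iN i'N E; have : (j * N + i) %/ N = (j' * N + i') %/ N by rewrite E.
by rewrite !divnMDl // !divn_small // !addn0 => jj; split=> //; nia.
Qed.

(** All reasoning about faults, addresses and time is confined here. Interleaved objects are told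
    apart by the residue of the address modulo the stride, and the time is bounded whatever the
    outcome of the tests. *)
Theorem wp_sound c Q H s : wf c -> wp c Q H -> rep H s ->
  exists (s' : state) t H',
    [/\ exec S (comp c) s s' t, t <= cost N (comp c), rep H' s' & Q H'].
Proof.
elim: c Q H s.
- by move=> Q H s _ HQ Hs; exists s, 1, H; split=> //; constructor.
- move=> r e Q H s /andP[r64 r9] [oe HQ] Hs; have [e1 e2] := compI_ok Hs oe.
  have rS : r < S by nia.
  exists (State (upd (imem s) r (ev H e)) (kmem s) (lmem s)), (1 + isize (compI e)).+1.
  exists (setr r (ev H e) H); split=> //; last exact: rep_setr.
  by apply: ExecISet => //=; rewrite /word rS.
- move=> a i e Q H s; rewrite [wf _]/= => a16 [oi oe iN HQ] Hs; have [e1 e2] := compI_ok Hs oe.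
  have ha := aadr_val Hs a16 oi iN.
  eexists; eexists; eexists; split; last exact: HQ.
  + exact: ExecISet ha e1.
  + by [].
  case: Hs => -[h1 h2 h3 h4 h5] k1 k2 l1 l2; split=> //; split=> /=.
  + by move=> r' hr'; rewrite /upd; case: eqP => [|_]; [lia|apply: h1].
  + by move=> x hx; rewrite /upd; case: eqP => [|_]; [lia|apply: h2].
  + move=> b j ha' hj; rewrite /upd /upd2.
    case: eqP => [E|nE]; last first.
      by case: ifP => [/andP[/eqP? /eqP?]|_]; [subst; lia|apply: h3].
    have -> : b = a by lia.
    by have -> : j = ev H i by [lia]; rewrite !eqxx.
  + by move=> x; rewrite /upd; case: eqP.
  + by rewrite /upd; case: eqP => //; lia.
- move=> x e Q H s _ [ox oe xN HQ] Hs; have [e1 e2] := compI_ok Hs oe.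
  have [x1 x2] := compI_ok Hs ox.
  have [hS1 hS2] : 64 < S /\ 64 + ev H x < S by nia.
  eexists; eexists; eexists; split; last exact: HQ.
  + by apply: ExecISet e1; rewrite /= x1 /= /word hS1 /= hS2.
  + by [].
  case: Hs => -[h1 h2 h3 h4 h5] k1 k2 l1 l2; split=> //; split=> /=.
  + by move=> r' hr'; rewrite /upd; case: eqP => [|_]; [lia|apply: h1].
  + by move=> y hy; rewrite /upd eqn_add2l; case: eqP => // _; apply: h2.
  + by move=> b j ha' hj; rewrite /upd; case: eqP => [|_]; [lia|apply: h3].
  + by move=> y; rewrite /upd; case: eqP.
  + by rewrite /upd; case: eqP => //; lia.
- move=> q i j e Q H s _ [om oe HQ] Hs; have e1 := compK_val Hs oe.
  have ha := madr_val Hs om.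
  eexists; eexists; eexists; split; last exact: HQ.
  + exact: ExecKSet ha e1.
  + by [].
  case: om => q8 _ iN jN.
  case: Hs => hI k1 k2 l1 l2; split=> //=.
  + by move=> x hx; rewrite /upd; case: eqP => [|_]; [lia|apply: k1].
  move=> q' i' j' hq hi hj; rewrite /upd /upd3.
  case: eqP => [E|nE]; last first.
    by case: ifP => [/and3P[/eqP? /eqP? /eqP?]|_]; [subst; lia|apply: k2].
  have -> : q' = q by lia.
  have /idxN_inj : j' * N + i' = ev H j * N + ev H i by lia.
  by case=> // -> ->; rewrite !eqxx.
- move=> x e Q H s _ [ox xN oe HQ] Hs; have e1 := compK_val Hs oe.
  have x1 := compI_val Hs ox.
  eexists; eexists; eexists; split; last exact: HQ.
  + exact: ExecKSet x1 e1.
  + by [].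
  case: Hs => hI k1 k2 l1 l2; split=> //=.
  + by move=> y hy; rewrite /upd; case: eqP => // _; apply: k1.
  by move=> q' i' j' hq hi hj; rewrite /upd; case: eqP => [|_]; [lia|apply: k2].
- move=> a i b j Q H s; rewrite [wf _]/= => a8 [oi oj HQ] Hs.
  have i1 := ladr_val Hs oi; have j1 := ladr_val Hs oj.
  eexists; eexists; eexists; split; last exact: HQ.
  + exact: ExecLCopy i1 j1.
  + by [].
  case: oi oj => _ _ iN [b8 _ jN].
  case: Hs => hI k1 k2 l1 l2; split=> //=.
  + by move=> y hy; rewrite /upd; case: eqP => [|_]; [lia|apply: l1].
  move=> a' i' ha hi; rewrite /upd /upd2 l2 //; case: eqP => [E|nE].
    have -> : a' = a by lia.
    by have -> : i' = ev H i by [lia]; rewrite !eqxx.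
  by case: ifP => [/andP[/eqP? /eqP?]|_]; [subst; lia|apply: l2].
- move=> a i x Q H s; rewrite [wf _]/= => a8 [oi ox xN HQ] Hs.
  have i1 := ladr_val Hs oi; have j1 := compI_val Hs ox.
  eexists; eexists; eexists; split; last exact: HQ.
  + exact: ExecLCopy i1 j1.
  + by [].
  case: oi => _ _ iN.
  case: Hs => hI k1 k2 l1 l2; split=> //=.
  + by move=> y hy; rewrite /upd; case: eqP => [|_]; [lia|apply: l1].
  move=> a' i' ha hi; rewrite /upd /upd2 l1 //; case: eqP => [E|nE].
    have -> : a' = a by lia.
    by have -> : i' = ev H i by [lia]; rewrite !eqxx.
  by case: ifP => [/andP[/eqP? /eqP?]|_]; [subst; lia|apply: l2].
- move=> x a i Q H s _ [oi ox xN HQ] Hs.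
  have i1 := ladr_val Hs oi; have j1 := compI_val Hs ox.
  eexists; eexists; eexists; split; last exact: HQ.
  + exact: ExecLCopy j1 i1.
  + by [].
  case: oi => a8 _ iN.
  case: Hs => hI k1 k2 l1 l2; split=> //=.
  + by move=> y hy; rewrite /upd l2 //; case: eqP => // _; apply: l1.
  by move=> a' i' ha hi; rewrite /upd; case: eqP => [|_]; [lia|apply: l2].
- move=> c1 IH1 c2 IH2 Q H s /= /andP[w1 w2] HQ Hs.
  have [s1 [t1 [H1 [x1 l1 r1 q1]]]] := IH1 _ _ _ w1 HQ Hs.
  have [s2 [t2 [H2 [x2 l2 r2 q2]]]] := IH2 _ _ _ w2 q1 r1.
  exists s2, (t1 + t2), H2; split=> //; last exact: leq_add.
  exact: ExecSeq x1 x2.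
- move=> b c1 IH1 c2 IH2 Q H s /= /andP[w1 w2] [ob HQ] Hs.
  have hb := compB_val Hs ob.
  have : exists s' t H', [/\ exec S (if bev H b then comp c1 else comp c2) s s' t,
    t <= cost N (comp c1) + cost N (comp c2), rep H' s' & Q H'].
    case: (bev H b) HQ => HQ.
      have [s1 [t1 [H1 [x1 l1 r1 q1]]]] := IH1 _ _ _ w1 HQ Hs.
      by exists s1, t1, H1; split=> //; lia.
    have [s1 [t1 [H1 [x1 l1 r1 q1]]]] := IH2 _ _ _ w2 HQ Hs.
    by exists s1, t1, H1; split=> //; lia.
  move=> [s1 [t1 [H1 [x1 l1 r1 q1]]]].
  exists s1, (bsize (compB b) + t1).+1, H1; split=> //; last by lia.
  exact: ExecIf hb x1.
- move=> r rn c IH Q H s.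
  have -> : wf (For r rn c) = [&& r < 64, rn < 64, r != 9, r != rn,
    r \notin wrR c, rn \notin wrR c & wf c] by [].
  have -> : wp (For r rn c) Q H =
    (rg H rn <= N /\ wpfor (wp c) r Q (rg H rn) 0 (setr r 0 H)) by [].
  move=> /and5P[r64 rn64 r9 rrn /and3P[rc rnc wfc]] [nN HQ] Hs.
  have [h0S [h1S [rS rnS]]] : 0 < S /\ 1 < S /\ r < S /\ rn < S by nia.
  set s0 := State (upd (imem s) r 0) (kmem s) (lmem s).
  have Hs0 : rep (setr r 0 H) s0 by apply: rep_setr => //; lia.
  have x0 : exec S (ISet (INum r) (INum 0)) s s0 3.
    by apply: (@ExecISet _ S s (INum r) (INum 0)); rewrite /= /word ?rS ?h0S.
  have -> : comp (For r rn c) = Seq (ISet (INum r) (INum 0))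
    (While (BNot (BLe (IGet (INum rn)) (IGet (INum r))))
       (Seq (comp c) (ISet (INum r) (IAdd (IGet (INum r)) (INum 1))))) by [].
  set b := BNot _; set c' := Seq (comp c) _.
  suff [s' [t [H' [xW lW rW qW]]]] : exists s' t H',
      [/\ exec S (While b c') s0 s' t,
         t <= rg H rn * (bsize b + cost N c').+1 + (bsize b).+1, rep H' s' & Q H'].
    exists s', (3 + t), H'; split=> //; first exact: (ExecSeq x0 xW).
    have -> : cost N (Seq (ISet (INum r) (INum 0)) (While b c')) =
      3 + (N * (bsize b + cost N c').+1 + (bsize b).+1) by [].
    have : rg H rn * (bsize b + cost N c').+1 <= N * (bsize b + cost N c').+1.
      by rewrite leq_mul2r nN orbT.
    lia.
  have bv H1 s1 : rep H1 s1 -> beval S s1 b = Some (~~ (rg H1 rn <= rg H1 r)).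
    move=> [[h _ _ hS' _] _ _ _ _].
    by rewrite /b /= /word rS rnS /= !hS' /= !h.
  have: rg (setr r 0 H) r = 0 by rewrite /= /upd eqxx.
  have: rg (setr r 0 H) rn = rg H rn by rewrite /= /upd eq_sym (negbTE rrn).
  have: rg H rn + 0 = rg H rn by lia.
  (* Only the number [k] of remaining iterations is generalized; the bound register keeps its value,
     and the equation [k + i = rg H rn] makes the test fail exactly when no iteration remains. *)
  elim: {1 2 5}(rg H rn) 0 (setr r 0 H) s0 Hs0 HQ {x0} =>
    [|k IHk] i H1 s1 r1 HQ E ern er.
    exists s1, (bsize b).+1, H1; split=> //.
    by apply: ExecWhileF; rewrite (bv _ _ r1) ern er -E add0n leqnn.
  have /wp_frame HQ' : wp c (fun H2 => wpfor (wp c) r Q k i.+1 (setr r i.+1 H2)) H1.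
    by [].
  have [s2 [t2 [H2 [x2 l2 r2 [q2 sm2]]]]] := IH _ _ _ wfc HQ' r1.
  have er2 : rg H2 r = i by rewrite (sameR sm2).
  have ern2 : rg H2 rn = rg H rn by rewrite (sameR sm2).
  have iS : i.+1 < S by nia.
  set s3 := State (upd (imem s2) r i.+1) (kmem s2) (lmem s2).
  have r3 : rep (setr r i.+1 H2) s3 by apply: rep_setr.
  have x3 : exec S (ISet (INum r) (IAdd (IGet (INum r)) (INum 1))) s2 s3 6.
    apply: (@ExecISet _ S s2 (INum r) (IAdd (IGet (INum r)) (INum 1))).
      by rewrite /= /word rS.
    have [[h _ _ hS' _] _ _ _ _] := r2.
    by rewrite /= /word rS /= hS' h // er2 h1S /= addn1 iS.
  have [|||s4 [t4 [H4 [x4 l4 r4 q4]]]] := IHk i.+1 _ s3 r3 q2.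
  + lia.
  + by rewrite /= /upd eq_sym (negbTE rrn) -ern2.
  + by rewrite /= /upd eqxx.
  exists s4, (bsize b + (t2 + 6) + t4).+1, H4; split=> //.
    apply: ExecWhileT _ (ExecSeq x2 x3) x4.
    by rewrite (bv _ _ r1) ern er; congr Some; lia.
  have : cost N c' = cost N (comp c) + 6 by [].
  lia.
Qed.

End HighLevel.

Arguments wp : simpl never.

(** * Insertion of columns *)

Section Insertion.
Local Open Scope ring_scope.
Variable K : fieldType.
Implicit Types (R V G : nat -> nat -> K) (A : nat -> bool) (pv dd : nat -> nat).

Lemma sum1 n k (F : nat -> K) : (k < n)%N ->
  \sum_(j < n) F j = F k + \sum_(j < n | j != k :> nat) F j.
Proof. by move=> kn; rewrite (bigD1 (Ordinal kn)). Qed.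

Lemma sum_only n k (F : nat -> K) : (k < n)%N ->
  (forall j, (j < n)%N -> j != k -> F j = 0) -> \sum_(j < n) F j = F k.
Proof.
by move=> kn F0; rewrite (sum1 _ kn) big1 ?addr0 // => j jk; rewrite F0.
Qed.

Lemma sum0 n (F : nat -> K) :
  (forall j, (j < n)%N -> F j = 0) -> \sum_(j < n) F j = 0.
Proof. by move=> F0; rewrite big1 // => j _; rewrite F0. Qed.

Lemma sum_ex n (F : nat -> K) : \sum_(j < n) F j <> 0 ->
  exists2 j, (j < n)%N & F j <> 0.
Proof.
move=> F0; case: (boolP [exists j : 'I_n, F j != 0]) => [/existsP[j /eqP Fj]|].
  by exists j.
rewrite negb_exists => /forallP Fj; case: F0; apply: sum0 => j jn.
by have /negPn/eqP := Fj (Ordinal jn).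
Qed.

Definition unitri n V : Prop :=
  (forall j, (j < n)%N -> V j j = 1) /\
  (forall i j, (j < i)%N -> (i < n)%N -> V i j = 0).

(** Back substitution, from the last coordinate to the first. *)
Lemma unitri_solve n V (c : nat -> K) : unitri n V ->
  exists e : nat -> K, forall k, (k < n)%N -> c k = \sum_(j < n) V k j * e j.
Proof.
move=> [V1 V0].
suff h : forall t, (t <= n)%N -> exists e : nat -> K,
    (forall k, (n - t <= k)%N -> (k < n)%N -> c k = \sum_(j < n) V k j * e j).
  by have [e He] := h n (leqnn n); exists e => k kn; apply: He => //; lia.
elim=> [|t IH] tn; first by exists (fun=> 0) => k; lia.
have [|e He] := IH; first by lia.
pose k := (n - t.+1)%N; have kn : (k < n)%N by rewrite /k; lia.
pose e' j := if j == k then c k - \sum_(j < n | j != k :> nat) V k j * e j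
             else e j.
exists e' => k' k1 k2.
have [->|k'k] := eqVneq k' k.
  rewrite (sum1 (fun j => V k j * e' j) kn) /e' eqxx V1 // mul1r.
  rewrite [X in _ + X](eq_bigr (fun j : 'I_n => V k j * e j)) ?subrK //.
  by move=> j /negbTE->.
rewrite He //; last by rewrite /k in k1 k'k *; lia.
apply: eq_bigr => j _; rewrite /e'; case: eqP => // ->.
by rewrite V0 ?mul0r //; rewrite /k in k1 k'k *; lia.
Qed.

Section Core.
Variables (m n : nat) (G : nat -> nat -> K) (y1 : nat -> int).

(* [A]: inserted columns; [pv p = k.+1]: the pivot of column [k] is [p];
   [dd k = a.+1]: column [k] became zero when column [a] was inserted. *)
Record core A R V pv dd : Prop := Core {
  cB1 : forall i j, (i < m)%N -> (j < n)%N ->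
    R i j = \sum_(k < n) G i k * V k j;
  cV : unitri n V;
  cVA : forall i j, (i < n)%N -> (j < n)%N -> V i j <> 0 ->
    i = j \/ A i /\ A j;
  cP : forall p k, (p < m)%N -> pv p = k.+1 ->
    [/\ (k < n)%N, A k, R p k <> 0,
        forall p', (p < p')%N -> (p' < m)%N -> R p' k = 0 & dd k = 0%N];
  cD : forall k, (k < n)%N -> dd k <> 0%N ->
    A k /\ forall i, (i < m)%N -> R i k = 0;
  cL : forall k a, (k < n)%N -> dd k = a.+1 ->
    [/\ (a < n)%N, A a, a = k \/ y1 k < y1 a
      & forall i, (i < n)%N -> V i k <> 0 -> y1 i <= y1 a];
  cR : forall k, (k < n)%N -> dd k = k.+1 ->
    forall j, (j < n)%N -> j <> k -> V k j = 0 }.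

Definition placed pv dd k :=
  dd k <> 0%N \/ exists2 p, (p < m)%N & pv p = k.+1.

(** In colexicographical order, the columns whose second coordinate is at most a given bound form
    such an initial segment; this is the only form in which second coordinates enter the analysis of
    insertions. *)
Definition downcl (D : nat -> bool) : Prop :=
  forall i j, (i <= j)%N -> (j < n)%N -> D j -> D i.

Lemma core_ext A A' R V pv dd : (forall k, (k < n)%N -> A k = A' k) ->
  core A R V pv dd -> core A' R V pv dd.
Proof.
move=> E [b1 b2 b3 b4 b5 b6 b7]; split=> //.
- by move=> i j ii jn /b3[]// => [->|[Ai Aj]]; [left|right; rewrite -!E].
- by move=> p k pm /b4[]// => *; split=> //; rewrite -E.
- by move=> k kn /b5[]// => *; split=> //; rewrite -E.
- by move=> k a kn /b6[]// => *; split=> //; rewrite -E.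
Qed.

(** Unitriangularity and [cVA] keep the support of the coordinates [e] inside [D] and among the
    inserted columns. Then [R e = 0], and since distinct columns have distinct pivots, no column
    owning a pivot can have a nonzero coefficient. *)
Lemma core_snapshot A R V pv dd (D : nat -> bool) (c : nat -> K) :
  core A R V pv dd ->
  (forall k, (k < n)%N -> A k -> placed pv dd k) -> downcl D ->
  (forall k, (k < n)%N -> c k <> 0 -> D k /\ A k) ->
  (forall i, (i < m)%N -> \sum_(k < n) G i k * c k = 0) ->
  exists2 e : nat -> K, (forall k, (k < n)%N -> c k = \sum_(j < n) V k j * e j) &
    forall j, (j < n)%N -> e j <> 0 -> D j /\ dd j <> 0%N.
Proof.
move=> C F Dd cs cG; have [e He] := unitri_solve c (cV C); exists e => //.
have [V1 V0] := cV C.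
have supp : forall j, (j < n)%N -> e j <> 0 -> D j /\ A j.
  suff : forall t j, (n - t <= j)%N -> (j < n)%N -> e j <> 0 -> D j /\ A j.
    by move=> h j; apply: (h n); lia.
  elim=> [|t IH] j j1 j2 ej; first by lia.
  have [j3|j3] := boolP ((n - t)%N <= j)%N; first by apply: IH.
  case: (boolP [exists k : 'I_n, [&& (k != j :> nat), V j k != 0 & e k != 0]]).
    case/existsP=> k /and3P[/eqP kj /eqP Vjk /eqP ek].
    have [Dk Ak] : D k /\ A k.
      apply: IH => //; have := V0 j k; case: (ltnP k j) => [kj' h|jk _].
        by case: Vjk; apply: h.
      by lia.
    case: (cVA C j2 (ltn_ord k) Vjk) => [jk|[Aj _]]; first by case: kj.
    split=> //; apply: Dd Dk => //; have := V0 j k; case: (ltnP k j) => // jk h.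
    by case: Vjk; apply: h.
  rewrite negb_exists => /forallP noex; apply: cs => //.
  rewrite He // (sum1 (fun k => V j k * e k) j2) V1 // mul1r big1 ?addr0 //.
  move=> k kj; have := noex k; rewrite kj /= negb_and !negbK.
  by case/orP=> /eqP->; rewrite ?mul0r ?mulr0.
have Re i : (i < m)%N -> \sum_(j < n) R i j * e j = 0.
  move=> im; rewrite -[RHS](cG i im).
  transitivity (\sum_(j < n) \sum_(k < n) G i k * V k j * e j).
    by apply: eq_bigr => j _; rewrite (cB1 C) // big_distrl.
  rewrite exchange_big /=; apply: eq_bigr => k _; rewrite He // big_distrr /=.
  by apply: eq_bigr => j _; rewrite mulrA.
(* Descending induction on the row: in row [p], columns with a smaller pivot vanish and those with a
   larger pivot already have coefficient zero, so only the owner of [p] remains. *)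
suff piv0 : forall t p k, (m - t <= p)%N -> (p < m)%N -> pv p = k.+1 -> e k = 0.
  move=> j jn ej; have [Dj Aj] := supp j jn ej; split=> //.
  case: (F j jn Aj) => // -[p pm /(piv0 m)]; rewrite subnn => h.
  by case: ej; apply: h.
elim=> [|t IH] p k p1 p2 pk; first by lia.
have [kn Ak Rk Rk0 _] := cP C p2 pk.
have := Re p p2; rewrite (@sum_only n k (fun j => R p j * e j)) //.
  by move/eqP; rewrite mulf_eq0 => /orP[/eqP|/eqP].
move=> j jn jk; case: (e j =P 0) => [->|ej]; first by rewrite mulr0.
have [Dj Aj] := supp j jn ej; case: (F j jn Aj) => [dj|[q qm qj]].
  by have [_ ->] := cD C jn dj; rewrite ?mul0r.
have [qp|pq] := ltnP q p; first by have [_ _ _ -> //] := cP C qm qj; rewrite mul0r.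
have [qE|qp] := eqVneq q p; first by move: jk; rewrite qE in qj; lia.
by case: ej; apply: IH qj => //; lia.
Qed.

Lemma core_colop A R V pv dd R' V' cur k f : core A R V pv dd ->
  (k < cur)%N -> (cur < n)%N -> A k -> A cur -> dd k = 0%N -> dd cur = 0%N ->
  (forall p, (p < m)%N -> pv p <> cur.+1) ->
  (forall i j, (i < m)%N -> (j < n)%N ->
     R' i j = if j == cur then R i j - f * R i k else R i j) ->
  (forall i j, (i < n)%N -> (j < n)%N ->
     V' i j = if j == cur then V i j - f * V i k else V i j) ->
  core A R' V' pv dd.
Proof.
move=> [b1 [b2 b2'] b3 b4 b5 b6 b7] kc cn Ak Ac dk dc pc HR HV.
have kn : (k < n)%N by lia.
split.
- move=> i j im jn; rewrite HR //.
  under eq_bigr => l _ do rewrite HV //.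
  case: eqP => [->|_]; last exact: b1.
  rewrite !b1 // big_distrr -sumrB; apply: eq_bigr => l _ /=; ring.
- split=> [j jn|i j ji ii].
    by rewrite HV //; case: eqP => [->|_]; rewrite b2 // b2' // mulr0 subr0.
  have jn : (j < n)%N by lia.
  rewrite HV //; case: eqP => [jc|_]; last exact: b2'.
  by rewrite !b2' ?mulr0 ?subr0 //; lia.
- move=> i j ii jn; rewrite HV //; case: eqP => [->|_]; last exact: b3.
  case: (V i cur =P 0) => [->|Vi _]; last by case: (b3 _ _ ii cn Vi); auto.
  case: (V i k =P 0) => [->|Vi _]; first by rewrite mulr0 subr0.
  by case: (b3 _ _ ii kn Vi) => [->|[? ?]]; right.
- move=> p j pm pj; have [jn Aj Rp Rp' dj] := b4 _ _ pm pj.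
  have jc : j == cur = false by apply/eqP => jc; apply: (pc p); rewrite -?jc.
  by split=> //; [rewrite HR // jc|move=> p' *; rewrite HR // jc Rp'].
- move=> j jn dj; have [Aj Rj] := b5 _ jn dj.
  have jc : j == cur = false by apply/eqP => jc; apply: dj; rewrite jc.
  by split=> // i im; rewrite HR // jc Rj.
- move=> j a jn dj; have [an Aa ja Vj] := b6 _ _ jn dj.
  have jc : j == cur = false by apply/eqP => jc; move: dj; rewrite jc dc.
  by split=> // i ii; rewrite HV // jc; apply: Vj.
- move=> j jn dj i ii ij; rewrite HV //; case: eqP => [ic|_]; last exact: b7.
  rewrite ic in ij *; rewrite !(b7 _ jn dj) ?mulr0 ?subr0 // => kj.
  by move: dj; rewrite -kj dk.
Qed.

Lemma core_pivot A R V pv pv' dd cur p : core A R V pv dd ->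
  (p < m)%N -> (cur < n)%N -> A cur -> dd cur = 0%N -> R p cur <> 0 ->
  (forall p', (p < p')%N -> (p' < m)%N -> R p' cur = 0) ->
  (forall q, (q < m)%N -> pv' q = if q == p then cur.+1 else pv q) ->
  core A R V pv' dd.
Proof.
move=> [b1 b2 b3 b4 b5 b6 b7] pm cn Ac dc Rp Rp' Hp; split=> //.
move=> q k qm; rewrite Hp //; case: eqP => [->|_]; last exact: b4.
by case=> <-.
Qed.

Record inserted A R V pv dd : Prop := Inserted {
  oC : core A R V pv dd;
  oF : forall k, (k < n)%N -> A k -> placed pv dd k;
  oO : forall i j, (i < n)%N -> (j < n)%N -> A i -> ~~ A j ->
    y1 i <= y1 j /\ (y1 i = y1 j -> (i < j)%N);
  (* the columns inserted so far suffice to compute the kernel at every grade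
     whose first coordinate is below those of the columns to come *)
  oH : forall (t : int) D (c : nat -> K),
    (forall j, (j < n)%N -> ~~ A j -> t < y1 j) -> downcl D ->
    (forall k, (k < n)%N -> c k <> 0 -> D k /\ y1 k <= t) ->
    (forall i, (i < m)%N -> \sum_(k < n) G i k * c k = 0) ->
    exists2 e : nat -> K,
      (forall k, (k < n)%N -> c k = \sum_(j < n) V k j * e j) &
      forall j, (j < n)%N -> e j <> 0 ->
        D j /\ exists2 a, dd j = a.+1 & y1 a <= t }.

Lemma inserted_init A R V pv dd :
  (forall k, (k < n)%N -> A k = false) ->
  (forall i j, (i < m)%N -> (j < n)%N -> R i j = G i j) ->
  (forall i j, (i < n)%N -> (j < n)%N -> V i j = if i == j then 1 else 0) ->
  (forall p, (p < m)%N -> pv p = 0%N) ->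
  (forall k, (k < n)%N -> dd k = 0%N) -> inserted A R V pv dd.
Proof.
move=> HA HR HV Hp Hd; split.
- split.
  + move=> i j im jn; rewrite HR // (@sum_only n j (fun k => G i k * V k j)) //.
      by rewrite HV // eqxx mulr1.
    by move=> k kn /negbTE kj; rewrite HV // kj mulr0.
  + split=> [j jn|i j ji ii]; first by rewrite HV ?eqxx.
    have jn : (j < n)%N by lia.
    by rewrite HV //; case: eqP => // ij; move: ji; rewrite ij ltnn.
  + by move=> i j ii jn; rewrite HV //; case: eqP => // ij; left.
  + by move=> p k pm; rewrite Hp.
  + by move=> k kn; rewrite Hd.
  + by move=> k a kn; rewrite Hd.
  + by move=> k kn; rewrite Hd.
- by move=> k kn; rewrite HA.
- by move=> i j ii jn; rewrite HA.
- move=> t D c Ht _ Hc _; exists (fun=> 0) => [k kn|//].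
  rewrite big1 => [|j _]; last by rewrite mulr0.
  case: (c k =P 0) => // /(Hc _ kn)[_ yk]; have := Ht k kn.
  by rewrite HA // ltNge yk => /(_ isT).
Qed.

(** The point is [oH]. For [t] below the first coordinate of [a], the old coordinates still work
    because columns reduced to zero are frozen. Otherwise all inserted columns have first coordinate
    at most [t], and [core_snapshot] applies to the new state. *)
Lemma inserted_step A R0 V0 pv0 dd0 a A1 R V pv dd :
  inserted A R0 V0 pv0 dd0 -> (a < n)%N -> ~~ A a ->
  (forall j, (j < n)%N -> ~~ A j -> y1 a <= y1 j /\ (y1 a = y1 j -> (a <= j)%N)) ->
  (forall k, (k < n)%N -> A1 k = (k == a) || A k) ->
  core A1 R V pv dd ->
  (forall k, (k < n)%N -> A1 k -> placed pv dd k) ->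
  (forall k, (k < n)%N -> dd0 k <> 0%N ->
     dd k = dd0 k /\ forall i, (i < n)%N -> V i k = V0 i k) ->
  inserted A1 R V pv dd.
Proof.
move=> [C0 F0 O0 H0] an nAa amin HA C F Hd; split=> //.
- move=> i j ii jn; rewrite !HA // negb_or => /orP[/eqP->|Ai] /andP[ja Aj].
    by have [? h] := amin j jn Aj; split=> // /h; move/eqP: ja; lia.
  exact: O0.
move=> t D c Ht Dd Hc cG; have [yt|yt] := ltP t (y1 a).
  have [|e He1 He2] := H0 t D c _ Dd Hc cG.
    by move=> j jn Aj; have [h _] := amin j jn Aj; apply: lt_le_trans yt h.
  exists e => [k kn|j jn ej].
    rewrite He1 //; apply: eq_bigr => j _; case: (e j =P 0) => [->|].
      by rewrite !mulr0.
    move=> /He2[]// _ [b db _]; have [|_ ->] // := Hd j (ltn_ord j).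
    by rewrite db.
  have [Dj [b db yb]] := He2 j jn ej; split=> //; exists b => //.
  by have [|-> _] := Hd j jn; rewrite db.
have [|e He1 He2] := core_snapshot C F Dd _ cG.
  move=> k kn /(Hc _ kn)[Dk yk]; split=> //.
  by apply: contraT => nA; have := Ht k kn nA; rewrite ltNge yk.
exists e => // j jn ej; have [Dj dj0] := He2 j jn ej; split=> //.
have [b dj] : exists b, dd j = b.+1 by exists (dd j).-1; lia.
exists b => //.
have [bn Ab _ _] := cL C jn dj; apply: le_trans yt.
move: Ab; rewrite HA // => /orP[/eqP->//|Ab].
by have [] := O0 b a bn an Ab nAa.
Qed.

(* State of the insertion of [a] when the last [t] rows have been scanned: [cur]
   is the column being reduced, [go] tells that it has not been placed yet. *)
Record inserting A dd V0 a t R V pv cur (go : bool) : Prop := Inserting {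
  gC : core A R V pv dd;
  gcur : [/\ (cur < n)%N, A cur & dd cur = 0%N];
  gF : forall k, (k < n)%N -> A k -> k <> cur \/ ~~ go -> placed pv dd k;
  gGo : go -> [/\ forall p, (p < m)%N -> pv p <> cur.+1,
    forall p, (m - t <= p)%N -> (p < m)%N -> R p cur = 0,
    (a <= cur)%N &
    cur = a -> forall j, (j < n)%N -> j <> a -> V a j = 0];
  gV : forall j, (j < n)%N -> dd j <> 0%N ->
    forall i, (i < n)%N -> V i j = V0 i j }.

Lemma inserting_start A A1 R V pv dd a :
  inserted A R V pv dd -> (a < n)%N -> ~~ A a ->
  (forall k, (k < n)%N -> A1 k = (k == a) || A k) ->
  inserting A1 dd V a 0 R V pv a true.
Proof.
move=> [C F O H] an nAa HA; have [b1 b2 b3 b4 b5 b6 b7] := C.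
have Adn k : (k < n)%N -> dd k <> 0%N -> k <> a.
  by move=> kn /b5[]// Ak _ ka; move: nAa; rewrite -ka Ak.
split.
- split=> //.
  + move=> i j ii jn /b3[]// => [->|[Ai Aj]]; [by left|right].
    by rewrite !HA // Ai Aj !orbT.
  + by move=> p k pm /b4[]// *; split=> //; rewrite HA // orbC; apply/orP; left.
  + by move=> k kn /b5[]// *; split=> //; rewrite HA // orbC; apply/orP; left.
  + by move=> k b kn /b6[]// *; split=> //; rewrite HA // orbC; apply/orP; left.
- split=> //; first by rewrite HA // eqxx.
  by case: (dd a =P 0%N) => // /(Adn _ an).
- move=> k kn; rewrite HA // => /orP[/eqP->|Ak _]; first by case.
  exact: F.
- move=> _; split=> // [p pm /b4[]// _ Aa|p|_ j jn ja].
  + by move: nAa; rewrite Aa.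
  + by rewrite subn0; lia.
  case: (V a j =P 0) => // /b3[]// => [aj|[Aa]]; first by case: ja.
  by move: nAa; rewrite Aa.
- by [].
Qed.

Lemma inserting_skip A dd V0 a t R V pv cur go :
  inserting A dd V0 a t R V pv cur go -> (t < m)%N ->
  (go -> R (m - 1 - t)%N cur = 0) -> inserting A dd V0 a t.+1 R V pv cur go.
Proof.
move=> [C c F G' V'] tm R0; split=> //.
move=> g; have [g1 g2 g3 g4] := G' g; split=> // p p1 p2.
have [->|pE] := eqVneq p (m - 1 - t)%N; first exact: R0.
by apply: g2 => //; lia.
Qed.

Lemma inserting_place A dd V0 a t R V pv pv' cur p :
  inserting A dd V0 a t R V pv cur true -> (t < m)%N -> p = (m - 1 - t)%N ->
  R p cur <> 0 -> pv p = 0%N ->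
  (forall q, (q < m)%N -> pv' q = if q == p then cur.+1 else pv q) ->
  inserting A dd V0 a t.+1 R V pv' cur false.
Proof.
move=> [C [cn Ac dc] F /(_ isT)[g1 g2 g3 g4] V'] tm pE Rp pp HP.
have pm : (p < m)%N by lia.
split=> //.
  by apply: core_pivot C pm cn Ac dc Rp _ HP => p' *; apply: g2; lia.
move=> k kn Ak _; have [->|kc] := eqVneq k cur.
  by right; exists p; rewrite ?HP ?eqxx.
case: (F k kn Ak) => [|dk|[q qm qk]]; first by left; apply/eqP.
  by left.
right; exists q => //; rewrite HP //; case: eqP => // qp.
by move: pp; rewrite -qp qk.
Qed.

(** The count [t] of treated rows does not advance: the evicted column still has a nonzero entry in
    row [p], to be cleared through [inserting_colop] by the column that has just taken the pivot. *)
Lemma inserting_swap A dd V0 a t R V pv pv' cur p k :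
  inserting A dd V0 a t R V pv cur true -> (t < m)%N -> p = (m - 1 - t)%N ->
  R p cur <> 0 -> pv p = k.+1 -> (cur < k)%N ->
  (forall q, (q < m)%N -> pv' q = if q == p then cur.+1 else pv q) ->
  inserting A dd V0 a t R V pv' k true.
Proof.
move=> [C [cn Ac dc] F /(_ isT)[g1 g2 g3 g4] V'] tm pE Rp pp ck HP.
have pm : (p < m)%N by lia.
have [kn Ak Rk Rk' dk] := cP C pm pp.
split=> //.
- by apply: core_pivot C pm cn Ac dc Rp _ HP => p' *; apply: g2; lia.
- move=> j jn Aj [] // jk; have [->|jc] := eqVneq j cur.
    by right; exists p; rewrite ?HP ?eqxx.
  case: (F j jn Aj) => [|dj|[q qm qj]]; first by left; apply/eqP.
    by left.
  right; exists q => //; rewrite HP //; case: eqP => // qp.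
  by move: pp; rewrite -qp qj => -[].
move=> _; split; try by lia.
  (* A column has a single last nonzero row, so the evicted column owned no pivot besides [p]. *)
  move=> q qm; rewrite HP //; case: eqP => [_|qp qk]; first by lia.
  have [_ _ Rq Rq' _] := cP C qm qk.
  have [qp'|qp'] := ltnP q p; first by case: Rk; apply: Rq'.
  by case: Rq; apply: Rk' => //; lia.
by move=> q q1 q2; apply: Rk'; lia.
Qed.

Lemma inserting_colop A dd V0 a t R V pv R' V' cur p k f :
  inserting A dd V0 a t R V pv cur true -> (t < m)%N -> p = (m - 1 - t)%N ->
  pv p = k.+1 -> (k < cur)%N -> f = R p cur / R p k ->
  (forall i j, (i < m)%N ->
     R' i j = if j == cur then R i j - f * R i k else R i j) ->
  (forall i j, (i < n)%N ->
     V' i j = if j == cur then V i j - f * V i k else V i j) ->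
  inserting A dd V0 a t.+1 R' V' pv cur true.
Proof.
move=> [C [cn Ac dc] F /(_ isT)[g1 g2 g3 g4] gV'] tm pE pp kc fE HR HV.
have pm : (p < m)%N by lia.
have [kn Ak Rk Rk' dk] := cP C pm pp.
split=> //.
- apply: core_colop C kc cn Ak Ac dk dc g1 _ _ => i j ii jn.
    exact: HR.
  exact: HV.
- move=> _; split=> //.
    move=> q q1 q2; rewrite HR // eqxx.
    have [qp|qp] := eqVneq q p.
      by rewrite qp fE divfK ?subrr //; apply/eqP.
    by rewrite g2 ?Rk' ?mulr0 ?subr0 //; lia.
  move=> ca j jn ja; have an : (a < n)%N by rewrite -ca.
  by rewrite HV //; case: eqP => [jc|_]; [case: ja; rewrite jc|apply: g4].
move=> j jn dj i ii; rewrite HV //; case: eqP => [jc|_]; last exact: gV'.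
by move: dj; rewrite jc dc.
Qed.

(** If [go] still holds after all rows, the current column is zero; it is stamped with the column
    [a] whose insertion killed it, from which the grade of the generator is read. *)
Lemma inserting_done A A1 R0 V0 pv0 dd a R V pv cur go dd' :
  inserted A R0 V0 pv0 dd -> (a < n)%N -> ~~ A a ->
  (forall j, (j < n)%N -> ~~ A j -> y1 a <= y1 j /\ (y1 a = y1 j -> (a <= j)%N)) ->
  (forall k, (k < n)%N -> A1 k = (k == a) || A k) ->
  inserting A1 dd V0 a m R V pv cur go ->
  (forall k, (k < n)%N -> dd' k = if go && (k == cur) then a.+1 else dd k) ->
  inserted A1 R V pv dd'.
Proof.
move=> I0 an nAa amin HA [C [cn Ac dc] F G' V'] Hd.
have Amax i : (i < n)%N -> A1 i -> y1 i <= y1 a.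
  move=> ii; rewrite HA // => /orP[/eqP->//|Ai].
  by have [] := oO I0 ii an Ai nAa.
have dd'0 k : (k < n)%N -> dd k <> 0%N -> dd' k = dd k.
  by move=> kn dk; rewrite Hd //; case: andP => // -[_ /eqP kc]; rewrite kc dc in dk.
apply: (inserted_step I0 an nAa amin HA); last first.
- by move=> k kn dk; rewrite dd'0 //; split=> // i ii; apply: V'.
- move=> k kn Ak; have [kc|kc] := boolP (go && (k == cur)).
    by left; rewrite Hd // kc.
  have [|dk|[p pm pk]] := F k kn Ak; last by right; exists p.
    by move: kc; rewrite negb_and => /orP[|/eqP]; auto.
  by left; rewrite dd'0.
have [b1 b2 b3 b4 b5 b6 b7] := C; split=> //.
- move=> p k pm pk; have [kn Ak Rk Rk' dk] := b4 _ _ pm pk; split=> //.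
  rewrite Hd //; case: andP => // -[g /eqP kc]; have [g1 _ _ _] := G' g.
  by case: (g1 p pm); rewrite -kc.
- move=> k kn; rewrite Hd //; case: andP => [[g /eqP->] _|_]; last exact: b5.
  have [_ g2 _ _] := G' g; split=> // i im.
  by apply: g2 => //; rewrite subnn.
- move=> k b kn; rewrite Hd //; case: andP => [[g /eqP kc] [<-]|_]; last exact: b6.
  have [_ _ g3 _] := G' g.
  split=> //; first by rewrite HA // eqxx.
    rewrite kc; have [->|ca] := eqVneq cur a; [by left|right].
    (* An evicted column has a larger index than [a] but was inserted earlier. As ties are broken by
       index, its first coordinate must be strictly smaller; minimality will rest on this. *)
    have Acur : A cur by move: Ac; rewrite HA // (negbTE ca).
    have [le ne] := oO I0 cn an Acur nAa.
    by rewrite lt_neqAle le andbT; apply/eqP => /ne; lia.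
  move=> i ii; rewrite kc => Vi; apply: Amax => //.
  by case: (b3 _ _ ii cn Vi) => [->//|[]].
move=> k kn; rewrite Hd //; case: andP => [[g /eqP kc] [ak]|_]; last exact: b7.
have [_ _ _ g4] := G' g; move=> j jn jk; rewrite -ak; apply: g4 => //; lia.
Qed.

End Core.
End Insertion.

(** * Kernels, lifting and elimination *)

Section Reduction.
Local Open Scope ring_scope.
Variable K : fieldType.
Implicit Types (G V h U : nat -> nat -> K) (c d e v : nat -> K).

Definition app n (A : nat -> nat -> K) (c : nat -> K) (i : nat) : K :=
  \sum_(j < n) A i j * c j.

(** Such a [c] is the coordinate vector of an element of grade [z] in the free module on the
    generators selected by [p]. *)
Definition supported n (l : nat -> grade) (p : nat -> bool) (z : grade) c : Prop :=
  forall i, (i < n)%N -> c i <> 0 -> p i /\ gle (l i) z.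

Definition sorted_labels n (l : nat -> grade) : Prop :=
  forall i j, (i <= j)%N -> (j < n)%N -> colex (l i) (l j).

Lemma appB n A c d i : app n A (fun j => c j - d j) i = app n A c i - app n A d i.
Proof. by rewrite /app -sumrB; apply: eq_bigr => j _; rewrite mulrBr. Qed.

Lemma appD n A c d i : app n A (fun j => c j + d j) i = app n A c i + app n A d i.
Proof. by rewrite /app -big_split; apply: eq_bigr => j _; rewrite mulrDr. Qed.

Lemma app_ext n A c d i : (forall j, (j < n)%N -> c j = d j) ->
  app n A c i = app n A d i.
Proof. by move=> E; apply: eq_bigr => j _; rewrite E. Qed.

Lemma app_extl n A B c i : (forall j, (j < n)%N -> A i j = B i j) ->
  app n A c i = app n B c i.
Proof. by move=> E; apply: eq_bigr => j _; rewrite E. Qed.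

Lemma app_comp n k A B c i :
  app n (fun a b => app k A (fun l => B l b) a) c i = app k A (app n B c) i.
Proof.
rewrite /app; under eq_bigr => j _ do rewrite big_distrl /=.
rewrite exchange_big /=; apply: eq_bigr => l _; rewrite big_distrr /=.
by apply: eq_bigr => j _; rewrite mulrA.
Qed.

Lemma app_ex n A c i : app n A c i <> 0 ->
  exists2 j, (j < n)%N & A i j <> 0 /\ c j <> 0.
Proof.
move/(@sum_ex _ _ (fun j => A i j * c j)) => [j jn Ac]; exists j => //.
by split=> E; apply: Ac; rewrite E ?mul0r ?mulr0.
Qed.

Lemma unitri_inj n V c d : unitri n V ->
  (forall i, (i < n)%N -> app n V c i = app n V d i) ->
  forall i, (i < n)%N -> c i = d i.
Proof.
move=> [V1 V0] E.
suff h t i : (n - t <= i)%N -> (i < n)%N -> c i = d i.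
  by move=> i; apply: (h n); lia.
elim: t i => [|t IH] i i1 i2; first by lia.
have := E i i2; rewrite /app (sum1 (fun j => V i j * c j) i2).
rewrite (sum1 (fun j => V i j * d j) i2) V1 // !mul1r.
rewrite [X in _ + X = _](eq_bigr (fun j : 'I_n => V i j * d j)); first exact: addIr.
move=> j ji; have [jl|il] := ltnP j i; first by rewrite V0 // !mul0r.
by rewrite IH //; lia.
Qed.

Lemma gle_refl z : gle z z. Proof. by rewrite /gle !lexx. Qed.

Lemma gle_anti y z : gle y z -> gle z y -> y = z.
Proof.
case: y z => [a b] [c d] /andP[/= h1 h2] /andP[/= h3 h4].
by congr pair; apply/eqP; rewrite eq_le ?h1 ?h2 ?h3 ?h4.
Qed.

Lemma colex2 y z : colex y z -> y.2 <= z.2.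
Proof. by case/orP => [/ltW//|/andP[/eqP-> _]]. Qed.

Lemma colex1 y z : colex y z -> z.2 <= y.2 -> y.1 <= z.1.
Proof. by case/orP => [yz zy|/andP[_ ->//]]; move: yz; rewrite ltNge zy. Qed.

(** The second coordinates are squeezed to a common value, after which [colex] compares the first
    ones. This will protect the columns already treated by the elimination. *)
Lemma colex_gle_between x y w : colex x y -> gle y w -> gle w x -> gle x w.
Proof.
move=> xy /andP[yw1 yw2] /andP[wx1 wx2].
have xy1 := colex1 xy (le_trans yw2 wx2).
by rewrite /gle (le_trans xy1) // (le_trans (colex2 xy)).
Qed.

(** * Generators of the kernel at every grade *)

Section Kernel.
Variables (m n : nat) (G : nat -> nat -> K) (y : nat -> grade).
Variables (R V : nat -> nat -> K) (pv dd : nat -> nat).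
Hypothesis ys : sorted_labels n y.
Hypothesis I : inserted m n G (fun j => (y j).1) (fun=> true) R V pv dd.

Definition kerlab (j : nat) : grade := ((y (dd j).-1).1, (y j).2).

Lemma kernel_V j : (j < n)%N -> dd j <> 0%N ->
  (forall i, (i < n)%N -> V i j <> 0 -> gle (y i) (kerlab j)) /\
  forall i, (i < m)%N -> app n G (V^~ j) i = 0.
Proof.
move=> jn dj; have C := oC I; have [b ddj] : exists b, dd j = b.+1.
  by exists (dd j).-1; lia.
have [an _ _ Vj] := cL C jn ddj; split=> [i ii Vij|i im].
  rewrite /gle /kerlab ddj /= (Vj i ii Vij) /=; apply: colex2; apply: ys => //.
  by rewrite leqNgt; apply/negP => ji; apply: Vij; apply: (cV C).2.
by rewrite /app -(cB1 C) //; apply: (cD C jn dj).2.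
Qed.

(** This is [oH] with every column inserted, [t] being the first coordinate of [z] and [D] the
    columns whose second coordinate is at most that of [z]. *)
Lemma kernel_span z c : supported n y predT z c ->
  (forall i, (i < m)%N -> app n G c i = 0) ->
  exists2 e, supported n kerlab (fun j => dd j != 0%N) z e &
    forall k, (k < n)%N -> c k = app n V e k.
Proof.
move=> sc Gc.
have [||||e He1 He2] := @oH _ _ _ _ _ _ _ _ _ _ I z.1 (fun k => (y k).2 <= z.2) c.
- by [].
- by move=> i j ij jn; apply: le_trans; apply: colex2; apply: ys.
- by move=> k kn /(sc k kn)[_ /andP[]].
- by [].
exists e => // j jn ej; have [Dj [a da ya]] := He2 j jn ej.
by rewrite da /gle /kerlab da /= ya Dj.
Qed.

(* The columns killed at their own insertion are exactly those that are
   redundant generators of the image; they do not occur in the other kernel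
   elements. *)
Lemma kernel_redundant j : (j < n)%N -> dd j = j.+1 -> kerlab j = y j /\
  forall k, (k < n)%N -> k <> j -> V j k = 0.
Proof.
move=> jn dj; rewrite /kerlab dj; split; first by case: (y j).
exact: (cR (oC I) jn dj).
Qed.

(** If the labels agreed, column [i], which does not come after [j], would share its second
    coordinate and hence have at most its first coordinate. But by [cL] a generator found when
    another column is inserted has a strictly larger first coordinate than [y j]. *)
Lemma kernel_strict i j : (i < n)%N -> (j < n)%N -> dd j <> 0%N -> dd j <> j.+1 ->
  V i j <> 0 -> y i <> kerlab j.
Proof.
move=> ii jn dj djj Vij E; have C := oC I.
have [b ddj] : exists b, dd j = b.+1 by exists (dd j).-1; lia.
have [an _ ja Vj] := cL C jn ddj.
have ij : (i <= j)%N.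
  by rewrite leqNgt; apply/negP => ji; apply: Vij; apply: (cV C).2.
have := ys ij jn; rewrite E /kerlab ddj /= => /colex1 /(_ (lexx _)) /= ya.
by case: ja => [bj|]; [apply: djj; rewrite ddj bj|rewrite ltNge ya].
Qed.

End Kernel.

(** * Cancelling generators against relations of the same grade *)

Section Elimination.
Variables (nY nX : nat) (h0 : nat -> nat -> K) (p0 : nat -> bool).
Variables (w x : nat -> grade).
Hypothesis xs : sorted_labels nX x.

(* [h] is the matrix after elimination of the columns before [cur], which have
   no entry left whose row and column labels agree; [p] are the remaining rows. *)
Record eliminated (cur : nat) h (p : nat -> bool) : Prop := Eliminated {
  eE : forall i j, (i < nY)%N -> (j < nX)%N -> h i j <> 0 ->
    p i /\ gle (w i) (x j);
  eS : forall z v, supported nY w p0 z v -> exists v' d,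
    [/\ supported nY w p z v', supported nX x predT z d &
      forall i, (i < nY)%N -> v i = v' i + app nX h0 d i];
  eI : forall z v, supported nY w p z v ->
    ((exists2 d, supported nX x predT z d &
        forall i, (i < nY)%N -> v i = app nX h0 d i) <->
     (exists2 e, supported nX x predT z e &
        forall i, (i < nY)%N -> v i = app nX h e i));
  eM : forall i j, (i < nY)%N -> (j < cur)%N -> (j < nX)%N -> h i j <> 0 ->
    ~~ gle (x j) (w i) }.

Lemma eliminated_init h : (forall i j, (i < nY)%N -> (j < nX)%N -> h i j = h0 i j) ->
  (forall i j, (i < nY)%N -> (j < nX)%N -> h0 i j <> 0 ->
    p0 i /\ gle (w i) (x j)) -> eliminated 0 h p0.
Proof.
move=> hE H; split=> //.
- by move=> i j ii jn; rewrite hE //; apply: H.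
- move=> z v sv; exists v, (fun=> 0); split=> // i ii.
  by rewrite /app big1 ?addr0 // => j _; rewrite mulr0.
- move=> z v sv; split=> -[d sd E]; exists d => // i ii; rewrite E //;
    apply: app_extl => j jn; by rewrite hE.
Qed.

Lemma eliminated_skip j h p : eliminated j h p -> (j < nX)%N ->
  (forall i, (i < nY)%N -> p i -> h i j <> 0 -> ~~ gle (x j) (w i)) ->
  eliminated j.+1 h p.
Proof.
move=> [E S I M] jn H; split=> // i l ii; rewrite ltnS leq_eqVlt.
case/orP => [/eqP->|lj] ln hl; last exact: M.
by have [pi _] := E _ _ ii ln hl; apply: H.
Qed.

(** By [eE] generator [i] and relation [j] have the same label, so that subtracting multiples of
    column [j] from the columns meeting row [i] respects grades. Earlier columns do not meet row
    [i]: by [colex_gle_between] such an entry would contradict [eM]. *)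
Lemma eliminated_step i j h p h' p' : eliminated j h p ->
  (i < nY)%N -> (j < nX)%N -> p i -> h i j <> 0 -> gle (x j) (w i) ->
  (forall k l, (k < nY)%N -> (l < nX)%N -> h' k l = h k l - h i l / h i j * h k j) ->
  (forall k, (k < nY)%N -> p' k = p k && (k != i)) ->
  eliminated j.+1 h' p'.
Proof.
move=> [E S I M] ii jn pi hij xw Hh Hp.
have hij0 : h i j != 0 by apply/eqP.
have app' e k : (k < nY)%N ->
    app nX h' e k = app nX h e k - h k j * (app nX h e i / h i j).
  move=> kn; rewrite /app.
  under eq_bigr => l _ do rewrite Hh // mulrBl.
  rewrite sumrB; congr (_ - _); rewrite big_distrl /= big_distrr /=.
  by apply: eq_bigr => l _; ring.
have appj q k : app nX h (fun l => if l == j then q else 0) k = h k j * q.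
  rewrite /app (@sum_only _ nX j (fun l => h k l * (if l == j then q else 0))) //.
    by rewrite eqxx.
  by move=> l ln /negbTE->; rewrite mulr0.
have Sj z q : (q <> 0 -> gle (x j) z) ->
    supported nX x predT z (fun l => if l == j then q else 0).
  by move=> hq l ln /=; case: eqP => // -> /hq.
split.
- move=> k l kn ln; rewrite Hh // Hp //.
  have [->|ki] := eqVneq k i; first by rewrite divfK // subrr.
  rewrite andbT => hkl; have [h0'|/eqP hkl0] := eqVneq (h k l) 0; last exact: E.
  have [hil hkj] : h i l <> 0 /\ h k j <> 0.
    by split=> F; apply: hkl; rewrite h0' F ?mul0r ?mulr0 subr0.
  have [pk wx] := E _ _ kn jn hkj; have [_ wx'] := E _ _ ii ln hil; split=> //.
  exact: gle_trans wx (gle_trans xw wx').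
- move=> z v /S[v' [d [sv' sd vE]]].
  (* Subtracting [q] times relation [j] kills coordinate [i]; by [eI] the subtracted multiple is a
     combination [d'] of the original relations. *)
  pose q := v' i / h i j.
  have qz : q <> 0 -> gle (x j) z.
    move=> q0; have [] := sv' i ii; last by move=> _; apply: gle_trans xw.
    by move=> v0; apply: q0; rewrite /q v0 mul0r.
  have sj : supported nY w p z (fun k => h k j * q).
    move=> k kn hq; have [hk q0] : h k j <> 0 /\ q <> 0.
      by split=> F; apply: hq; rewrite F ?mul0r ?mulr0.
    have [pk wx] := E _ _ kn jn hk; split=> //; apply: gle_trans wx _; exact: qz.
  have [_ [|d' sd' dE]] := I z _ sj.
    by exists (fun l => if l == j then q else 0); [exact: Sj|move=> *; rewrite appj].
  exists (fun k => v' k - h k j * q), (fun l => d l + d' l); split.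
  + move=> k kn; rewrite Hp //; have [->|ki] := eqVneq k i.
      by rewrite /q mulrC divfK // subrr.
    rewrite andbT; have [->|/eqP v0] := eqVneq (v' k) 0; last first.
      by move=> _; apply: sv'.
    move=> hq; apply: sj => // F; by apply: hq; rewrite F subr0.
  + move=> l ln dl; have [d0|/eqP d0] := eqVneq (d l) 0; last exact: sd.
    by apply: sd' => // F; apply: dl; rewrite d0 F addr0.
  + move=> k kn; rewrite vE // appD -dE //; ring.
- move=> z v sv; have svp : supported nY w p z v.
    by move=> k kn /(sv k kn); rewrite Hp // => -[/andP[-> _]].
  have vi : v i = 0.
    have [//|/eqP v0] := eqVneq (v i) 0.
    by have [] := sv i ii v0; rewrite Hp // eqxx andbF.
  rewrite I //; split=> -[e se vE].
    by exists e => // k kn; rewrite app' // -!vE // vi mul0r mulr0 subr0.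
  (* Applying [h'] to [e] amounts to applying [h] to [e] with coefficient [j] lowered by [q]. *)
  pose q := app nX h e i / h i j.
  exists (fun l => e l - (if l == j then q else 0)); last first.
    by move=> k kn; rewrite appB appj vE // app'.
  move=> l ln el; have [e0|/eqP e0] := eqVneq (e l) 0; last exact: se.
  have q0 : (if l == j then q else 0) <> 0.
    by move=> F; apply: el; rewrite e0 F subr0.
  apply: Sj q0 => // q0; have [] := @app_ex nX h e i.
    by move=> F; apply: q0; rewrite /q F mul0r.
  move=> l' ln' [hl el']; have [_ xz] := se l' ln' el'.
  by have [_ wx] := E _ _ ii ln' hl; apply: gle_trans xw (gle_trans wx xz).
move=> k l kn; rewrite ltnS leq_eqVlt => /orP[/eqP->|lj] ln; rewrite Hh //.
  by rewrite divff // mul1r subrr.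
have -> : h i l = 0.
  have [//|/eqP hil] := eqVneq (h i l) 0.
  have [_ wx] := E _ _ ii ln hil; have := M _ _ ii lj ln hil.
  by rewrite (colex_gle_between (xs (ltnW lj) jn) xw wx).
by rewrite !mul0r subr0; apply: M.
Qed.

End Elimination.
Section Lift.
Variables (nZ nY nX : nat) (G F : nat -> nat -> K) (y x : nat -> grade).
Variables (R V : nat -> nat -> K) (pv dd : nat -> nat) (w : nat -> grade).
Hypothesis ys : sorted_labels nY y.
Hypothesis FY : forall i j, (i < nY)%N -> (j < nX)%N -> F i j <> 0 -> gle (y i) (x j).
Hypothesis GF : forall l j, (l < nZ)%N -> (j < nX)%N -> app nY G (F^~ j) l = 0.
Hypothesis I : inserted nZ nY G (fun j => (y j).1) (fun=> true) R V pv dd.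
Hypothesis wE : forall j, (j < nY)%N -> dd j <> 0%N -> w j = kerlab y dd j.

(** By uniqueness of coordinates with respect to the unitriangular [V], back substitution finds the
    coordinates provided by [kernel_span]; these use only kernel generators, of grade at most
    [x j]. *)
Lemma lift_supported h0 :
  (forall k j, (k < nY)%N -> (j < nX)%N -> F k j = app nY V (h0^~ j) k) ->
  forall i j, (i < nY)%N -> (j < nX)%N -> h0 i j <> 0 ->
    dd i != 0%N /\ gle (w i) (x j).
Proof.
move=> Fh i j ii jn h0ij.
have sF : supported nY y predT (x j) (F^~ j).
  by move=> k kn Fk; split=> //; apply: FY.
have [e se eE] := kernel_span ys I sF (fun l ln => GF ln jn).
have eh : e i = h0 i j.
  apply: (unitri_inj (d := h0^~ j) (cV (oC I))) ii => k kn.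
  by rewrite -eE // Fh.
have [|di wi] := se i ii; first by rewrite eh.
by split=> //; rewrite wE //; apply/eqP.
Qed.

End Lift.

(** * The resolution in coordinates *)

Section Result.
Variables (nZ nY nX : nat) (G F : nat -> nat -> K) (y x : nat -> grade).

(** The interface between programs and modules: at every grade, syzygies ([p2], [u]), relations
    ([p1], [x]) and generators ([p0], [w]) resolve the quotient of [ker G] by [im F], a generator
    being sent to its column of [V]. The strict inequalities of labels in [rh] and [rU] express
    minimality. *)
Record resolved h U (p0 p1 p2 : nat -> bool) (w u : nat -> grade) V : Prop := Resolved {
  rV : forall i, (i < nY)%N -> p0 i ->
    (forall k, (k < nY)%N -> V k i <> 0 -> gle (y k) (w i)) /\
    forall l, (l < nZ)%N -> app nY G (V^~ i) l = 0;
  rsurj : forall z c, supported nY y predT z c ->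
    (forall l, (l < nZ)%N -> app nY G c l = 0) -> exists v d,
    [/\ supported nY w p0 z v, supported nX x predT z d &
      forall k, (k < nY)%N -> c k = app nY V v k + app nX F d k];
  rrel : forall z v, supported nY w p0 z v ->
    ((exists2 d, supported nX x predT z d &
        forall k, (k < nY)%N -> app nY V v k = app nX F d k) <->
     (exists2 e, supported nX x p1 z e &
        forall i, (i < nY)%N -> v i = app nX h e i));
  rh : forall i j, (i < nY)%N -> (j < nX)%N -> h i j <> 0 ->
    [/\ p0 i, gle (w i) (x j) & w i <> x j];
  rU : forall j, (j < nX)%N -> p2 j ->
    (forall i, (i < nX)%N -> U i j <> 0 ->
       [/\ p1 i, gle (x i) (u j) & x i <> u j]) /\
    forall l, (l < nY)%N -> app nX h (U^~ j) l = 0;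
  rker : forall z e, supported nX x p1 z e ->
    (forall l, (l < nY)%N -> app nX h e l = 0) ->
    exists2 d, supported nX u p2 z d &
      forall i, (i < nX)%N -> e i = app nX U d i;
  rinj : forall d, (forall i, (i < nX)%N -> app nX U d i = 0) ->
    forall j, (j < nX)%N -> d j = 0 }.

Hypothesis ys : sorted_labels nY y.
Hypothesis xs : sorted_labels nX x.
Hypothesis FY : forall i j, (i < nY)%N -> (j < nX)%N -> F i j <> 0 -> gle (y i) (x j).
Hypothesis GF : forall l j, (l < nZ)%N -> (j < nX)%N -> app nY G (F^~ j) l = 0.

Lemma resolution_result R1 V pv1 dd1 w h0 h p0 R2 U pv2 dd2 (p1 p2 : nat -> bool) u :
  inserted nZ nY G (fun j => (y j).1) (fun=> true) R1 V pv1 dd1 ->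
  (forall j, (j < nY)%N -> dd1 j <> 0%N -> w j = kerlab y dd1 j) ->
  (forall k j, (k < nY)%N -> (j < nX)%N -> F k j = app nY V (h0^~ j) k) ->
  eliminated nY nX h0 (fun j => dd1 j != 0%N) w x nX h p0 ->
  (forall i, (i < nY)%N -> p0 i -> dd1 i != 0%N) ->
  inserted nY nX h (fun j => (x j).1) (fun=> true) R2 U pv2 dd2 ->
  (forall j, (j < nX)%N -> p1 j = (dd2 j != j.+1)) ->
  (forall j, (j < nX)%N -> p2 j = (dd2 j != 0%N) && (dd2 j != j.+1)) ->
  (forall j, (j < nX)%N -> p2 j -> u j = kerlab x dd2 j) ->
  resolved h U p0 p1 p2 w u V.
Proof.
move=> I1 wE Fh El p0d I2 p1E p2E uE.
have C2 := oC I2; have [U1 U0] := cV C2.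
have FE z d : supported nX x predT z d -> forall k, (k < nY)%N ->
    app nX F d k = app nY V (app nX h0 d) k.
  move=> _ k kn; rewrite -app_comp; apply: app_extl => j jn; exact: Fh.
have fromp z v : supported nY w p0 z v -> supported nY w (fun j => dd1 j != 0%N) z v.
  by move=> sv i ii /(sv i ii)[pi wz]; split=> //; apply: p0d.
have redE j k : (j < nX)%N -> ~~ p1 j -> (k < nX)%N -> k <> j -> U j k = 0.
  move=> jn; rewrite p1E // negbK => /eqP dj.
  exact: (kernel_redundant I2 jn dj).2.
have redlab j : (j < nX)%N -> ~~ p1 j ->
    (forall i, (i < nX)%N -> U i j <> 0 -> gle (x i) (x j)) /\
    forall l, (l < nY)%N -> app nX h (U^~ j) l = 0.
  move=> jn; rewrite p1E // negbK => /eqP dj.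
  have [dj0 kE] : dd2 j <> 0%N /\ kerlab x dd2 j = x j.
    by split; [rewrite dj|exact: (kernel_redundant I2 jn dj).1].
  by have := kernel_V xs I2 jn dj0; rewrite kE.
have rowE j d : (j < nX)%N -> ~~ p1 j -> app nX U d j = d j.
  move=> jn pj; rewrite /app (@sum_only _ nX j (fun k => U j k * d k)) //.
    by rewrite U1 // mul1r.
  by move=> k kn /eqP kj; rewrite redE // mul0r.
split.
- move=> i ii /p0d di; have {di}/eqP di := di ii; rewrite wE //.
  exact: (kernel_V ys I1 ii di).
- move=> z c sc Gc; have [e se eE] := kernel_span ys I1 sc Gc.
  have se' : supported nY w (fun j => dd1 j != 0%N) z e.
    by move=> i ii /(se i ii)[di ?]; rewrite wE //; apply/eqP.
  have [v [d [sv sd ev]]] := eS El se'; exists v, d; split=> // k kn.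
  rewrite eE // (FE _ _ sd) // -appD; exact: app_ext.
- move=> z v sv; split.
    move=> [d sd vE]; have [|e se eE] := (eI El sv).1.
      exists d => //; apply: (unitri_inj (cV (oC I1))) => k kn.
      by rewrite vE // (FE _ _ sd).
    (* For a redundant [j], row [j] of [U] is a unit row, so subtracting these kernel elements
       clears all redundant coefficients at once without changing the image under [h]. *)
    pose e' i := e i - app nX U (fun j => if p1 j then 0 else e j) i.
    exists e'; last first.
      move=> i ii; rewrite eE // /e' appB -[LHS]subr0; congr (_ - _).
      rewrite -app_comp [RHS]/app big1 // => j _; case: ifP => [_|/negbT pj].
        by rewrite mulr0.
      by rewrite (redlab j (ltn_ord j) pj).2 // mul0r.
    move=> i ii e'i; split.
      by apply: contraT => pi; case: e'i; rewrite /e' rowE // (negbTE pi) subrr.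
    have [ei|/eqP ei] := eqVneq (e i) 0; last by have [] := se i ii ei.
    have [|j jn [Uij]] := @app_ex nX U (fun j => if p1 j then 0 else e j) i.
      by move=> E; apply: e'i; rewrite /e' ei E subr0.
    case: ifP => // /negbT pj ej; have [_ xz] := se j jn ej.
    exact: gle_trans ((redlab j jn pj).1 i ii Uij) xz.
  move=> [e se vE]; have [|d sd dE] := (eI El sv).2.
    by exists e => // i ii /(se i ii)[].
  exists d => // k kn; rewrite (FE _ _ sd) //; exact: app_ext.
- move=> i j ii jn hij; have [pi wx] := eE El ii jn hij; split=> // E.
  by have := eM El ii jn jn hij; rewrite -E gle_refl.
- move=> j jn pj; have := pj; rewrite p2E // => /andP[/eqP dj /eqP djj].
  have [Uj hU] := kernel_V xs I2 jn dj; rewrite uE //; split=> // i ii Uij.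
  split; [|exact: Uj|exact: kernel_strict xs I2 _ _ ii jn dj djj Uij].
  apply: contraT => pi; case: Uij; apply: redE => // ji.
  by move: pi; rewrite p1E // negbK -ji => /eqP.
- move=> z e se he; have [||d sd dE] := kernel_span xs I2 (z := z) (c := e).
  + by move=> i ii /(se i ii)[].
  + exact: he.
  exists d => // j jn dj; have [dj0 kz] := sd j jn dj.
  (* At a redundant [j] the coefficient [d j] equals [e j], which is zero there. *)
  have p1j : p1 j.
    apply: contraT => pj; have : e j <> 0 by rewrite dE // rowE.
    by move/(se j jn) => [pj' _]; rewrite pj' in pj.
  have p2j : p2 j by rewrite p2E // dj0 -p1E.
  by split=> //; rewrite uE.
- move=> d dE j jn; apply: (unitri_inj (d := fun=> 0) (cV C2)) jn => i ii.
  by rewrite dE // /app big1 // => k _; rewrite mulr0.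
Qed.

End Result.
End Reduction.

(** * Programs *)

Notation "a ;; b" := (HSeq a b) (at level 60, right associativity).

Lemma ltSE i j : (i < j.+1) = (i == j) || (i < j).
Proof. by rewrite ltnS leq_eqVlt. Qed.

Definition sel (p : nat -> bool) n : seq nat := [seq i <- iota 0 n | p i].

Lemma selS p n : sel p n.+1 = if p n then rcons (sel p n) n else sel p n.
Proof.
rewrite /sel -addn1 iotaD filter_cat /= add0n.
by case: (p n); rewrite ?cats1 ?cats0.
Qed.

Lemma size_sel p n : size (sel p n) <= n.
Proof. by rewrite size_filter (leq_trans (count_size _ _)) ?size_iota. Qed.

Lemma sel_nth p n k : k < size (sel p n) ->
  nth 0 (sel p n) k < n /\ p (nth 0 (sel p n) k).
Proof. by move/(mem_nth 0); rewrite mem_filter mem_iota => /andP[pk kn]. Qed.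

Lemma sel_mem (p : pred nat) n i : i < n -> p i -> exists2 k, k < size (sel p n) & nth 0 (sel p n) k = i.
Proof.
move=> ii pi; have ms : i \in sel p n by rewrite mem_filter pi mem_iota.
by exists (index i (sel p n)); rewrite ?index_mem // nth_index.
Qed.

Lemma sel_inj p n k l : k < size (sel p n) -> l < size (sel p n) ->
  nth 0 (sel p n) k = nth 0 (sel p n) l -> k = l.
Proof.
move=> kn ln /eqP; rewrite nth_uniq ?filter_uniq ?iota_uniq //; exact: eqP.
Qed.

Definition count_below (p : pred nat) n := count p (iota 0 n).
Arguments count_below : simpl never.

Lemma count_belowS (p : pred nat) n : count_below p n.+1 = count_below p n + p n.
Proof. by rewrite /count_below -addn1 iotaD count_cat /= addn0. Qed.

Lemma count_below_le p n : count_below p n <= n.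
Proof. by rewrite (leq_trans (count_size _ _)) ?size_iota. Qed.

Section Programs.
Variable K : fieldType.
Variables (N S : nat).
Hypothesis N0 : 0 < N.
Hypothesis hS : 200 * (N * N) <= S.
Local Notation hst := (hst K).
Local Notation wp := (@wp K N S).
Implicit Types H : hst.

Ltac sdone := try done; try lia; try nia.
Ltac side := rewrite /= /okM /okL /= /upd3 /upd2 /upd /=; repeat split; sdone.
Ltac step1 := apply: wp_seq; split; [by side|].
Ltac step2 := apply: wp_seq; split; [by side|by side|].
Ltac step3 := apply: wp_seq; split; [by side|by side|by side|].
Tactic Notation "loop" constr(n) constr(I) :=
  apply: (@wp_for K N S N0 hS _ _ _ I _ _ n) => //.

(* Registers: 10, 11, 12 hold |X|, |Y|, |Z|; 13, 14 the numbers of rows and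
   columns of the matrix to be reduced.  Matrices: 0 is f, then its lift; 1 and 2
   are the reduced matrix and the column operations; 4 and 5 are temporary.
   Label arrays, in pairs: 0 for X, 2 for Y (2 holds the first coordinates of the
   columns to be reduced, hence later those of X), 4 for ker g, 6 for the kernel
   of the lift.  Arrays: 0, 1, 2 hold the pivots, the inserted columns and the
   columns reduced to zero, the indices of columns being shifted by one; 3, 4, 5
   mark the generators, relations and syzygies that are kept. *)
Definition colop : hcmd :=
  SetM 5 (Num 0) (Num 0)
    (KDv (KMt 1 (Rg 24) (Rg 25)) (KMt 1 (Rg 24) (Rg 28)));;
  For 26 13 (SetM 1 (Rg 26) (Rg 25) (KSb (KMt 1 (Rg 26) (Rg 25))
    (KMl (KMt 5 (Num 0) (Num 0)) (KMt 1 (Rg 26) (Rg 28)))));;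
  For 26 14 (SetM 2 (Rg 26) (Rg 25) (KSb (KMt 2 (Rg 26) (Rg 25))
    (KMl (KMt 5 (Num 0) (Num 0)) (KMt 2 (Rg 26) (Rg 28))))).

Lemma colop_spec H m n p cur k (f : K) :
  rg H 13 = m -> rg H 14 = n -> rg H 24 = p -> rg H 25 = cur -> rg H 28 = k ->
  m <= N -> n <= N -> p < m -> cur < n -> k < n ->
  mt H 1 p k <> 0%R -> f = (mt H 1 p cur / mt H 1 p k)%R ->
  wp colop (fun H' =>
    (forall i j, i < m -> mt H' 1 i j =
       if j == cur then (mt H 1 i j - f * mt H 1 i k)%R else mt H 1 i j) /\
    (forall i j, i < n -> mt H' 2 i j =
       if j == cur then (mt H 2 i j - f * mt H 2 i k)%R else mt H 2 i j)) H.
Proof.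
move=> em en ep ec ek mN nN pm cn kn R0 fE.
(* The factor is saved in matrix 5 before the loop overwrites the entry from which it is
   computed. *)
apply: wp_seq; split; [by side|by side; rewrite ?ep ?ek|rewrite /=].
apply: wp_seq; loop m (fun i0 (H1 : hst) =>
  (forall i j, mt H1 1 i j = if (i < i0) && (j == cur)
     then (mt H 1 i j - f * mt H 1 i k)%R else mt H 1 i j)).
  move=> i H1 im ei sm I1.
  have e25 : rg H1 25 = cur by rewrite (sameR sm).
  have e28 : rg H1 28 = k by rewrite (sameR sm).
  have e5 : mt H1 5 0 0 = f by rewrite (sameM sm) //= /upd3 /= ep ec ek.
  split; [by side|by side|rewrite /=].
  rewrite ei e25 e28 e5 => i' j'; rewrite /upd3 eqxx /= !I1 ltnn /=.
  rewrite ltSE; case: eqP => [->|_] //=; rewrite ?ltnn /=.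
  by case: eqP => [->|].
move=> H1 _ sm1 I1.
have e5 : mt H1 5 0 0 = f by rewrite (sameM sm1) //= /upd3 /= ep ec ek.
have e25 : rg H1 25 = cur by rewrite (sameR sm1).
have e28 : rg H1 28 = k by rewrite (sameR sm1).
loop n (fun i0 (H2 : hst) =>
  (forall i j, mt H2 2 i j = if (i < i0) && (j == cur)
     then (mt H 2 i j - f * mt H 2 i k)%R else mt H 2 i j)).
- by rewrite (sameR sm1).
- by move=> i j /=; rewrite (sameM sm1).
- move=> i H2 im ei sm I2.
  have e25' : rg H2 25 = cur by rewrite (sameR sm).
  have e28' : rg H2 28 = k by rewrite (sameR sm).
  have e5' : mt H2 5 0 0 = f by rewrite (sameM sm).
  split; [by side|by side|rewrite /=].
  rewrite ei e25' e28' e5' => i' j'; rewrite /upd3 eqxx /= !I2 ltnn /=.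
  rewrite ltSE; case: eqP => [->|_] //=; rewrite ?ltnn /=.
  by case: eqP => [->|].
move=> H2 _ sm2 I2; split=> i j ii; last by rewrite I2 ii.
by rewrite (sameM sm2) // I1 ii.
Qed.

(* The columns are inserted by increasing first coordinate, ties being broken by
   index.  A column reaching a pivot owned by a column of larger index takes it
   over, and the insertion goes on with the evicted column, so that columns are
   only ever added to columns of larger index. *)
Definition select : hcmd :=
  SetR 21 (Num 0);;
  For 22 14 (HIf (And (Le (Ar 1 (Rg 22)) (Num 0))
      (Not (And (Le (Num 1) (Rg 21))
         (LabLe 2 (Sub (Rg 21) (Num 1)) 2 (Rg 22)))))
    (SetR 21 (Add (Rg 22) (Num 1))) HSkip).

Definition place : hcmd :=
  SetA 0 (Rg 24) (Add (Rg 25) (Num 1));; SetR 27 (Num 0).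

Definition swap_reduce : hcmd :=
  SetR 28 (Sub (Rg 28) (Num 1));;
  HIf (Le (Rg 28) (Rg 25)) HSkip
    (SetA 0 (Rg 24) (Add (Rg 25) (Num 1));;
     SetR 30 (Rg 25);; SetR 25 (Rg 28);; SetR 28 (Rg 30));;
  colop.

Definition reduce_row : hcmd :=
  SetR 24 (Sub (Sub (Rg 13) (Num 1)) (Rg 23));;
  HIf (And (Le (Num 1) (Rg 27)) (Not (KZ (KMt 1 (Rg 24) (Rg 25)))))
    (SetR 28 (Ar 0 (Rg 24));;
     HIf (Le (Rg 28) (Num 0)) place swap_reduce)
    HSkip.

Definition insert : hcmd :=
  select;;
  SetR 25 (Sub (Rg 21) (Num 1));; SetA 1 (Rg 25) (Num 1);; SetR 27 (Num 1);;
  For 23 13 reduce_row;;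
  HIf (Le (Num 1) (Rg 27)) (SetA 2 (Rg 25) (Rg 21)) HSkip.

(** [KSb KOn KOn] stands for zero, which is not a constant of the language. *)
Definition bired_init : hcmd :=
  For 22 14 (
    For 26 14 (SetM 2 (Rg 26) (Rg 22) (KSb KOn KOn));;
    SetM 2 (Rg 22) (Rg 22) KOn;; SetA 1 (Rg 22) (Num 0);; SetA 2 (Rg 22) (Num 0));;
  For 22 13 (SetA 0 (Rg 22) (Num 0)).

Definition bired : hcmd := bired_init;; For 20 14 insert.

Lemma select_spec H n (y1 : nat -> int) :
  rg H 14 = n -> n <= N -> (forall j, j < n -> lb H 2 j = y1 j) ->
  (exists2 j, j < n & ar H 1 j = 0) ->
  wp select (fun H' => exists a, [/\ a < n, ar H 1 a = 0, rg H' 21 = a.+1 &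
    forall j, j < n -> ar H 1 j = 0 ->
      (y1 a <= y1 j)%R /\ (y1 a = y1 j -> a <= j)]) H.
Proof.
move=> en nN ey [j0 j0n Aj0].
apply: wp_seq; split; [by side|rewrite /=].
loop n (fun i0 (H1 : hst) =>
  (rg H1 21 = 0 /\ (forall j, j < i0 -> ar H 1 j <> 0)) \/
  exists a, [/\ a < i0, ar H 1 a = 0, rg H1 21 = a.+1 &
    forall j, j < i0 -> ar H 1 j = 0 ->
      (y1 a <= y1 j)%R /\ (y1 a = y1 j -> a <= j)]).
- by left; split.
- move=> i H1 im ei sm I1.
  have eA : ar H1 1 i = ar H 1 i by rewrite (sameA sm).
  have eL j : j < n -> lb H1 2 j = y1 j by move=> jn; rewrite (sameL sm) //= ey.
  have l21 : rg H1 21 <= i by case: I1 => [[-> _]|[a [? _ -> _]]].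
  split; first by side.
  rewrite /= ei eA.
  case: (posnP (ar H 1 i)) => [Ai|Ai]; rewrite ?Ai /=; last first.
    rewrite leqNgt Ai /=; case: I1 => [[h21 I1]|[a [ai Aa h21 I1]]]; [left|right].
      by split=> // j; rewrite ltSE => /orP[/eqP->|/I1]; lia.
    exists a; split=> //; first by lia.
    by move=> j; rewrite ltSE => /orP[/eqP->|/I1]; lia.
  case: I1 => [[h21 I1]|[a [ai Aa h21 I1]]].
    rewrite h21 /=; split; [by side|rewrite /=; right].
    exists i; split=> //; first by rewrite ei addn1.
    by move=> j; rewrite ltSE => /orP[/eqP->|/I1 h /h].
  rewrite h21 subn1 /= !eL //; last by lia.
  case: (lerP (y1 a) (y1 i)) => /= ya; [right|split; [by side|rewrite /=; right]].
    exists a; split=> //; first by lia.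
    by move=> j; rewrite ltSE => /orP[/eqP->|/I1 h /h]; split=> //; lia.
  exists i; split=> //; first by rewrite ei addn1.
  move=> j; rewrite ltSE => /orP[/eqP-> //|ji Aj]; have [yj _] := I1 j ji Aj.
  by split=> [|yij]; [apply: le_trans (ltW ya) yj|move: ya; rewrite yij ltNge yj].
move=> H1 _ _ [[_ /(_ _ j0n)]|[a [an Aa h21 I1]]]; first by rewrite Aj0.
by exists a; split.
Qed.

(** * Correctness of the insertion program *)

Section BiRed.
Variables (m n : nat) (G : nat -> nat -> K) (y1 : nat -> int).
Hypotheses (mN : m <= N) (nN : n <= N).

Lemma reduce_row_spec H A dd V0 a t :
  rg H 13 = m -> rg H 14 = n -> rg H 23 = t -> t < m ->
  inserting m n G y1 A dd V0 a t (mt H 1) (mt H 2) (ar H 0) (rg H 25)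
    (0 < rg H 27) ->
  wp reduce_row (fun H' =>
    inserting m n G y1 A dd V0 a t.+1 (mt H' 1) (mt H' 2) (ar H' 0) (rg H' 25)
      (0 < rg H' 27)) H.
Proof.
move=> em en et tm I0; have [cn _ _] := gcur I0.
step1; rewrite [ev _ _]/= em et.
set p := m - 1 - t; have pm : p < m by rewrite /p; lia.
set H1 := setr _ _ _; split; [by side|].
case: ifP => /= [/andP[go /eqP Rp]|ng]; last first.
  apply: inserting_skip I0 tm _ => go; apply/eqP; rewrite -/p.
  by move: ng; rewrite /upd /= go /= => /negbT; rewrite negbK.
rewrite /upd /= in go Rp; rewrite go in I0.
step1; rewrite [ev _ _]/= /upd /=.
split; first by side.
rewrite /= /upd /=; case: (posnP (ar H 0 p)) => [pp|pp]; rewrite ?pp /=.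
  step3.
  rewrite /= /upd /= /upd2; split; [by side|rewrite /= /upd /=].
  apply: (inserting_place I0 tm (erefl _)) => // q qm; rewrite addn1 //.
rewrite leqNgt pp /=.
have {pp}[k pk] : exists k, ar H 0 p = k.+1 by exists (ar H 0 p).-1; lia.
have [kn _ Rk _ _] := cP (gC I0) pm pk.
step1; rewrite [ev _ _]/= /upd /= pk subn1 /=.
step1; rewrite /= /upd /=.
have [kc|ck] := leqP k (rg H 25).
  have kc' : k < rg H 25.
    rewrite ltn_neqAle kc andbT; apply/eqP => E.
    by have [g1 _ _ _] := gGo I0 isT; apply: (g1 p pm); rewrite pk E.
  have := @colop_spec (setr 28 k (setr 28 k.+1 (setr 24 p H))) m n p (rg H 25) k
    _ em en erefl erefl erefl mN nN pm cn kn Rk erefl.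
  move=> sp; apply: wp_use sp _ => H' sm [HR HV].
  rewrite (sameR sm) // [rg _ _]/= (sameR sm) // /= /upd /= go.
  have -> : ar H' 0 = ar H 0 by apply/funext => q; rewrite (sameA sm).
  exact: inserting_colop I0 tm (erefl _) pk kc' erefl HR HV.
(* The current column takes the pivot and registers 25 and 28 are exchanged, after which [colop] is
   used as in the other case. *)
step3.
rewrite /= /upd /= addn1.
do 3 (try (apply: wp_seq); split; [by side|]; rewrite /= /upd /=).
set H2 := setr 28 _ _.
have I2 : inserting m n G y1 A dd V0 a t (mt H2 1) (mt H2 2) (ar H2 0) k true.
  apply: (inserting_swap I0 tm (erefl _) Rp pk ck) => q qm.
  by rewrite /H2 /= /upd2 /=.
have pk2 : ar H2 0 p = (rg H 25).+1 by rewrite /H2 /= /upd2 /= eqxx.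
have sp := @colop_spec H2 m n p k (rg H 25)
  _ em en erefl erefl erefl mN nN pm kn cn Rp erefl.
apply: wp_use sp _ => H' sm [HR HV].
rewrite (sameR sm) // [rg H2 25]/= (sameR sm) // [rg H2 27]/= /upd /= go.
have -> : ar H' 0 = ar H2 0 by apply/funext => q; rewrite (sameA sm).
exact: inserting_colop I2 tm (erefl _) pk2 ck erefl HR HV.
Qed.

Lemma insert_spec H :
  rg H 13 = m -> rg H 14 = n -> (forall j, j < n -> lb H 2 j = y1 j) ->
  (exists2 j, j < n & ar H 1 j = 0) ->
  inserted m n G y1 (fun j => ar H 1 j != 0) (mt H 1) (mt H 2) (ar H 0) (ar H 2) ->
  wp insert (fun H' =>
    (exists a, [/\ a < n, ar H 1 a = 0 &
        forall j, ar H' 1 j = if j == a then 1 else ar H 1 j]) /\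
    inserted m n G y1 (fun j => ar H' 1 j != 0) (mt H' 1) (mt H' 2) (ar H' 0)
      (ar H' 2)) H.
Proof.
move=> em en ey ex I0.
apply: wp_seq; apply: wp_use (select_spec en nN ey ex) _ => H1 sm1.
move=> [a [an Aa h21 amin]].
step1; rewrite [ev _ _]/= h21 subn1 [_.-1]/=.
step3; rewrite /= /upd /=.
step1; rewrite /= /upd /=.
set H2 := setr 27 _ _.
have eA j : ar H2 1 j = if j == a then 1 else ar H 1 j.
  by rewrite /H2 /= /upd2 /=; case: eqP => // _; rewrite (sameA sm1).
have eP : ar H2 0 = ar H 0.
  by apply/funext => j; rewrite /H2 /= /upd2 /= (sameA sm1).
have eD : ar H2 2 = ar H 2.
  by apply/funext => j; rewrite /H2 /= /upd2 /= (sameA sm1).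
have eM q : mt H2 q = mt H q.
  by apply/funext => i; apply/funext => j; rewrite /H2 /= (sameM sm1).
have e13 : rg H2 13 = m by rewrite /H2 /= /upd /= (sameR sm1).
have e14 : rg H2 14 = n by rewrite /H2 /= /upd /= (sameR sm1).
have nAa : ~~ (ar H 1 a != 0) by rewrite Aa.
have HA k : k < n -> (ar H2 1 k != 0) = (k == a) || (ar H 1 k != 0).
  by move=> _; rewrite eA; case: ifP.
have amin' j : j < n -> ~~ (ar H 1 j != 0) ->
    (y1 a <= y1 j)%R /\ (y1 a = y1 j -> a <= j).
  by move=> jn /negPn/eqP; apply: amin.
pose A1 j := ar H2 1 j != 0.
have I2 : inserting m n G y1 A1 (ar H 2) (mt H 2) a 0 (mt H2 1) (mt H2 2)
    (ar H2 0) (rg H2 25) (0 < rg H2 27).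
  rewrite eP !eM; exact: inserting_start I0 an nAa HA.
apply: wp_seq; loop m (fun t (H3 : hst) =>
  inserting m n G y1 A1 (ar H 2) (mt H 2) a t (mt H3 1) (mt H3 2)
    (ar H3 0) (rg H3 25) (0 < rg H3 27)).
  move=> t H3 tm et sm3 I3.
  have e13' : rg H3 13 = m by rewrite (sameR sm3).
  have e14' : rg H3 14 = n by rewrite (sameR sm3).
  exact: reduce_row_spec e13' e14' et tm I3.
move=> H3 _ sm3 I3; have [cn _ _] := gcur I3.
have e21 : rg H3 21 = a.+1 by rewrite (sameR sm3) //= /upd /= h21.
have eA3 : ar H3 1 = ar H2 1 by apply/funext => j; rewrite (sameA sm3).
have eD3 : ar H3 2 = ar H 2.
  by apply/funext => j; rewrite (sameA sm3) // -eD.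
split; first by side.
rewrite [bev _ _]/=; case: ifP => go.
  split; [by side|by side|by side|]; rewrite /= /upd2 /= e21; split.
    by exists a; split=> // j; rewrite eA3 eA.
  rewrite eA3; apply: (inserting_done I0 an nAa amin' HA I3) => k kn.
  by rewrite go eD3.
split; first by exists a; split=> // j; rewrite eA3 eA.
rewrite eA3; apply: (inserting_done I0 an nAa amin' HA I3) => k kn.
by rewrite go eD3.
Qed.

Lemma bired_init_spec H : rg H 13 = m -> rg H 14 = n ->
  wp bired_init (fun H' => [/\
    forall i j, i < n -> j < n -> mt H' 2 i j = if i == j then 1%R else 0%R,
    forall p, p < m -> ar H' 0 p = 0 &
    forall j, j < n -> ar H' 1 j = 0 /\ ar H' 2 j = 0]) H.
Proof.
move=> em en; apply: wp_seq.
loop n (fun j0 (H1 : hst) =>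
  [/\ forall i j, i < n -> j < j0 ->
         mt H1 2 i j = if i == j then 1%R else 0%R,
       forall j, j < j0 -> ar H1 1 j = 0 & forall j, j < j0 -> ar H1 2 j = 0]).
  move=> j0 H1 jn ej sm [I1 I2 I3].
  have en1 : rg H1 14 = n by rewrite (sameR sm).
  apply: wp_seq; loop n (fun i0 (H2 : hst) =>
    forall i j, mt H2 2 i j =
      if (i < i0) && (j == j0) then 0%R else mt H1 2 i j).
    move=> i0 H2 ii ei sm2 J.
    have e22 : rg H2 22 = j0 by rewrite (sameR sm2).
    split; [by side|by side|rewrite /= /upd3 /= ei e22 subrr] => i j.
    by rewrite J ltSE; case: eqP; case: eqP => //=; rewrite ?andbF.
  move=> H2 _ sm2 J.
  have e22 : rg H2 22 = j0 by rewrite (sameR sm2).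
  step2.
  step3.
  split; [by side|by side|by side|]; rewrite /= /upd3 /upd2 /= e22.
  split=> [i j ii|j|j]; rewrite ltSE.
  - have [->|jj] := eqVneq j j0 => /= [_|jl].
      by rewrite andbT; case: (i =P j0) => //= _; rewrite J ii eqxx.
    by rewrite andbF J (negbTE jj) andbF I1.
  - by case: (j =P j0) => //= _ /I2; rewrite (sameA sm2).
  - by case: (j =P j0) => //= _ /I3; rewrite (sameA sm2).
move=> H1 _ sm1 [I1 I2 I3].
loop m (fun p0 (H2 : hst) => forall p, p < p0 -> ar H2 0 p = 0).
- by rewrite (sameR sm1).
- move=> p H2 pm ep sm2 J; split; [by side|by side|by side|].
  rewrite /= /upd2 /= ep => q; rewrite ltSE; case: (q =P p) => //= _; exact: J.
move=> H2 _ sm2 J; split=> [i j ii jn|//|j jn].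
  by rewrite (sameM sm2) // I1.
by rewrite !(sameA sm2) // I2 // I3.
Qed.

Lemma bired_spec H : rg H 13 = m -> rg H 14 = n ->
  (forall j, j < n -> lb H 2 j = y1 j) ->
  (forall i j, i < m -> j < n -> mt H 1 i j = G i j) ->
  wp bired (fun H' =>
    inserted m n G y1 (fun=> true) (mt H' 1) (mt H' 2) (ar H' 0) (ar H' 2)) H.
Proof.
move=> em en ey eG; apply: wp_seq.
apply: wp_use (bired_init_spec em en) _ => H1 sm1 [I1 I2 I3].
(* Counting the inserted columns ensures that [select] always finds one, and that none is left at
   the end. *)
loop n (fun t (H2 : hst) =>
  #|[set j : 'I_n | ar H2 1 j != 0]| = t /\
  inserted m n G y1 (fun j => ar H2 1 j != 0) (mt H2 1) (mt H2 2) (ar H2 0)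
    (ar H2 2)).
- by rewrite (sameR sm1).
- split; rewrite /=.
    by apply: eq_card0 => j; rewrite inE; have [-> _] := I3 j (ltn_ord j).
  apply: inserted_init => //.
  + by move=> k kn; have [-> _] := I3 k kn.
  + by move=> i j im jn; rewrite (sameM sm1) // eG.
  + by move=> k kn; have [_ ->] := I3 k kn.
- move=> t H2 tn et sm2 [J1 J2].
  have em2 : rg H2 13 = m by rewrite (sameR sm2) //= /upd /= (sameR sm1).
  have en2 : rg H2 14 = n by rewrite (sameR sm2) //= /upd /= (sameR sm1).
  have ey2 j : j < n -> lb H2 2 j = y1 j.
    by move=> jn; rewrite (sameL sm2) //= (sameL sm1) // ey.
  have ex : exists2 j, j < n & ar H2 1 j = 0.
    have [/existsP[j /eqP Aj]|] := boolP [exists j : 'I_n, ar H2 1 j == 0].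
      by exists j.
    rewrite negb_exists => /forallP noex; move: tn; rewrite -J1.
    suff -> : [set j : 'I_n | ar H2 1 j != 0] = setT by rewrite cardsT card_ord ltnn.
    by apply/setP => j; rewrite !inE noex.
  apply: wp_conseq (insert_spec em2 en2 ey2 ex J2) _ => H3 [[a [an Aa A3]] J3].
  split; last exact: J3.
  rewrite -J1 (cardsD1 (Ordinal an)) !inE /= A3 eqxx add1n; congr _.+1.
  apply: eq_card => j; rewrite !inE A3 -val_eqE /=.
  by case: (val j =P a) => [->|] //=; rewrite Aa.
move=> H2 _ sm2 [J1 [C F O HH]].
have Aall k : k < n -> (ar H2 1 k != 0) = true.
  move=> kn; have : [set j : 'I_n | ar H2 1 j != 0] = setT.
    by apply/eqP; rewrite eqEcard subsetT cardsT card_ord J1 leqnn.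
  by move/setP/(_ (Ordinal kn)); rewrite !inE.
split=> //; first exact: core_ext C.
  by move=> k kn _; apply: F; rewrite ?Aall.
move=> t D cc _; apply: HH => j jn; by rewrite Aall.
Qed.

End BiRed.

(** * Programs computing the resolution *)

Variables (nX nY nZ : nat).
Hypothesis hN : nX + nY + nZ < N.

Lemma idx_lt a b i j : i < b -> j < a -> j * b + i < a * b.
Proof. nia. Qed.

Lemma size_le : [/\ nX * nY + nY * nZ <= N * N, N * N < S & 100 * N < S].
Proof. split; nia. Qed.

Definition dims H := [/\ rg H 10 = nX, rg H 11 = nY & rg H 12 = nZ].

Lemma dims_same c H H' : same c H H' -> dims H ->
  (10 \notin wrR c) && (11 \notin wrR c) && (12 \notin wrR c) -> dims H'.
Proof. by move=> sm [d0 d1 d2] /andP[/andP[h0 h1] h2]; split; rewrite (sameR sm). Qed.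

Definition load_mx : hcmd :=
  For 20 10 (For 22 11 (SetM 0 (Rg 22) (Rg 20)
    (KLow (Add (Mul (Rg 20) (Rg 11)) (Rg 22)))));;
  For 20 11 (For 22 12 (SetM 1 (Rg 22) (Rg 20)
    (KLow (Add (Add (Mul (Rg 10) (Rg 11)) (Mul (Rg 20) (Rg 12))) (Rg 22))))).

Lemma fill_spec q rj ri cj ci e H a b (f : nat -> nat -> K) :
  let c := For rj cj (For ri ci (SetM q (Rg ri) (Rg rj) e)) in
  wf c -> rg H cj = a -> rg H ci = b -> ci != rj -> a <= N -> b <= N ->
  (forall H' i j, i < b -> j < a -> same c H H' -> rg H' ri = i ->
     rg H' rj = j -> kok N S H' e /\ kev H' e = f i j) ->
  wp c (fun H' => forall i j, i < b -> j < a -> mt H' q i j = f i j) H.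
Proof.
move=> c wfc ea eb cr aN bN He.
have [ri64 [rj64 [ir [q8 [ri9 [rc [ci64 rj9]]]]]]] : ri < 64 /\ rj < 64 /\
    ri != rj /\ q < 8 /\ ri != 9 /\ ri != ci /\ ci < 64 /\ rj != 9.
  by move: wfc; rewrite /c /= !inE /=; lia.
have wfi : wf (For ri ci (SetM q (Rg ri) (Rg rj) e)).
  by rewrite /= ri64 ci64 ri9 rc q8.
loop a (fun j0 (H1 : hst) =>
  forall i j, i < b -> j < j0 -> mt H1 q i j = f i j).
move=> j0 H1 jn ej sm I1.
loop b (fun i0 (H2 : hst) => forall i j, mt H2 q i j =
  if (i < i0) && (j == j0) then f i j else mt H1 q i j).
- by rewrite (sameR sm) //= !inE negb_or cr eq_sym rc.
- move=> i0 H2 ii ei sm2 J.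
  have ej2 : rg H2 rj = j0 by rewrite (sameR sm2) //= inE eq_sym ir.
  have smc : same c H H2.
    apply: (same_trans sm); apply: same_sub sm2 => //= r.
    by rewrite !inE => ->; rewrite orbT.
  have [oke vale] := He _ _ _ ii jn smc ei ej2.
  split; [by side|by []|rewrite /= /upd3 eqxx ei ej2 vale /= => i j].
  rewrite J ltSE; have [->|_] := eqVneq i i0 => //=.
  by have [->|_] := eqVneq j j0; rewrite ?ltnn.
move=> H2 _ _ J i j ii; rewrite ltSE J ii.
by case: eqP => [->//|_] /=; apply: I1.
Qed.

Lemma load_mx_spec H (F G : nat -> nat -> K) : dims H ->
  (forall i j, i < nY -> j < nX -> lk H (j * nY + i) = F i j) ->
  (forall i j, i < nZ -> j < nY -> lk H (nX * nY + j * nZ + i) = G i j) ->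
  wp load_mx (fun H' =>
    (forall i j, i < nY -> j < nX -> mt H' 0 i j = F i j) /\
    (forall i j, i < nZ -> j < nY -> mt H' 1 i j = G i j)) H.
Proof.
move=> dH hF hG; have [h1 h2 h3] := size_le; have [d0 d1 d2] := dH.
apply: wp_seq; apply: wp_use; first apply: (fill_spec (f := F) _ d0 d1) => //;
  try by lia.
  move=> H1 i j ii jn sm ei ej.
  have [e0 e1 e2] := dims_same sm dH isT; have ij := idx_lt ii jn.
  by rewrite /= ei ej e1 (sameK sm) // hF //; split=> //; side.
move=> H1 sm I1; have dH1 := dims_same sm dH isT.
have [d0' d1' d2'] := dH1.
apply: wp_use; first apply: (fill_spec (f := G) _ d1' d2') => //; try by lia.
  move=> H2 i j ii jn sm2 ei ej.
  have [e0 e1 e2] := dims_same sm2 dH1 isT; have ij := idx_lt ii jn.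
  by rewrite /= ei ej e0 e1 e2 (sameK sm2) // (sameK sm) // hG //; split=> //; side.
move=> H2 sm2 I2; split=> // i j ii jn; by rewrite (sameM sm2) // I1.
Qed.

Definition load_lab : hcmd :=
  For 20 10 (LoadL 0 (Rg 20) (Mul (Num 2) (Rg 20));;
    LoadL 1 (Rg 20) (Add (Mul (Num 2) (Rg 20)) (Num 1)));;
  For 20 11 (
    LoadL 2 (Rg 20) (Add (Mul (Num 2) (Rg 10)) (Mul (Num 2) (Rg 20)));;
    LoadL 3 (Rg 20)
      (Add (Add (Mul (Num 2) (Rg 10)) (Mul (Num 2) (Rg 20))) (Num 1))).

Definition has_lab H a b n (l : nat -> grade) : Prop :=
  forall j, j < n -> lb H a j = (l j).1 /\ lb H b j = (l j).2.

Lemma load_lab_spec H (x y : nat -> grade) : dims H ->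
  (forall j, j < nX -> ll H (2 * j) = (x j).1 /\ ll H (2 * j + 1) = (x j).2) ->
  (forall j, j < nY -> ll H (2 * nX + 2 * j) = (y j).1 /\
     ll H (2 * nX + 2 * j + 1) = (y j).2) ->
  wp load_lab (fun H' => has_lab H' 0 1 nX x /\ has_lab H' 2 3 nY y) H.
Proof.
move=> dH hx hy; have [h1 h2 h3] := size_le; have [d0 d1 d2] := dH.
apply: wp_seq; loop nX (fun j0 (H1 : hst) => has_lab H1 0 1 j0 x).
- by lia.
- move=> j0 H1 jn ej sm I1.
  step3.
  split; [by side|by side|by side|].
  rewrite /has_lab /= /upd2 /= ej !(sameLl sm) // => j.
  by rewrite ltSE; case: (j =P j0) => /= [-> _|_ /I1//]; apply: hx.
move=> H1 _ sm1 I1; have dH1 := dims_same sm1 dH isT.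
have [d0' d1' d2'] := dH1.
loop nY (fun j0 (H2 : hst) => has_lab H2 2 3 j0 y).
- by lia.
- move=> j0 H2 jn ej sm I2; have [e0 e1 e2] := dims_same sm dH1 isT.
  step3.
  split; [by side|by side|by side|].
  rewrite /has_lab /= /upd2 /= ej e0 !(sameLl sm) // !(sameLl sm1) // => j.
  by rewrite ltSE; case: (j =P j0) => /= [-> _|_ /I2//]; apply: hy.
move=> H2 _ sm2 I2; split=> // j jn; rewrite !(sameL sm2) //; exact: I1.
Qed.

Definition lift : hcmd :=
  For 20 10 (For 22 11 (
    SetR 24 (Sub (Sub (Rg 11) (Num 1)) (Rg 22));;
    For 26 24 (SetM 0 (Rg 26) (Rg 20) (KSb (KMt 0 (Rg 26) (Rg 20))
      (KMl (KMt 0 (Rg 24) (Rg 20)) (KMt 2 (Rg 26) (Rg 24))))))).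

(** Back substitution in place: an unknown is final when its turn comes, and its multiple of a
    column of [V] is then removed from the rows above. The invariant interpolates between the
    identity matrix and [V]. *)
Lemma lift_spec H (F V : nat -> nat -> K) : dims H ->
  (forall i j, i < nY -> j < nX -> mt H 0 i j = F i j) ->
  (forall i j, i < nY -> j < nY -> mt H 2 i j = V i j) -> unitri nY V ->
  wp lift (fun H' => forall i j, i < nY -> j < nX ->
    F i j = app nY V (fun k => mt H' 0 k j) i) H.
Proof.
move=> dH hF hV [V1 V0]; have [h1 h2 h3] := size_le; have [d0 d1 d2] := dH.
loop nX (fun j0 (H1 : hst) =>
  (forall i j, i < nY -> j0 <= j < nX -> mt H1 0 i j = F i j) /\
  forall i j, i < nY -> j < j0 -> F i j = app nY V (fun k => mt H1 0 k j) i).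
- by lia.
- move=> j0 H1 jn ej sm [I1 I2]; have [e0 e1 e2] := dims_same sm dH isT.
  (* the first [nY - t] unknowns are still to be solved for *)
  pose W t i k : K := if k < nY - t then (if k == i then 1%R else 0%R) else V i k.
  loop nY (fun t (H2 : hst) =>
    (forall i j, j != j0 -> mt H2 0 i j = mt H1 0 i j) /\
    forall i, i < nY -> F i j0 = app nY (W t) (fun k => mt H2 0 k j0) i).
  + by lia.
  + split=> // i ii.
    rewrite /app (@sum_only _ nY i (fun k : nat => W 0 i k * mt H1 0 k j0)%R) //.
      by rewrite /W subn0 ii eqxx mul1r I1 // leqnn.
    by move=> k kn /negbTE ki; rewrite /W subn0 kn ki mul0r.
  + move=> t H2 tn et sm2 [J1 J2].
    have [f0 f1 f2] := dims_same sm2 (And3 e0 e1 e2) isT.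
    step1; rewrite /= f1 et.
    set s := nY - 1 - t; have sn : s < nY by rewrite /s; lia.
    have e20 : rg H2 20 = j0 by rewrite (sameR sm2) // ej.
    loop s (fun i0 (H3 : hst) => forall i j, mt H3 0 i j =
      if (i < i0) && (j == j0) then (mt H2 0 i j - mt H2 0 s j0 * V i s)%R
      else mt H2 0 i j).
    * by lia.
    * move=> i0 H3 ii ei sm3 J3.
      have g20 : rg H3 20 = j0 by rewrite (sameR sm3).
      have g24 : rg H3 24 = s by rewrite (sameR sm3).
      have gV : mt H3 2 i0 s = V i0 s.
        by rewrite (sameM sm3) //= (sameM sm2) // (sameM sm) // hV //; lia.
      split; [by side|by side|rewrite /= /upd3 /= ei g20 g24 gV => i j].
      rewrite !J3 ltnn [s < i0]ltnNge (ltnW ii) /= ltSE.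
      have [->|_] := eqVneq i i0 => //=.
      by have [->|_] := eqVneq j j0; rewrite ?ltnn.
    move=> H3 _ sm3 J3; split=> [i j jj|i ii].
      by rewrite J3 (negbTE jj) andbF J1.
    set q := mt H2 0 s j0 in J3 *.
    (* The sum changes for two reasons: column [s] of the matrix becomes that of [V] ([b1]), and
       unknown [i] is modified if it comes before [s] ([b2]). By unitriangularity the two totals
       cancel. *)
    pose b1 k : K := (if k == s then (V i s - (if i == s then 1 else 0)) * q else 0)%R.
    pose b2 k : K := (if k == i then (if (i < s)%N then q * V i s else 0) else 0)%R.
    have Wk k : k < nY -> (W t.+1 i k * mt H3 0 k j0 =
        W t i k * mt H2 0 k j0 + (b1 k - b2 k))%R.
      move=> kn; rewrite J3 eqxx andbT /W /b1 /b2.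
      have -> : (k < nY - t.+1) = (k < s) by apply/idP/idP; rewrite /s; lia.
      have -> : (k < nY - t) = (k <= s) by apply/idP/idP; rewrite /s; lia.
      case: (ltngtP k s) => [ks|ks|->].
      - by have [E|_] := eqVneq k i; rewrite -?E ?ks; ring.
      - by have [E|_] := eqVneq k i; rewrite -?E ?[k < s]ltnNge ?(ltnW ks) /=; ring.
      - by rewrite /q [s == i]eq_sym; have [->|_] := eqVneq i s; rewrite ?ltnn; ring.
    rewrite J2 // /app [RHS](eq_bigr (fun k : 'I_nY =>
      W t i k * mt H2 0 k j0 + (b1 k - b2 k))%R); last by move=> k _; apply: Wk.
    rewrite big_split sumrB /= (@sum_only _ nY s b1) //; last first.
      by rewrite /b1 => k _ /negbTE->.
    rewrite (@sum_only _ nY i b2) //; last by rewrite /b2 => k _ /negbTE->.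
    rewrite /b1 /b2 !eqxx; case: (ltngtP i s) => [il|il|->].
    - ring.
    - by rewrite V0 //; ring.
    - by rewrite V1 //; ring.
  move=> H2 _ sm2 [J1 J2]; split=> [i j ii /andP[j1 j2]|i j ii].
    by rewrite /= J1 ?I1 ?j2 ?(ltnW j1) // neq_ltn j1 orbT.
  rewrite ltSE => /orP[/eqP->|jl].
    rewrite J2 //; apply: app_extl => k kn; by rewrite /W subnn.
  by rewrite I2 //; apply: app_ext => k kn /=; rewrite J1 // neq_ltn jl.
by move=> H1 _ _ [_ I2].
Qed.

Definition set_rows : hcmd :=
  For 20 11 (HIf (Le (Num 1) (Ar 2 (Rg 20)))
    (SetA 3 (Rg 20) (Num 1);;
     SetL 4 (Rg 20) 2 (Sub (Ar 2 (Rg 20)) (Num 1));;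
     SetL 5 (Rg 20) 3 (Rg 20))
    (SetA 3 (Rg 20) (Num 0))).

Lemma set_rows_spec H (y : nat -> grade) (dd : nat -> nat) : dims H ->
  has_lab H 2 3 nY y -> (forall j, ar H 2 j = dd j) ->
  (forall j, j < nY -> dd j <= nY) ->
  wp set_rows (fun H' => forall j, j < nY ->
    ar H' 3 j = (dd j != 0) /\
    (dd j != 0 -> (lb H' 4 j, lb H' 5 j) = kerlab y dd j)) H.
Proof.
move=> [_ d1 _] hy hd hdn; have [h1 h2 h3] := size_le.
loop nY (fun j0 (H1 : hst) => forall j, j < j0 ->
  ar H1 3 j = (dd j != 0) /\
  (dd j != 0 -> (lb H1 4 j, lb H1 5 j) = kerlab y dd j)).
- by lia.
- move=> j0 H1 jn ej sm I1; have hdj := hdn _ jn.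
  have eD : ar H1 2 j0 = dd j0 by rewrite (sameA sm).
  split; first by side.
  rewrite /= ej eD; case: (posnP (dd j0)) => [dj|dj].
    split; [by side|by side|by side|rewrite /= /upd2 /= ej => j].
    by rewrite ltSE; case: (j =P j0) => /= [->|_ /I1//]; rewrite dj.
  step3.
  apply: wp_seq; split; [by side|by side; rewrite ej eD; lia|].
  split; [by side|by side|].
  rewrite /= /upd2 /= ej eD => j; rewrite ltSE; case: (j =P j0) => /= [->|_ /I1//].
  rewrite -lt0n dj !(sameL sm) // /kerlab subn1; split=> // _.
  by congr pair; [apply: (hy _ _).1; lia|apply: (hy _ _).2].
Qed.

Definition search_unit : hcmd :=
  SetR 21 (Num 0);;
  For 22 11 (HIf (And (And (Le (Num 1) (Ar 3 (Rg 22)))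
                           (Not (KZ (KMt 0 (Rg 22) (Rg 20)))))
                      (And (LabLe 0 (Rg 20) 4 (Rg 22))
                           (LabLe 1 (Rg 20) 5 (Rg 22))))
    (SetR 21 (Add (Rg 22) (Num 1))) HSkip).

(** Column [j] is first copied to matrix 4, since the update runs over all columns and overwrites
    [j] itself. *)
Definition clear_row : hcmd :=
  SetR 25 (Sub (Rg 21) (Num 1));;
  For 26 11 (SetM 4 (Rg 26) (Num 0) (KMt 0 (Rg 26) (Rg 20)));;
  For 22 10 (
    SetM 5 (Num 0) (Num 0) (KDv (KMt 0 (Rg 25) (Rg 22)) (KMt 4 (Rg 25) (Num 0)));;
    For 26 11 (SetM 0 (Rg 26) (Rg 22) (KSb (KMt 0 (Rg 26) (Rg 22))
      (KMl (KMt 5 (Num 0) (Num 0)) (KMt 4 (Rg 26) (Num 0))))));;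
  SetA 3 (Rg 25) (Num 0).

Definition eliminate : hcmd :=
  For 20 10 (search_unit;; HIf (Le (Num 1) (Rg 21)) clear_row HSkip).

Section Eliminate.
Variables (w x : nat -> grade).

(** Testing one inequality detects equal labels: the opposite one holds at every nonzero entry by
    [eE]. *)
Definition unit_entry H j i :=
  [&& ar H 3 i != 0, mt H 0 i j != 0%R & gle (x j) (w i)].

Lemma search_unit_spec H j : dims H -> rg H 20 = j -> j < nX ->
  has_lab H 4 5 nY w -> has_lab H 0 1 nX x ->
  wp search_unit (fun H' =>
    (rg H' 21 = 0 /\ forall i, i < nY -> ~~ unit_entry H j i) \/
    exists i, [/\ i < nY, rg H' 21 = i.+1 & unit_entry H j i]) H.
Proof.
move=> [d0 d1 d2] ej jn hw hx; have [h1 h2 h3] := size_le.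
apply: wp_seq; split; [by side|rewrite /=].
loop nY (fun i0 (H1 : hst) =>
  (rg H1 21 = 0 /\ forall i, i < i0 -> ~~ unit_entry H j i) \/
  exists i, [/\ i < nY, rg H1 21 = i.+1 & unit_entry H j i]).
- by lia.
- by left.
move=> i H1 ii ei sm I1.
have e20 : rg H1 20 = j by rewrite (sameR sm).
split; first by side.
have [x1 x2] := hx j jn; have [w1 w2] := hw i ii.
have -> : bev H1 (And (And (Le (Num 1) (Ar 3 (Rg 22)))
  (Not (KZ (KMt 0 (Rg 22) (Rg 20))))) (And (LabLe 0 (Rg 20) 4 (Rg 22))
  (LabLe 1 (Rg 20) 5 (Rg 22)))) = unit_entry H j i.
  rewrite /= ei e20 (sameA sm) // (sameM sm) // !(sameL sm) //=.
  by rewrite x1 x2 w1 w2 lt0n -andbA.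
case: ifP => ui.
  split; [by side|right; exists i; split=> //].
  by rewrite /= /upd /= ei addn1.
case: I1 => [[r21 I1]|I1]; [left|right] => //; split=> // i'.
by rewrite ltSE => /orP[/eqP->|/I1//]; rewrite ui.
Qed.

Lemma clear_row_spec H i j : dims H -> rg H 20 = j -> j < nX ->
  rg H 21 = i.+1 -> i < nY -> mt H 0 i j <> 0%R ->
  wp clear_row (fun H' =>
    (forall k l, k < nY -> l < nX -> mt H' 0 k l =
       (mt H 0 k l - mt H 0 i l / mt H 0 i j * mt H 0 k j)%R) /\
    forall k, ar H' 3 k = if k == i then 0 else ar H 3 k) H.
Proof.
move=> dH ej jn ei ii hij; have [h1 h2 h3] := size_le; have [d0 d1 d2] := dH.
step1; rewrite /= ei subn1 [_.-1]/=.
apply: wp_seq; loop nY (fun k0 (H1 : hst) => forall k, k < k0 ->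
  mt H1 4 k 0 = mt H 0 k j).
- by lia.
- move=> k H1 kn ek sm I1.
  have e20 : rg H1 20 = j by rewrite (sameR sm).
  split; [by side|by side|rewrite /= /upd3 /= ek e20 => k'].
  by rewrite ltSE; case: (k' =P k) => /= [-> _|_ /I1//]; rewrite (sameM sm).
move=> H1 _ sm1 I1; have [e0 e1 e2] := dims_same sm1 dH isT.
have e25 : rg H1 25 = i by rewrite (sameR sm1).
have eM k l : mt H1 0 k l = mt H 0 k l by rewrite (sameM sm1).
apply: wp_seq; loop nX (fun l0 (H2 : hst) => forall k l, k < nY ->
  mt H2 0 k l = if l < l0 then
    (mt H 0 k l - mt H 0 i l / mt H 0 i j * mt H 0 k j)%R else mt H 0 k l).
- by lia.
- by move=> k l kn; rewrite /= eM.
- move=> l H2 ln el sm2 I2.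
  have [f0 f1 f2] := dims_same sm2 (And3 e0 e1 e2) isT.
  have e25' : rg H2 25 = i by rewrite (sameR sm2).
  have e4 k : k < nY -> mt H2 4 k 0 = mt H 0 k j.
    by move=> kn; rewrite (sameM sm2) // I1.
  apply: wp_seq; split; [by side|by side; rewrite /= e25' e4|].
  rewrite /= el e25' e4 // I2 // ltnn.
  set q := (mt H 0 i l / mt H 0 i j)%R.
  loop nY (fun k0 (H3 : hst) => forall k l', mt H3 0 k l' =
    if (k < k0) && (l' == l) then (mt H 0 k l - q * mt H 0 k j)%R else mt H2 0 k l').
  + by lia.
  + move=> k H3 kn ek sm3 J.
    have g22 : rg H3 22 = l by rewrite (sameR sm3).
    have g4 : mt H3 4 k 0 = mt H 0 k j by rewrite (sameM sm3) //= /upd3 /= e4.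
    have g5 : mt H3 5 0 0 = q by rewrite (sameM sm3).
    split; [by side|by side|rewrite /= /upd3 /= ek g22 g4 g5 => k' l'].
    rewrite !J ltnn /= I2 // ltnn ltSE.
    by have [->|_] := eqVneq k' k => //=; case: (l' == l); rewrite ?ltnn.
  move=> H3 _ sm3 J k l' kn; rewrite /= J kn /= ltSE I2 //.
  by have [->|] := eqVneq l' l.
move=> H2 _ sm2 I2; have e25' : rg H2 25 = i by rewrite (sameR sm2).
split; [by side|by side|by side|].
split=> [k l kn ln|k] /=; first by rewrite I2 // ln.
rewrite /upd2 /= e25'; case: eqP => //= _.
by rewrite (sameA sm2) // (sameA sm1).
Qed.

Lemma eliminate_spec H (h0 : nat -> nat -> K) (p0 : nat -> bool) : dims H ->
  sorted_labels nX x -> has_lab H 4 5 nY w -> has_lab H 0 1 nX x ->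
  eliminated nY nX h0 p0 w x 0 (mt H 0) (fun i => ar H 3 i != 0) ->
  wp eliminate (fun H' =>
    (forall i, ar H' 3 i != 0 -> ar H 3 i != 0) /\
    eliminated nY nX h0 p0 w x nX (mt H' 0) (fun i => ar H' 3 i != 0)) H.
Proof.
move=> dH xs hw hx E0; have [d0 d1 d2] := dH.
loop nX (fun j0 (H1 : hst) =>
  (forall i, ar H1 3 i != 0 -> ar H 3 i != 0) /\
  eliminated nY nX h0 p0 w x j0 (mt H1 0) (fun i => ar H1 3 i != 0)).
- by lia.
move=> j H1 jn ej sm [A1 E1]; have dH1 := dims_same sm dH isT.
have hw1 : has_lab H1 4 5 nY w by move=> i ii; rewrite !(sameL sm) //; apply: hw.
have hx1 : has_lab H1 0 1 nX x by move=> i ii; rewrite !(sameL sm) //; apply: hx.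
apply: wp_seq; apply: wp_use (search_unit_spec dH1 ej jn hw1 hx1) _.
move=> H2 sm2 I2; split; first by side.
have eA : ar H2 3 = ar H1 3 by apply/funext => i; rewrite (sameA sm2).
have eM : mt H2 0 = mt H1 0.
  by apply/funext => i; apply/funext => k; rewrite (sameM sm2).
case: I2 => [[r21 I2]|[i [ii r21 /and3P[pi /eqP hij xw]]]].
  rewrite /= r21 /=; split; rewrite /= ?eA ?eM //; apply: eliminated_skip => // i ii pi hij.
  by have := I2 i ii; rewrite /unit_entry pi /=; case: eqP.
rewrite /= r21 /=.
have dH2 := dims_same sm2 dH1 isT.
have e20 : rg H2 20 = j by rewrite (sameR sm2).
have hij2 : mt H2 0 i j <> 0%R by rewrite eM.
apply: wp_conseq (clear_row_spec dH2 e20 jn r21 ii hij2) _ => H3 [I3 A3].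
split=> [k|]; rewrite /= ?A3; first by rewrite eA; case: ifP => // _; apply: A1.
apply: (eliminated_step xs E1 ii jn pi hij xw) => [k l kn ln|k kn].
  by rewrite I3 // !eM.
by rewrite A3 eA; case: (k =P i) => _; rewrite ?andbT ?andbF.
Qed.

End Eliminate.

Definition prepare_relations : hcmd :=
  For 20 10 (For 22 11 (SetM 1 (Rg 22) (Rg 20) (KMt 0 (Rg 22) (Rg 20))));;
  For 20 10 (SetL 2 (Rg 20) 0 (Rg 20));;
  SetR 13 (Rg 11);; SetR 14 (Rg 10).

Lemma prepare_relations_spec H (x : nat -> grade) : dims H ->
  has_lab H 0 1 nX x ->
  wp prepare_relations (fun H' => [/\ rg H' 13 = nY, rg H' 14 = nX,
    forall i j, i < nY -> j < nX -> mt H' 1 i j = mt H 0 i j &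
    forall j, j < nX -> lb H' 2 j = (x j).1]) H.
Proof.
move=> dH hx; have [h1 h2 h3] := size_le; have [d0 d1 d2] := dH.
apply: wp_seq; apply: wp_use; first apply: (fill_spec (f := mt H 0) _ d0 d1) => //;
  try by lia.
  move=> H1 i j ii jn sm ei ej.
  by rewrite /= ei ej (sameM sm) //; split=> //; side.
move=> H1 sm I1; have [e0 e1 e2] := dims_same sm dH isT.
apply: wp_seq; loop nX (fun j0 (H2 : hst) =>
  forall j, j < j0 -> lb H2 2 j = (x j).1).
- by lia.
- move=> j0 H2 jn ej sm2 J; split; [by side|by side|rewrite /= /upd2 /= ej => j].
  rewrite ltSE; case: (j =P j0) => /= [-> _|_ /J//].
  by rewrite (sameL sm2) //= (sameL sm) //; apply: (hx _ _).1.
move=> H2 _ sm2 J; have [f0 f1 f2] := dims_same sm2 (And3 e0 e1 e2) isT.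
step1; split; [by side|].
rewrite /= /upd /= f0 f1; split=> // i j ii jn.
by rewrite (sameM sm2) // I1.
Qed.

Definition set_columns : hcmd :=
  For 20 10 (
    SetA 4 (Rg 20) (Num 1);; SetA 5 (Rg 20) (Num 0);;
    HIf (Le (Num 1) (Ar 2 (Rg 20)))
      (HIf (And (Le (Ar 2 (Rg 20)) (Add (Rg 20) (Num 1)))
                (Le (Add (Rg 20) (Num 1)) (Ar 2 (Rg 20))))
        (SetA 4 (Rg 20) (Num 0))
        (SetA 5 (Rg 20) (Num 1);;
         SetL 6 (Rg 20) 0 (Sub (Ar 2 (Rg 20)) (Num 1));;
         SetL 7 (Rg 20) 1 (Rg 20)))
      HSkip).

Lemma set_columns_spec H (x : nat -> grade) (dd : nat -> nat) : dims H ->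
  has_lab H 0 1 nX x -> (forall j, ar H 2 j = dd j) ->
  (forall j, j < nX -> dd j <= nX) ->
  wp set_columns (fun H' => forall j, j < nX ->
    [/\ (ar H' 4 j != 0) = (dd j != j.+1),
        (ar H' 5 j != 0) = (dd j != 0) && (dd j != j.+1) &
        ar H' 5 j != 0 -> (lb H' 6 j, lb H' 7 j) = kerlab x dd j]) H.
Proof.
move=> dH hx hd hdn; have [h1 h2 h3] := size_le; have [d0 d1 d2] := dH.
loop nX (fun j0 (H1 : hst) => forall j, j < j0 ->
    [/\ (ar H1 4 j != 0) = (dd j != j.+1),
        (ar H1 5 j != 0) = (dd j != 0) && (dd j != j.+1) &
        ar H1 5 j != 0 -> (lb H1 6 j, lb H1 7 j) = kerlab x dd j]).
- by lia.
move=> j0 H1 jn ej sm I1; have hdj := hdn _ jn.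
have eD : ar H1 2 j0 = dd j0 by rewrite (sameA sm).
step3.
step3.
split; first by side.
rewrite /= /upd2 /= ej eD; case: (posnP (dd j0)) => [dj|dj].
  move=> j; rewrite ltSE /=; have [->|jj] /= := eqVneq j j0; last exact: I1.
  by rewrite dj.
split; first by side.
rewrite /= /upd2 /= ej eD addn1 -eqn_leq; case: (dd j0 =P j0.+1) => djj.
  split; [by side|by side|by side|rewrite /= /upd2 /= ej => j].
  rewrite ltSE /=; have [->|jj] /= := eqVneq j j0; last exact: I1.
  by rewrite djj eqxx.
step3.
apply: wp_seq; split; [by side|by side; rewrite ej eD; lia|].
split; [by side|by side|].
rewrite /= /upd2 /= ej eD => j; rewrite ltSE /=; have [->|jj] /= := eqVneq j j0; last exact: I1.
rewrite -lt0n dj; split=> //; first by apply/esym/eqP.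
  by apply/esym/eqP.
move=> _; rewrite !(sameL sm) // /kerlab subn1.
by congr pair; [apply: (hx _ _).1; lia|apply: (hx _ _).2].
Qed.

Definition resolve : hcmd :=
  SetR 10 (Rg 0);; SetR 11 (Rg 1);; SetR 12 (Rg 2);;
  load_mx;; load_lab;; SetR 13 (Rg 12);; SetR 14 (Rg 11);;
  bired;; lift;; set_rows;; eliminate;; prepare_relations;; bired;; set_columns.

(** [U] and [V] are existential: the second insertion overwrites [V] in memory, and the output
    requires neither of them, only the labels and marks. *)
Definition resolved_state (G F : nat -> nat -> K) (y x : nat -> grade) H : Prop :=
  [/\ dims H, has_lab H 0 1 nX x & exists U V,
    resolved nZ nY nX G F y x (mt H 0) U
      (fun i => ar H 3 i != 0) (fun j => ar H 4 j != 0) (fun j => ar H 5 j != 0)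
      (fun i => (lb H 4 i, lb H 5 i)) (fun j => (lb H 6 j, lb H 7 j)) V].

Lemma inserted_le m n (G : nat -> nat -> K) y1 A R V pv dd j :
  inserted m n G y1 A R V pv dd -> j < n -> dd j <= n.
Proof.
by case=> C _ _ _ jn; case E : (dd j) => [//|a]; case: (cL C jn E).
Qed.

Lemma resolve_spec H (G F : nat -> nat -> K) (y x : nat -> grade) :
  [/\ rg H 0 = nX, rg H 1 = nY & rg H 2 = nZ] ->
  (forall i j, i < nY -> j < nX -> lk H (j * nY + i) = F i j) ->
  (forall i j, i < nZ -> j < nY -> lk H (nX * nY + j * nZ + i) = G i j) ->
  (forall j, j < nX -> ll H (2 * j) = (x j).1 /\ ll H (2 * j + 1) = (x j).2) ->
  (forall j, j < nY -> ll H (2 * nX + 2 * j) = (y j).1 /\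
     ll H (2 * nX + 2 * j + 1) = (y j).2) ->
  sorted_labels nY y -> sorted_labels nX x ->
  (forall i j, i < nY -> j < nX -> F i j <> 0%R -> gle (y i) (x j)) ->
  (forall l j, l < nZ -> j < nX -> app nY G (F^~ j) l = 0%R) ->
  wp resolve (resolved_state G F y x) H.
Proof.
move=> [r0 r1 r2] hF hG hx hy ys xs FY GF; have [h1 h2 h3] := size_le.
do 3 (step1; rewrite /= /upd /=).
set H0 := setr 12 _ _.
have dH0 : dims H0 by split; rewrite /H0 /= /upd /=.
apply: wp_seq; apply: wp_use (load_mx_spec dH0 hF hG) _ => H1 sm1 [F1 G1].
have dH1 := dims_same sm1 dH0 isT.
apply: wp_seq; apply: wp_use; first apply: (load_lab_spec (x := x) (y := y) dH1).
- by move=> j jn; rewrite !(sameLl sm1) //; apply: hx.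
- by move=> j jn; rewrite !(sameLl sm1) //; apply: hy.
move=> H2 sm2 [X2 Y2]; have dH2 := dims_same sm2 dH1 isT.
have [d0 d1 d2] := dH2.
do 2 (step1; rewrite /= /upd /=).
rewrite d1 d2; set H3 := setr 14 _ _.
have dH3 : dims H3 by [].
apply: wp_seq; apply: wp_use.
  apply: (@bired_spec nZ nY G (fun j => (y j).1)) => //; try by lia.
  - by move=> j jn; apply: (Y2 j jn).1.
  - by move=> i j ii jn; rewrite /H3 /= (sameM sm2) // G1.
move=> H4 sm4 I1; have dH4 := dims_same sm4 dH3 isT.
have F4 i j : i < nY -> j < nX -> mt H4 0 i j = F i j.
  by move=> ii jn; rewrite (sameM sm4) //= (sameM sm2) // F1.
have X4 : has_lab H4 0 1 nX x.
  by move=> j jn; rewrite !(sameL sm4) //; apply: X2.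
have Y4 : has_lab H4 2 3 nY y.
  by move=> j jn; rewrite !(sameL sm4) //; apply: Y2.
apply: wp_seq; apply: wp_use.
  by apply: (lift_spec (V := mt H4 2) dH4 F4 _ (cV (oC I1))).
move=> H5 sm5 L5; have dH5 := dims_same sm5 dH4 isT.
pose dd1 := ar H4 2; have D5 j : ar H5 2 j = dd1 j by rewrite (sameA sm5).
have Y5 : has_lab H5 2 3 nY y.
  by move=> j jn; rewrite !(sameL sm5) //; apply: Y4.
apply: wp_seq; apply: wp_use.
  apply: (set_rows_spec dH5 Y5 D5) => j jn; exact: inserted_le I1 jn.
move=> H6 sm6 W6; have dH6 := dims_same sm6 dH5 isT.
pose w i : grade := (lb H6 4 i, lb H6 5 i).
have X6 : has_lab H6 0 1 nX x.
  by move=> j jn; rewrite !(sameL sm6) // !(sameL sm5) //; apply: X4.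
have wE i : i < nY -> dd1 i <> 0 -> w i = kerlab y dd1 i.
  by move=> ii /eqP di; apply: (W6 i ii).2.
have M6 i j : mt H6 0 i j = mt H5 0 i j by rewrite (sameM sm6).
(* The marks of array 3 are known to agree with [dd1 i != 0] only for [i < nY], so the clauses are
   transported one by one. *)
have E6 : eliminated nY nX (mt H5 0) (fun i => dd1 i != 0) w x 0 (mt H6 0)
    (fun i => ar H6 3 i != 0).
  have := eliminated_init (h0 := mt H5 0) (p0 := fun i => dd1 i != 0) (w := w)
    (x := x) (fun i j _ _ => M6 i j) (lift_supported ys FY GF I1 wE L5).
  case=> A B C D; split.
  - move=> i j ii jn hij; have [di wx] := A _ _ ii jn hij; split=> //.
    by rewrite (W6 i ii).1 di.
  - move=> z v /B[v' [d [sv' sd vE]]]; exists v', d; split=> // i ii v0.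
    have [di wz] := sv' i ii v0; split=> //.
    by rewrite (W6 i ii).1 di.
  - move=> z v sv; apply: C => i ii v0; have [di wz] := sv i ii v0; split=> //.
    by move: di; rewrite (W6 i ii).1; case: (dd1 i != 0).
  - by move=> i j ii; rewrite ltn0.
apply: wp_seq; apply: wp_use.
  by apply: (eliminate_spec dH6 xs _ X6 E6).
move=> H7 sm7 [A7 E7]; have dH7 := dims_same sm7 dH6 isT.
have X7 : has_lab H7 0 1 nX x by move=> j jn; rewrite !(sameL sm7) //; apply: X6.
apply: wp_seq; apply: wp_use (prepare_relations_spec dH7 X7) _ => H8 sm8.
move=> [m8 n8 R8 L8]; have dH8 := dims_same sm8 dH7 isT.
apply: wp_seq; apply: wp_use.
  by apply: (@bired_spec nY nX (mt H7 0) (fun j => (x j).1)) => //; lia.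
move=> H9 sm9 I2; have dH9 := dims_same sm9 dH8 isT.
have X9 : has_lab H9 0 1 nX x.
  by move=> j jn; rewrite !(sameL sm9) // !(sameL sm8) //; apply: X7.
pose dd2 := ar H9 2.
apply: wp_use.
  apply: (set_columns_spec (dd := dd2) dH9 X9) => // j jn; exact: inserted_le I2 jn.
move=> H' sm' C'; have dH' := dims_same sm' dH9 isT.
split=> //; first by move=> j jn; rewrite !(sameL sm') //; apply: X9.
exists (mt H9 2), (mt H4 2).
have -> : mt H' 0 = mt H7 0.
  apply/funext => i; apply/funext => j.
  by rewrite (sameM sm') // (sameM sm9) // (sameM sm8).
have -> : (fun i => ar H' 3 i != 0) = (fun i => ar H7 3 i != 0).
  by apply/funext => i; rewrite (sameA sm') // (sameA sm9) // (sameA sm8).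
have -> : (fun i => (lb H' 4 i, lb H' 5 i)) = w.
  apply/funext => i; rewrite !(sameL sm') // !(sameL sm9) // !(sameL sm8) //.
  by rewrite !(sameL sm7).
apply: (resolution_result ys xs I1 wE L5 E7 _ I2 (p1 := fun j => ar H' 4 j != 0)
  (p2 := fun j => ar H' 5 j != 0)).
- move=> i ii /A7; rewrite (W6 i ii).1; by case: (dd1 i != 0).
- by move=> j jn; case: (C' j jn).
- by move=> j jn; case: (C' j jn).
- by move=> j jn pj; case: (C' j jn) => _ _ ->.
Qed.

(** * Output of the presentation and of the Betti numbers *)

Definition write_rows : hcmd :=
  SetR 31 (Num 0);;
  For 20 11 (HIf (Le (Num 1) (Ar 3 (Rg 20)))
    (SetA 6 (Rg 31) (Rg 20);;
     StoreL (Add (Mul (Num 2) (Rg 10)) (Mul (Num 2) (Rg 31))) 4 (Rg 20);;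
     StoreL (Add (Add (Mul (Num 2) (Rg 10)) (Mul (Num 2) (Rg 31))) (Num 1))
       5 (Rg 20);;
     SetR 31 (Add (Rg 31) (Num 1)))
    HSkip).

Definition write_columns : hcmd :=
  SetR 32 (Num 0);;
  For 20 10 (HIf (Le (Num 1) (Ar 4 (Rg 20)))
    (For 22 31 (SetLowK (Add (Mul (Rg 32) (Rg 31)) (Rg 22))
       (KMt 0 (Ar 6 (Rg 22)) (Rg 20)));;
     StoreL (Mul (Num 2) (Rg 32)) 0 (Rg 20);;
     StoreL (Add (Mul (Num 2) (Rg 32)) (Num 1)) 1 (Rg 20);;
     SetR 32 (Add (Rg 32) (Num 1)))
    HSkip).

(** Column labels start at cell 0 and row labels at cell [2 * nX], without overlap because at most
    |X| relations are kept. The input area can be overwritten, its content having been copied to the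
    work areas. *)
Definition write_presentation : hcmd :=
  write_rows;; write_columns;;
  SetR 0 (Rg 31);; SetR 1 (Rg 32);; SetR 2 (Num 0);;
  SetR 3 (Mul (Num 2) (Rg 10));; SetR 4 (Num 0).

Definition low_lab H (b n : nat) (l : nat -> grade) : Prop :=
  forall j, j < n -> ll H (b + 2 * j) = (l j).1 /\ ll H (b + 2 * j + 1) = (l j).2.

Lemma write_rows_spec H (p : nat -> bool) (w : nat -> grade) : dims H ->
  (forall i, (ar H 3 i != 0) = p i) -> has_lab H 4 5 nY w ->
  wp write_rows (fun H' =>
    [/\ rg H' 31 = size (sel p nY),
        forall t, t < size (sel p nY) -> ar H' 6 t = nth 0 (sel p nY) t &
        low_lab H' (2 * nX) (size (sel p nY)) (fun t => w (nth 0 (sel p nY) t))]) H.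
Proof.
move=> [d0 d1 d2] hp hw; apply: wp_seq; split; [by side|rewrite /=].
loop nY (fun k (H1 : hst) =>
  [/\ rg H1 31 = size (sel p k),
        forall t, t < size (sel p k) -> ar H1 6 t = nth 0 (sel p k) t &
        low_lab H1 (2 * nX) (size (sel p k)) (fun t => w (nth 0 (sel p k) t))]).
- by lia.
- move=> k H1 kn ek sm [I1 I2 I3]; have szk := size_sel p k.
  have e0 : rg H1 10 = nX by rewrite (sameR sm).
  split; first by side.
  rewrite /= ek (sameA sm) //= lt0n hp; case: ifP => pk; last first.
    by rewrite /low_lab /= /upd /= selS pk.
  have [w1 w2] := hw k kn.
  step3.
  step3.
  step3.
  split; [by side|].
  rewrite /low_lab /= selS pk size_rcons /upd2 /upd /= ek I1 e0 !(sameL sm) //=.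
  rewrite w1 w2; split=> [|t|t]; first by rewrite addn1.
    rewrite ltSE nth_rcons => /orP[/eqP->|tl]; first by rewrite ?ltnn ?eqxx ?ltnn.
    by rewrite tl ltn_eqF //= I2.
  rewrite ltSE nth_rcons => /orP[/eqP->|tl].
    by rewrite ltnn !eqxx; split=> //; case: eqP => //; lia.
  have [a1 a2] := I3 t tl; rewrite tl.
  by do 4 (case: eqP => [|_]; first by lia).
Qed.

Lemma write_columns_spec H m (r : nat -> nat) (p : nat -> bool) (x : nat -> grade) :
  dims H -> rg H 31 = m -> m <= nY -> (forall t, t < m -> ar H 6 t = r t) ->
  (forall t, t < m -> r t < nY) ->
  (forall i, (ar H 4 i != 0) = p i) -> has_lab H 0 1 nX x ->
  wp write_columns (fun H' =>
    [/\ rg H' 32 = size (sel p nX),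
        forall t s, t < m -> s < size (sel p nX) ->
          lk H' (s * m + t) = mt H 0 (r t) (nth 0 (sel p nX) s),
        low_lab H' 0 (size (sel p nX)) (fun s => x (nth 0 (sel p nX) s)) &
        forall b, 2 * nX <= b -> ll H' b = ll H b]) H.
Proof.
move=> [d0 d1 d2] em mY hr rY hp hx; apply: wp_seq; split; [by side|rewrite /=].
have [h1 h2 h3] := size_le.
loop nX (fun k (H1 : hst) =>
    [/\ rg H1 32 = size (sel p k),
        forall t s, t < m -> s < size (sel p k) ->
          lk H1 (s * m + t) = mt H 0 (r t) (nth 0 (sel p k) s),
        low_lab H1 0 (size (sel p k)) (fun s => x (nth 0 (sel p k) s)) &
        forall b, 2 * nX <= b -> ll H1 b = ll H b]).
- by lia.
move=> k H1 kn ek sm [I1 I2 I3 I4]; have szk := size_sel p k.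
have e31 : rg H1 31 = m by rewrite (sameR sm).
split; first by side.
rewrite /= ek (sameA sm) //= lt0n hp; case: ifP => pk; last first.
  by rewrite /low_lab /= /upd /= selS pk.
have [x1 x2] := hx k kn; set q := size (sel p k) in I1 I2 I3 szk *.
apply: wp_seq; loop m (fun t0 (H2 : hst) =>
  (forall t, t < t0 -> lk H2 (q * m + t) = mt H 0 (r t) k) /\
  forall b, b < q * m -> lk H2 b = lk H1 b).
- by lia.
- move=> t H2 tm et sm2 [J1 J2].
  have [f1 f2 f3] : [/\ rg H2 32 = q, rg H2 31 = m & rg H2 20 = k].
    by rewrite !(sameR sm2).
  have g6 : ar H2 6 t = r t by rewrite (sameA sm2) // (sameA sm) //= hr.
  have rt := rY t tm.
  have [b1 b2] : q * m < S /\ q * m + t < N * N by split; nia.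
  split; [by side|by side; rewrite ?et f1 f2; lia| |].
    by side; rewrite ?et ?g6 ?f3; lia.
  rewrite /= /upd /= et f1 f2 f3 g6; split=> [t' |b bq].
    rewrite ltSE eqn_add2l; case: (t' =P t) => [-> _|_ /=]; last exact: J1.
    by rewrite (sameM sm2) // (sameM sm).
  by case: eqP => [|_]; [lia|apply: J2].
move=> H2 _ sm2 [J1 J2].
have [f1 f3] : rg H2 32 = q /\ rg H2 20 = k by rewrite !(sameR sm2).
apply: wp_seq; split; [by side|by side|by side; rewrite f1; lia|].
apply: wp_seq; split; [by side|by side|by side; rewrite f1; lia|].
split; [by side|].
rewrite /low_lab /= selS pk size_rcons /upd /= f1 f3 !(sameL sm2) // !(sameL sm) //=.
rewrite x1 x2; split=> [|t s tm|s|b bX].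
- by rewrite addn1.
- rewrite ltSE nth_rcons => /orP[/eqP->|sq]; first by rewrite ltnn eqxx J1.
  by rewrite sq J2 ?I2 //; nia.
- rewrite ltSE nth_rcons => /orP[/eqP->|sq].
    by rewrite ltnn !add0n !eqxx; split=> //; case: eqP => //; lia.
  have [a1 a2] := I3 s sq; rewrite sq !(sameLl sm2) //.
  by do 4 (case: eqP => [|_]; first by lia).
by rewrite (sameLl sm2) // I4 //; do 2 (case: eqP => [|_]; first by lia).
Qed.

Lemma write_presentation_spec H (p0 p1 : nat -> bool) (w x : nat -> grade) :
  dims H -> (forall i, (ar H 3 i != 0) = p0 i) -> has_lab H 4 5 nY w ->
  (forall i, (ar H 4 i != 0) = p1 i) -> has_lab H 0 1 nX x ->
  wp write_presentation (fun H' =>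
    let m := size (sel p0 nY) in let n := size (sel p1 nX) in
    [/\ [/\ rg H' 0 = m, rg H' 1 = n, rg H' 2 = 0, rg H' 3 = 2 * nX & rg H' 4 = 0],
        forall t s, t < m -> s < n ->
          lk H' (s * m + t) = mt H 0 (nth 0 (sel p0 nY) t) (nth 0 (sel p1 nX) s),
        low_lab H' (2 * nX) m (fun t => w (nth 0 (sel p0 nY) t)) &
        low_lab H' 0 n (fun s => x (nth 0 (sel p1 nX) s))]) H.
Proof.
move=> dH hp0 hw hp1 hx; have szY := size_sel p0 nY.
apply: wp_seq; apply: wp_use (write_rows_spec dH hp0 hw) _ => H1 sm1 [I1 I2 I3].
have dH1 := dims_same sm1 dH isT.
apply: wp_seq; apply: wp_use.
  apply: (write_columns_spec (m := size (sel p0 nY)) (x := x) (p := p1)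
    (r := nth 0 (sel p0 nY)) dH1 I1 szY I2).
  - by move=> t /sel_nth[].
  - by move=> i; rewrite (sameA sm1).
  - by move=> j jn; rewrite !(sameL sm1) //; apply: hx.
move=> H2 sm2 [J1 J2 J3 J4]; have [e0 e1 e2] := dims_same sm2 dH1 isT.
have e31 : rg H2 31 = size (sel p0 nY) by rewrite (sameR sm2).
do 4 (step1; rewrite /= /upd /=).
split; [by side|]; rewrite /= /upd /= e31 J1 e0; split=> //.
  by move=> t s tm sn; rewrite J2 // (sameM sm1).
by move=> t tm /=; rewrite !J4 ?leq_addr //; [apply: I3|lia].
Qed.

(* Register 33 holds the number of labels; the grades that occur for the first
   time are output together with their multiplicities. *)
Definition tally_labels (ap la lc o : nat) : hcmd :=
  SetR 31 (Num 0);;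
  For 20 33 (HIf (Le (Num 1) (Ar ap (Rg 20)))
    (SetR 28 (Num 0);; SetR 27 (Num 1);;
     For 22 33 (HIf (And (Le (Num 1) (Ar ap (Rg 22)))
         (And (And (LabLe la (Rg 22) la (Rg 20)) (LabLe la (Rg 20) la (Rg 22)))
              (And (LabLe lc (Rg 22) lc (Rg 20)) (LabLe lc (Rg 20) lc (Rg 22)))))
       (SetR 28 (Add (Rg 28) (Num 1));;
        HIf (Le (Add (Rg 22) (Num 1)) (Rg 20)) (SetR 27 (Num 0)) HSkip)
       HSkip);;
     HIf (Le (Num 1) (Rg 27))
       (SetLowI (Add (Mul (Num o) (Rg 9)) (Rg 31)) (Rg 28);;
        StoreL (Add (Mul (Num (2 * o)) (Rg 9)) (Mul (Num 2) (Rg 31))) la (Rg 20);;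
        StoreL (Add (Add (Mul (Num (2 * o)) (Rg 9)) (Mul (Num 2) (Rg 31))) (Num 1))
          lc (Rg 20);;
        SetR 31 (Add (Rg 31) (Num 1)))
       HSkip)
    HSkip).

(** List [o] has its own [N] low integer cells and [2 * N] low label cells; with three lists, this
    is why the low areas have sizes 3 N and 6 N. The headers end at cell 8, so that register 9
    survives. *)
Definition tally_class (ap la lc o rc : nat) : hcmd :=
  SetR 33 (Rg rc);; tally_labels ap la lc o;;
  SetR (3 * o) (Rg 31);; SetR (3 * o).+1 (Add (Num 64) (Mul (Num o) (Rg 9)));;
  SetR (3 * o).+2 (Mul (Num (2 * o)) (Rg 9)).

Section Tally.
Variables (p : nat -> bool) (l : nat -> grade).

Definition same_label t : pred nat := fun s => p s && (l s == l t).
Definition first_label t : bool := p t && (count_below (same_label t) t == 0).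

Lemma eq_label (y z : grade) : (y == z) =
  (((y.1 <= z.1) && (z.1 <= y.1)) && ((y.2 <= z.2) && (z.2 <= y.2)))%R.
Proof. by case: y z => [a b] [c d]; rewrite -!eq_le xpair_eqE. Qed.

Lemma tally_labels_spec H ap la lc o n :
  ap < 16 -> la < 8 -> lc < 8 -> o < 3 ->
  rg H 9 = N -> rg H 33 = n -> n < N ->
  (forall i, (ar H ap i != 0) = p i) -> has_lab H la lc n l ->
  let r := sel first_label n in
  wp (tally_labels ap la lc o) (fun H' =>
    [/\ rg H' 31 = size r,
      forall k, k < size r -> li H' (o * N + k) =
        count_below (same_label (nth 0 r k)) n,
      low_lab H' (2 * o * N) (size r) (fun k => l (nth 0 r k)),
      forall b, (b < o * N) || ((o + 1) * N <= b) -> li H' b = li H b &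
      forall b, (b < 2 * o * N) || (2 * (o + 1) * N <= b) -> ll H' b = ll H b]) H.
Proof.
move=> a16 la8 lb8 o3 e9 en nN hp hl r.
apply: wp_seq; split; [by side|rewrite /=].
loop n (fun t (H1 : hst) => let r := sel first_label t in
  [/\ rg H1 31 = size r,
      forall k, k < size r -> li H1 (o * N + k) =
        count_below (same_label (nth 0 r k)) n,
      low_lab H1 (2 * o * N) (size r) (fun k => l (nth 0 r k)),
      forall b, (b < o * N) || ((o + 1) * N <= b) -> li H1 b = li H b &
      forall b, (b < 2 * o * N) || (2 * (o + 1) * N <= b) -> ll H1 b = ll H b]).
- by lia.
move=> t H1 tn et sm I1.
have szt := size_sel first_label t.
split; first by side.
rewrite /= et (sameA sm) //= lt0n hp; case: ifP => pt; last first.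
  move: I1; rewrite /low_lab /= /upd /= selS /first_label pt /=.
  by [].
do 2 (step1; rewrite /=).
set H2 := setr 27 _ _.
have L2 i : i < n -> lb H2 la i = (l i).1 /\ lb H2 lc i = (l i).2.
  by move=> ii; rewrite !(sameL sm) //; apply: hl.
have [e31 [e33 e20]] : rg H2 31 = rg H1 31 /\ rg H2 33 = n /\ rg H2 20 = t.
  by rewrite /H2 /= /upd /= (sameR sm (r := 33)).
(* Register 28 counts all occurrences of the label of [t], whereas register 27 stays 1 as long as
   none is found before [t]; hence the minimum. *)
apply: wp_seq; loop n (fun s (H3 : hst) =>
  rg H3 28 = count_below (same_label t) s /\
  rg H3 27 = (count_below (same_label t) (minn s t) == 0)).
- by lia.
- by rewrite min0n.
- move=> s H3 sn es sm3 [J1 J2].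
  have [f31 f20] : rg H3 31 = rg H1 31 /\ rg H3 20 = t by rewrite !(sameR sm3).
  split; first by side.
  have -> : bev H3 (And (Le (Num 1) (Ar ap (Rg 22)))
         (And (And (LabLe la (Rg 22) la (Rg 20)) (LabLe la (Rg 20) la (Rg 22)))
              (And (LabLe lc (Rg 22) lc (Rg 20)) (LabLe lc (Rg 20) lc (Rg 22)))))
      = same_label t s.
    rewrite /= es f20 (sameA sm3) //= (sameA sm) // !(sameL sm3) //.
    have [-> ->] := L2 s sn; have [-> ->] := L2 t tn.
    by rewrite /same_label eq_label lt0n hp.
  have cs := count_below_le (same_label t) s.
  case: ifP => ss; last first.
    rewrite /= /upd /= count_belowS ss addn0; split=> //.
    rewrite J2; have [st|ts] := ltnP s t.
      by rewrite (minn_idPl st) count_belowS ss addn0.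
    by rewrite (minn_idPr _) // leqW.
  step1; split; [by side|].
  rewrite /= /upd /= es f20 addn1 J1.
  case: ifP => st.
    split; [by side|rewrite /= /upd /=].
    rewrite count_belowS ss !addn1 (minn_idPl st) count_belowS ss addn1.
    by split.
  rewrite /= /upd /= count_belowS ss !addn1; split=> //.
  by rewrite /= /upd /= J2 !(minn_idPr _) //; lia.
move=> H3 _ sm3 [J1 J2].
have [f31 f20] : rg H3 31 = rg H1 31 /\ rg H3 20 = t by rewrite !(sameR sm3).
have f9 : rg H3 9 = N by rewrite (sameR sm3) //= /upd /= (sameR sm).
move: J2; rewrite (minn_idPr (ltnW tn)) => J2.
split; first by side.
have fE : first_label t = (0 < rg H3 27).
  by rewrite /first_label pt J2; case: eqP.
rewrite [bev _ _]/= -fE; case: I1 => I1 I2 I3 I4 I5.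
have cn := count_below_le (same_label t) n.
have I4' b : li H3 b = li H1 b by rewrite (sameI sm3).
have I5' b : ll H3 b = ll H1 b by rewrite (sameLl sm3).
case: ifP => ft; last first.
  apply: wp_skip; rewrite /low_lab /= selS ft /upd /= f31; split=> // [k kr|k kr|b bb|b bb].
  - by rewrite I4' I2.
  - by rewrite !I5'; apply: I3.
  - by rewrite I4' I4.
  - by rewrite I5' I5.
have [oN1 oN2] : o * N < S /\ 2 * o * N < S by split; nia.
set q := size (sel first_label t) in I1 I2 I3 szt *.
have [b1 [b2 b3]] : o * N + q < 3 * N /\ 2 * o * N + 2 * q + 1 < 6 * N /\
  2 * o * N + 2 * q + 1 < S by nia.
apply: wp_seq; split; [by side; rewrite ?f9 ?f31 ?I1; lia|by side
  |by rewrite /= f9 f31 I1|].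
apply: wp_seq; split; [by side|by side; rewrite ?f9 ?f31 ?I1; lia
  |by rewrite /= f9 f31 I1; lia|].
apply: wp_seq; split; [by side|by side; rewrite ?f9 ?f31 ?I1; lia
  |by rewrite /= f9 f31 I1; lia|].
split; [by side; rewrite ?f31 ?I1; lia|].
have [l1 l2] := L2 t tn.
have g1 : lb H3 la t = (l t).1 by rewrite (sameL sm3).
have g2 : lb H3 lc t = (l t).2 by rewrite (sameL sm3).
rewrite /low_lab /= selS ft size_rcons /upd /= f9 f31 f20 I1 g1 g2 -/q.
split=> [|k|k|b bb|b bb].
- by rewrite addn1.
- rewrite ltSE nth_rcons -/q => /orP[/eqP->|kq]; first by rewrite ltnn !eqxx J1.
  by rewrite kq eqn_add2l (ltn_eqF kq) I4' I2.
- rewrite ltSE nth_rcons -/q => /orP[/eqP->|kq].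
    by rewrite ltnn !eqxx; split=> //; case: eqP => //; lia.
  have [a1 a2] := I3 k kq; rewrite kq !I5'.
  by do 4 (case: eqP => [|_]; first by lia).
- by rewrite I4' I4 //; case: eqP => // bE; nia.
- rewrite I5' I5 //; case: eqP => [|_]; first by nia.
  by case: eqP => [|_ //]; nia.
Qed.

Definition tallied H o n : Prop :=
  let r := sel first_label n in
  [/\ [/\ rg H (3 * o) = size r, rg H (3 * o).+1 = 64 + o * N &
        rg H (3 * o).+2 = 2 * o * N],
      forall k, k < size r -> li H (o * N + k) = count_below (same_label (nth 0 r k)) n &
      low_lab H (2 * o * N) (size r) (fun k => l (nth 0 r k))].

Lemma tally_class_spec H ap la lc o rc n :
  ap < 16 -> la < 8 -> lc < 8 -> o < 3 -> rc < 64 ->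
  rg H 9 = N -> rg H rc = n -> n < N ->
  (forall i, (ar H ap i != 0) = p i) -> has_lab H la lc n l ->
  wp (tally_class ap la lc o rc) (fun H' =>
    [/\ tallied H' o n,
      forall b, (b < o * N) || ((o + 1) * N <= b) -> li H' b = li H b &
      forall b, (b < 2 * o * N) || (2 * (o + 1) * N <= b) -> ll H' b = ll H b]) H.
Proof.
move=> a16 la8 lc8 o3 rc64 e9 en nN hp hl.
apply: wp_seq; split; [by side|rewrite /= en].
apply: wp_seq; apply: wp_use; first by apply: tally_labels_spec => //; exact: hl.
move=> H1 sm1 [I1 I2 I3 I4 I5].
have f9 : rg H1 9 = N by rewrite (sameR sm1).
have [b1 [b2 b3]] : o * N < S /\ 2 * o * N < S /\ 64 + o * N < S by nia.
step1; rewrite /=.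
have g9 : upd (rg H1) (3 * o) (rg H1 31) 9 = N.
  by rewrite /upd; case: eqP => //; lia.
apply: wp_seq; split; [by side; rewrite -?/(upd _ _ _ _) ?g9; lia|]; rewrite /= g9.
have h9 : upd (upd (rg H1) (3 * o) (rg H1 31)) (3 * o).+1 (64 + o * N) 9 = N.
  by rewrite /upd; do 2 (case: eqP => [|_]; first by lia).
split; [by side; rewrite -?/(upd _ _ _ _) ?h9; lia|].
rewrite /tallied /= h9; split=> //; split=> //; rewrite /upd !eqxx.
split.
- by do 2 (case: eqP => [|_]; first by lia).
- by case: eqP => [|_]; first by lia.
- by [].
Qed.

End Tally.

Definition write_betti : hcmd :=
  tally_class 3 4 5 0 11;; tally_class 4 0 1 1 10;; tally_class 5 6 7 2 10.

Lemma write_betti_spec H (p0 p1 p2 : nat -> bool) (w x u : nat -> grade) :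
  dims H -> rg H 9 = N ->
  (forall i, (ar H 3 i != 0) = p0 i) -> has_lab H 4 5 nY w ->
  (forall i, (ar H 4 i != 0) = p1 i) -> has_lab H 0 1 nX x ->
  (forall i, (ar H 5 i != 0) = p2 i) -> has_lab H 6 7 nX u ->
  wp write_betti (fun H' =>
    [/\ tallied p0 w H' 0 nY, tallied p1 x H' 1 nX & tallied p2 u H' 2 nX]) H.
Proof.
move=> dH e9 hp0 hw hp1 hx hp2 hu; have [d0 d1 d2] := dH.
apply: wp_seq; apply: wp_use.
  by apply: (tally_class_spec (n := nY) (p := p0) (l := w)) => //; lia.
move=> H1 sm1 [T0 _ _]; have [e0 e1 e2] := dims_same sm1 dH isT.
apply: wp_seq; apply: wp_use.
  apply: (tally_class_spec (n := nX) (p := p1) (l := x)) => //.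
  - by rewrite (sameR sm1).
  - by lia.
  - by move=> i; rewrite (sameA sm1).
  - by move=> j jn; rewrite !(sameL sm1) //; apply: hx.
move=> H2 sm2 [T1 B1 C1].
have [f0 f1 f2] := dims_same sm2 (And3 e0 e1 e2) isT.
apply: wp_use.
  apply: (tally_class_spec (n := nX) (p := p2) (l := u)) => //.
  - by rewrite (sameR sm2) // (sameR sm1).
  - by lia.
  - by move=> i; rewrite (sameA sm2) // (sameA sm1).
  - by move=> j jn; rewrite !(sameL sm2) // !(sameL sm1) //; apply: hu.
move=> H3 sm3 [T2 B2 C2]; split=> //.
- move: T0 => [[t1 t2 t3] t4 t5]; have szr := size_sel (first_label p0 w) nY.
  split=> [|k kr|k kr].
  + by rewrite !(sameR sm3) // !(sameR sm2).
  + by rewrite B2 ?B1 ?t4 //; lia.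
  + rewrite !C2; try by lia.
    by rewrite !C1; [apply: t5|lia|lia].
- move: T1 => [[t1 t2 t3] t4 t5]; have szr := size_sel (first_label p1 x) nX.
  split=> [|k kr|k kr].
  + by rewrite !(sameR sm3).
  + by rewrite B2 ?t4 //; lia.
  + by rewrite !C2; [apply: t5|lia|lia].
Qed.

End Programs.

(** * Free bipersistence modules *)

Arguments btr {K b y z} h.

Section Modules.
Local Open Scope ring_scope.
Variable K : fieldType.

Lemma inj_surj_bij (T U : Type) (f : T -> U) :
  injective f -> (forall y, exists x, f x = y) -> bijective f.
Proof.
move=> fi fs; exists (fun y => projT1 (cid (fs y))) => [x|y].
  by apply: fi; case: cid.
by case: cid.
Qed.

Lemma linear_inj (V W : lmodType K) (f : {linear V -> W}) :
  (forall v, f v = 0 -> v = 0) -> injective f.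
Proof.
move=> f0 u v /eqP; rewrite -subr_eq0 -linearB => /eqP/f0/eqP.
by rewrite subr_eq0 => /eqP.
Qed.

Lemma inv_linear (V W : lmodType K) (f : {linear V -> W}) (g : W -> V) :
  cancel f g -> cancel g f -> linear g.
Proof. by move=> fg gf a u v; apply: (can_inj fg); rewrite linearP !gf. Qed.

Definition bmor_comp_fun (M N P : bipmod K) (g : bmor N P) (f : bmor M N) z :
  M z -> P z := g z \o f z.
Lemma bmor_comp_linear M N P (g : bmor N P) (f : bmor M N) z :
  linear (@bmor_comp_fun M N P g f z).
Proof. by move=> a u v; rewrite /bmor_comp_fun /= !linearP. Qed.
HB.instance Definition _ (M N P : bipmod K) (g : bmor N P) (f : bmor M N) z :=
  GRing.isLinear.Build K (M z) (P z) _ (@bmor_comp_fun M N P g f z)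
    (bmor_comp_linear g f (z := z)).
Lemma bmor_comp_tr M N P (g : bmor N P) (f : bmor M N) y z (h : gle y z) v :
  bmor_comp_fun g f (btr h v) = btr h (bmor_comp_fun g f v).
Proof. by rewrite /bmor_comp_fun /= !bmap_tr. Qed.
Definition bmor_comp M N P (g : bmor N P) (f : bmor M N) : bmor M P :=
  @Bmor _ M P (fun z => @bmor_comp_fun M N P g f z) (bmor_comp_tr g f).

Definition bmor_id_fun (M : bipmod K) z : M z -> M z := id.
Lemma bmor_id_linear M z : linear (@bmor_id_fun M z). Proof. by []. Qed.
HB.instance Definition _ (M : bipmod K) z :=
  GRing.isLinear.Build K (M z) (M z) _ (@bmor_id_fun M z) (@bmor_id_linear M z).
Definition bmor_id M : bmor M M :=
  @Bmor _ M M (fun z => @bmor_id_fun M z) (fun _ _ _ _ => erefl).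

Lemma biso_refl (M : bipmod K) : biso M M.
Proof. by exists (bmor_id M) => z; exists id. Qed.

Lemma biso_trans (M N P : bipmod K) : biso M N -> biso N P -> biso M P.
Proof.
by move=> [f fb] [g gb]; exists (bmor_comp g f) => z; apply: bij_comp (gb z) (fb z).
Qed.

Section Inverse.
Variables (M N : bipmod K) (f : bmor M N).
Hypothesis fb : forall z, bijective (f z).

Lemma binv_ex z : exists g : N z -> M z, cancel (f z) g /\ cancel g (f z).
Proof. by case: (fb z) => g fg gf; exists g. Qed.
Definition binv_fun z : N z -> M z := projT1 (cid (binv_ex z)).
Lemma binv_funK z : cancel (f z) (@binv_fun z).
Proof. by rewrite /binv_fun; case: cid => g []. Qed.
Lemma binv_funVK z : cancel (@binv_fun z) (f z).
Proof. by rewrite /binv_fun; case: cid => g []. Qed.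
Lemma binv_linear z : linear (@binv_fun z).
Proof. exact: inv_linear (@binv_funK z) (@binv_funVK z). Qed.
HB.instance Definition _ z :=
  GRing.isLinear.Build K (N z) (M z) _ (@binv_fun z) (@binv_linear z).
Lemma binv_tr y z (h : gle y z) v : binv_fun (btr h v) = btr h (binv_fun v).
Proof.
by apply: (can_inj (@binv_funK z)); rewrite binv_funVK bmap_tr binv_funVK.
Qed.
Definition binv : bmor N M := @Bmor _ N M (fun z => @binv_fun z) binv_tr.
End Inverse.

Lemma biso_sym (M N : bipmod K) : biso M N -> biso N M.
Proof.
move=> [f fb]; exists (binv fb) => z.
by exists (f z); [exact: binv_funVK|exact: binv_funK].
Qed.

Section Projection.
Variables (M : bipmod K) (S : bsub M).
Definition bproj_fun z : M z -> bquot S z := lproj (S z).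
HB.instance Definition _ z := GRing.Linear.on (@bproj_fun z).
Lemma bproj_tr y z (h : gle y z) v : bproj_fun (btr h v) = btr h (bproj_fun v).
Proof. by rewrite /bproj_fun /= quot_tr_funE. Qed.
Definition bproj : bmor M (bquot S) := @Bmor _ M _ (fun z => @bproj_fun z) bproj_tr.
End Projection.

Section Corestriction.
Variables (M N : bipmod K) (T : bsub N) (f : bmor M N).
Hypothesis fT : forall z v, f z v \in T z.
Definition cores_fun z (v : M z) : bsubmod T z := Subspace (fT v).
Lemma cores_linear z : linear (@cores_fun z).
Proof. by move=> a u v; apply: val_inj; rewrite /= linearP. Qed.
HB.instance Definition _ z :=
  GRing.isLinear.Build K (M z) (bsubmod T z) _ (@cores_fun z) (@cores_linear z).
Lemma cores_tr y z (h : gle y z) v : cores_fun (btr h v) = btr h (cores_fun v).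
Proof. by apply: val_inj; rewrite /= bmap_tr. Qed.
Definition cores : bmor M (bsubmod T) := @Bmor _ M _ (fun z => @cores_fun z) cores_tr.
End Corestriction.

Section LiftQuotient.
Variables (V W : lmodType K) (S : submodClosed V) (f : {linear V -> W}).
Hypothesis fS : forall v, (f v = 0) <-> v \in S.
Hypothesis fsurj : forall w, exists v, f v = w.
Definition lquot_map (u : lquot S) : W := f (lrepr u).
Lemma lquot_mapE v : lquot_map (lproj S v) = f v.
Proof.
apply/eqP; rewrite -subr_eq0 -linearB; apply/eqP/fS.
exact/lproj_eq/lreprK.
Qed.
Lemma lquot_map_linear : linear lquot_map.
Proof.
by move=> a u v; rewrite -[u]lreprK -[v]lreprK -(linearP (lproj S)) !lquot_mapE linearP.
Qed.
HB.instance Definition _ :=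
  GRing.isLinear.Build K (lquot S) W _ lquot_map lquot_map_linear.
Definition lquot_lin : {linear lquot S -> W} := lquot_map.
Lemma lquot_map_bij : bijective lquot_lin.
Proof.
apply: inj_surj_bij => [|w]; last first.
  by have [v <-] := fsurj w; exists (lproj S v); rewrite [lquot_lin _]lquot_mapE.
apply: linear_inj => u; rewrite -[u]lreprK [lquot_lin _]lquot_mapE => /fS uS.
by rewrite -[RHS](linear0 (lproj S)); apply/lproj_eq; rewrite subr0.
Qed.
End LiftQuotient.

(** The first isomorphism theorem. *)
Lemma bquot_iso (M N : bipmod K) (S : bsub M) (q : bmor M N) :
  (forall z v, (q z v = 0) <-> v \in S z) ->
  (forall z w, exists v, q z v = w) -> biso (bquot S) N.
Proof.
move=> qS qs.
have tr y z (h : gle y z) (v : bquot S y) :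
    lquot_map (q z) (btr h v) = btr h (lquot_map (q y) v).
  by rewrite -[v]lreprK /= quot_tr_funE !lquot_mapE ?bmap_tr //; apply: qS.
pose L z : {linear bquot S z -> N z} := lquot_lin (qS z).
have trL y z (h : gle y z) (v : bquot S y) : L z (btr h v) = btr h (L y v).
  exact: tr.
exists (@Bmor _ (bquot S) N L trL) => z.
exact: lquot_map_bij (qS z) (qs z).
Qed.

Lemma has_dim_quot (V : lmodType K) (S : submodClosed V) k (f : {linear V -> 'rV[K]_k}) :
  (forall v, (f v = 0) <-> v \in S) -> (forall w, exists v, f v = w) ->
  has_dim (lquot S) k.
Proof.
move=> fS fs.
by exists (lquot_lin fS); apply: lquot_map_bij.
Qed.

(** * Coordinates in finitely generated free modules *)

Section Free.
Variables (n : nat) (l : 'I_n -> grade).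

Definition freemod : bipmod K := bdsum (fun i => Qmod K (l i)).

(* [Qmod] has components 'rV[K]_b with b a boolean: the sum has at most one term. *)
Definition entry (b : nat) (v : 'rV[K]_b) : K := \sum_(j < b) v 0 j.

Definition crd z (v : freemod z) (i : 'I_n) : K :=
  entry ((v : lprod (fun i => Qmod K (l i) z)) i : 'rV[K]_(gle (l i) z)).

Definition of_crd z (c : 'I_n -> K) : freemod z :=
  [ffun i => const_mx (c i) : 'rV[K]_(gle (l i) z)]
    : lprod (fun i => Qmod K (l i) z).

Lemma crd_of_crd z c i : crd (of_crd z c) i = if gle (l i) z then c i else 0.
Proof.
rewrite /crd /of_crd ffunE /entry; case: (gle (l i) z) => /=.
  by rewrite big_ord1 mxE.
by rewrite big_ord0.
Qed.

Lemma crd_supp z (v : freemod z) i : ~~ gle (l i) z -> crd v i = 0.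
Proof.
rewrite /crd /entry; move: (v i); rewrite /= /Qcomp.
by case: (gle (l i) z) => //= w _; rewrite big_ord0.
Qed.

Lemma crd_linear z a (u v : freemod z) i : crd (a *: u + v) i = a * crd u i + crd v i.
Proof.
rewrite /crd !ffunE /entry big_distrr -big_split /=.
by apply: eq_bigr => j _; rewrite !mxE.
Qed.

Lemma crd0 z i : crd (0 : freemod z) i = 0.
Proof. by rewrite /crd ffunE /entry big1 // => j _; rewrite mxE. Qed.

Lemma crdD z (u v : freemod z) i : crd (u + v) i = crd u i + crd v i.
Proof. by have := crd_linear 1 u v i; rewrite scale1r mul1r. Qed.

Lemma crdZ z a (u : freemod z) i : crd (a *: u) i = a * crd u i.
Proof. by have := crd_linear a u 0 i; rewrite addr0 crd0 addr0. Qed.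

Lemma crd_sum z (J : finType) (P : pred J) (F : J -> freemod z) i :
  crd (\sum_(j | P j) F j) i = \sum_(j | P j) crd (F j) i.
Proof.
elim/big_ind2: _ => [|x1 x2 y1 y2 <- <-|//]; first exact: crd0.
exact: crdD.
Qed.

Lemma crd_inj z (u v : freemod z) : (forall i, crd u i = crd v i) -> u = v.
Proof.
move=> E; apply/ffunP => i; have := E i; rewrite /crd.
move: (u i) (v i); rewrite /= /Qcomp /entry; case: (gle (l i) z) => /= a b.
  by rewrite !big_ord1 => ab; apply/rowP => j; rewrite ord1.
by move=> _; rewrite [a]thinmx0 [b]thinmx0.
Qed.

Lemma crd_tr y z (h : gle y z) (v : freemod y) i : crd (btr h v) i = crd v i.
Proof.
rewrite /crd /= ffunE /= /entry; have := fun g => @gle_trans (l i) y z g h.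
move: (v i); rewrite /= /Qcomp; case: (gle (l i) y) => [|] /= w.
  by move=> /(_ isT) ->; rewrite !big_ord1 mxE big_ord1 mxE mulr1.
by move=> _; rewrite big_ord0 big1 // => j _; rewrite mxE big_ord0.
Qed.

Lemma of_crdK z (v : freemod z) : of_crd z (crd v) = v.
Proof.
by apply: crd_inj => i; rewrite crd_of_crd; case: ifP => // /negbT/crd_supp->.
Qed.

Lemma of_crd_linear z a c d : of_crd z (fun i => a * c i + d i) = a *: of_crd z c + of_crd z d.
Proof.
by apply: crd_inj => i; rewrite crd_linear !crd_of_crd; case: ifP; rewrite ?mulr0 ?addr0.
Qed.

Lemma freemod_free : bfree freemod.
Proof. by exists n, l; apply: biso_refl. Qed.

End Free.

Section MatrixMorphism.
Variables (m n : nat) (rl : 'I_m -> grade) (cl : 'I_n -> grade) (A : 'M[K]_(m, n)).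
Hypothesis hA : forall i j, A i j <> 0 -> gle (rl i) (cl j).

Definition mulc (c : 'I_n -> K) (i : 'I_m) : K := \sum_j A i j * c j.
Definition mxmor_fun z (v : freemod cl z) : freemod rl z := of_crd rl z (mulc (crd v)).

Lemma mulc_supp z (v : freemod cl z) i : ~~ gle (rl i) z -> mulc (crd v) i = 0.
Proof.
move=> nz; rewrite /mulc big1 // => j _.
have [->|/eqP/hA rc] := eqVneq (A i j) 0; first by rewrite mul0r.
rewrite crd_supp ?mulr0 //; apply: contra nz; exact: gle_trans rc.
Qed.

Lemma crd_mxmor z (v : freemod cl z) i : crd (mxmor_fun v) i = mulc (crd v) i.
Proof. by rewrite crd_of_crd; case: ifP => // /negbT nz; rewrite mulc_supp. Qed.

Lemma mxmor_linear z : linear (@mxmor_fun z).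
Proof.
move=> a u v; apply: crd_inj => i; rewrite crd_linear !crd_mxmor /mulc.
rewrite big_distrr -big_split; apply: eq_bigr => j _ /=.
by rewrite crd_linear; ring.
Qed.
HB.instance Definition _ z :=
  GRing.isLinear.Build K (freemod cl z) (freemod rl z) _ (@mxmor_fun z) (@mxmor_linear z).
Lemma mxmor_tr y z (h : gle y z) v : mxmor_fun (btr h v) = btr h (mxmor_fun v).
Proof.
apply: crd_inj => i; rewrite crd_tr !crd_mxmor /mulc.
by apply: eq_bigr => j _; rewrite crd_tr.
Qed.
Definition mxmor : bmor (freemod cl) (freemod rl) :=
  @Bmor _ (freemod cl) (freemod rl) (fun z => @mxmor_fun z) mxmor_tr.
End MatrixMorphism.

Section Family.
Variables (F : bipmod K) (n : nat) (B : hfam F n).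

Lemma xmulE y z (h : gle y z) (v : F y) : xmul z v = btr h v.
Proof. by rewrite /xmul; case: {-}_ / idP => [h'|] //; rewrite (bool_irrelevance h' h). Qed.

Lemma btr_xmul x y z (hx : gle x y) (h : gle y z) (v : F x) :
  btr h (xmul y v) = xmul z v.
Proof. by rewrite (xmulE hx) (xmulE (gle_trans hx h)) (btr_comp _ _ (gle_trans hx h)). Qed.

Definition fam_fun z (v : freemod (hgr B) z) : F z :=
  \sum_(i | gle (hgr B i) z) crd v i *: xmul z (B i).
Lemma fam_linear z : linear (@fam_fun z).
Proof.
move=> a u v; rewrite /fam_fun scaler_sumr -big_split; apply: eq_bigr => i _ /=.
by rewrite crd_linear scalerDl scalerA.
Qed.
HB.instance Definition _ z :=
  GRing.isLinear.Build K (freemod (hgr B) z) (F z) _ (@fam_fun z) (@fam_linear z).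
Lemma fam_tr y z (h : gle y z) v : fam_fun (btr h v) = btr h (fam_fun v).
Proof.
rewrite /fam_fun linear_sum /=.
rewrite (bigID (fun i => gle (hgr B i) y)) /= [X in _ + X]big1 ?addr0.
  rewrite (eq_bigl (fun i => gle (hgr B i) y)).
    by apply: eq_bigr => i iy; rewrite linearZ /= btr_xmul // crd_tr.
  by move=> i /=; case iy : (gle (hgr B i) y); rewrite ?andbF ?andbT // (gle_trans iy h).
by move=> i /andP[_ iy]; rewrite crd_tr crd_supp // scale0r.
Qed.
Definition fam_mor : bmor (freemod (hgr B)) F :=
  @Bmor _ (freemod (hgr B)) F (fun z => @fam_fun z) fam_tr.

Lemma is_coord_fam z (v : F z) (c : 'cV[K]_n) : is_coord B v c ->
  v = fam_mor z (of_crd _ z (fun i => c i 0)).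
Proof.
move=> [_ ->]; apply: eq_bigr => i iz; by rewrite crd_of_crd iz.
Qed.

End Family.

Definition delta (n : nat) (i j : 'I_n) : K := if j == i then 1 else 0.

Lemma sum_delta n (F : 'I_n -> K) i : \sum_j F j * delta i j = F i.
Proof.
rewrite (bigD1 i) //= /delta eqxx mulr1 big1 ?addr0 // => j /negbTE->.
by rewrite mulr0.
Qed.

Lemma im_mem (M N : bipmod K) (f : bmor M N) z w :
  (w \in bim f z) <-> exists v, w = f z v.
Proof. by split=> [/asboolP|?]; last apply/asboolP. Qed.

Lemma ker_mem (M N : bipmod K) (f : bmor M N) z v :
  (v \in bker f z) <-> f z v = 0.
Proof. by split=> /eqP. Qed.

Section Generated.
Variables (F : bipmod K) (n : nat) (B : hfam F n).
Local Notation b := (hgr B).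

Lemma fam_delta i z (h : gle (b i) z) : fam_mor B z (of_crd b z (delta i)) = xmul z (B i).
Proof.
rewrite /= /fam_fun (bigD1 i) //= crd_of_crd h /delta eqxx scale1r big1 ?addr0 //.
by move=> j /andP[jz /negbTE ji]; rewrite crd_of_crd jz ji scale0r.
Qed.

Lemma generates_surj : generates B setT -> forall z v, exists c, fam_mor B z c = v.
Proof.
move=> gB z v; have /asboolP/(_ (bim (fam_mor B))) h := gB z v.
have /im_mem[c ->] : v \in bim (fam_mor B) z; last by exists c.
apply: h => y w [i _]; apply/im_mem; exists (of_crd b (b i) (delta i)).
rewrite (fam_delta (gle_refl _)) (xmulE (gle_refl _)); by rewrite btr_id.
Qed.

Lemma generates_minus i : generates B setT ->
  B i \in generated (in_fam B (setT :\ i)) (b i) -> generates B (setT :\ i).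
Proof.
move=> gB Bi z v; apply/asboolP => S HS.
have /asboolP h := gB z v; apply: h => y w [j _].
have [->|ji] := eqVneq j i; last by apply: HS; constructor; rewrite !inE ji.
by move: Bi => /asboolP; apply.
Qed.

Lemma fam_mem (S : bsub F) (c : 'I_n -> K) z (A : {set 'I_n}) :
  (forall j, j \in A -> B j \in S (b j)) ->
  (forall j, j \notin A -> c j = 0) -> fam_mor B z (of_crd b z c) \in S z.
Proof.
move=> SA cA; rewrite /= /fam_fun rpred_sum // => j jz.
rewrite crd_of_crd jz; have [jA|jA] := boolP (j \in A); last first.
  by rewrite cA // scale0r rpred0.
by rewrite rpredZ // (xmulE jz); apply: bsub_tr; apply: SA.
Qed.

End Generated.

(** * Minimal generating families are coordinate systems *)

Section Basis.
Variables (F : bipmod K) (n : nat) (B : hfam F n).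
Hypothesis Ff : bfree F.
Hypothesis Bb : is_basis B.
Local Notation b := (hgr B).

(** Otherwise dividing the relation by [c i] expresses [B i] through the other members, against
    minimality. *)
Lemma basis_rel i (c : 'I_n -> K) : fam_mor B (b i) (of_crd b (b i) c) = 0 ->
  gle (b i) (b i) -> c i = 0.
Proof.
move=> c0 bi; apply/eqP; apply: contraT => ci0.
have [gB mB] := Bb; case: (mB (setT :\ i)).
  by rewrite properEneq subsetT andbT; apply/eqP => /setP/(_ i); rewrite !inE eqxx.
apply: generates_minus => //.
pose d j := delta i j - (c i)^-1 * c j.
have -> : B i = fam_mor B (b i) (of_crd b (b i) d).
  have -> : of_crd b (b i) d = - (c i)^-1 *: of_crd b (b i) c + of_crd b (b i) (delta i).
    rewrite -of_crd_linear; congr of_crd; apply/funext => j; rewrite /d; ring.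
  by rewrite linearP c0 scaler0 add0r fam_delta // (xmulE bi) btr_id.
apply: (@fam_mem _ _ _ _ d _ (setT :\ i)) => [j ji|j].
  apply/asboolP => S HS; apply: HS; by constructor.
rewrite !inE andbT negbK => /eqP->.
by rewrite /d /delta eqxx mulVf // subrr.
Qed.

(** The free basis supplied by [bfree] has the uniqueness that [B] lacks so far. [P] holds the
    coordinates of [B] in it and [Q] those of preimages of it under [fam_mor B], so that [P Q = 1]
    and the relations among [B] are the kernel of [P]. *)
Lemma basis_matrix : exists (m : nat) (P : 'M[K]_(m, n)) (Q : 'M[K]_(n, m))
    (g : 'I_m -> grade),
  [/\ P *m Q = 1%:M, forall i k, Q i k <> 0 -> gle (b i) (g k),
      forall k i, P k i <> 0 -> gle (g k) (b i) &
      forall z (c : freemod b z), (fam_mor B z c = 0) <-> forall k, mulc P (crd c) k = 0].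
Proof.
have [m [g [phi phib]]] := Ff; have [gB _] := Bb.
pose P : 'M[K]_(m, n) := \matrix_(k, i) crd (l := g) (phi _ (B i)) k.
have PE z (c : freemod b z) k : crd (l := g) (phi z (fam_mor B z c)) k = mulc P (crd c) k.
  rewrite /= /fam_fun linear_sum /= crd_sum /mulc big_mkcond /=.
  apply: eq_bigr => i _; case: ifP => [iz|/negbT iz]; last by rewrite crd_supp // mulr0.
  by rewrite linearZ /= crdZ (xmulE iz) bmap_tr crd_tr mxE mulrC.
have exQ k : exists c : freemod b (g k), phi _ (fam_mor B _ c) = of_crd g (g k) (delta k).
  have [psi _ psiK] := phib (g k).
  have [c cE] := generates_surj gB (psi (of_crd g (g k) (delta k))).
  by exists c; rewrite cE psiK.
pose q k := projT1 (cid (exQ k)).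
have qE k : phi _ (fam_mor B _ (q k)) = of_crd g (g k) (delta k) by rewrite /q; case: cid.
pose Q : 'M[K]_(n, m) := \matrix_(i, k) crd (q k) i.
exists m, P, Q, g; split.
- apply/matrixP => k k'; rewrite !mxE.
  transitivity (mulc P (crd (q k')) k).
    by apply: eq_bigr => i _; rewrite [Q _ _]mxE.
  rewrite -PE qE crd_of_crd /delta; have [->|ne] := eqVneq k k'.
    by rewrite gle_refl.
  by case: ifP.
- move=> i k; rewrite mxE; case: (boolP (gle (b i) (g k))) => // /crd_supp->.
  by case.
- move=> k i; rewrite mxE; case: (boolP (gle (g k) (b i))) => // /crd_supp->.
  by case.
move=> z c; split=> [c0 k|c0]; first by rewrite -PE c0 linear0 crd0.
apply: (bij_inj (phib z)); rewrite linear0; apply: crd_inj => k.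
by rewrite PE c0 crd0.
Qed.

(** The columns of the idempotent [E = 1 - Q P] are relations among [B], so by [basis_rel] its
    entries between equal grades vanish. Hence [E] is strictly triangular for the order of grades,
    thus nilpotent, and an idempotent that is nilpotent is zero. *)
Lemma basis_iso z : bijective (fam_mor B z).
Proof.
have [gB _] := Bb; apply: inj_surj_bij; last exact: generates_surj.
have [m [P [Q [g [PQ Qb Pb PE]]]]] := basis_matrix.
pose E := 1%:M - Q *m P.
have PE0 : P *m E = 0 by rewrite mulmxBr mulmx1 mulmxA PQ mul1mx subrr.
have EE : E *m E = E by rewrite {1}/E mulmxBl mul1mx -mulmxA PE0 mulmx0 subr0.
have Eb i j : E i j <> 0 -> gle (b i) (b j).
  rewrite !mxE; have [->|ne] := eqVneq i j; first by rewrite gle_refl.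
  rewrite sub0r => /eqP; rewrite oppr_eq0; apply: contraNT => nb.
  rewrite big1 // => k _; have [->|/eqP/Qb qb] := eqVneq (Q i k) 0.
    by rewrite mul0r.
  have [->|/eqP/Pb pb] := eqVneq (P k j) 0; first by rewrite mulr0.
  by move: nb; rewrite (gle_trans qb pb).
have Estrict i j : E i j <> 0 -> b i <> b j.
  move=> Eij bij; have bz := Eb _ _ Eij; have bz' : gle (b j) (b i).
    by rewrite bij gle_refl.
  have rel : fam_mor B (b j) (of_crd b (b j) (fun k => E k j)) = 0.
    apply/PE => k; move/matrixP/(_ k j): PE0; rewrite !mxE => PEkj.
    rewrite -[RHS]PEkj; apply: eq_bigr => i' _; rewrite crd_of_crd.
    by case: ifP => // /negP ne; case: (E i' j =P 0) => [->//|/Eb].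
  apply: Eij; apply: (@basis_rel i (fun k => E k j) _ (gle_refl _)).
  have -> : of_crd b (b i) (fun k => E k j) = btr bz' (of_crd b (b j) (fun k => E k j)).
    by apply: crd_inj => k; rewrite crd_tr !crd_of_crd bij.
  by rewrite bmap_tr rel linear0.
(* The number of members of strictly smaller grade drops along every nonzero entry of [E]; induction
   on it replaces nilpotency. *)
pose below j := [set k | gle (b k) (b j) && (b k != b j)].
have E0 : E = 0.
  suff H s i j : (#|below j| < s)%N -> E i j = 0.
    by apply/matrixP => i j; rewrite [RHS]mxE; apply: H (ltnSn _).
  elim: s i j => // s IH i j sj; apply/eqP; apply: contraT => /eqP Eij.
  move: {-1}(Eij); rewrite -[in E i j]EE mxE; case; apply: big1 => k _.
  have [->|/eqP Ekj] := eqVneq (E k j) 0; first by rewrite mulr0.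
  rewrite IH ?mul0r //; apply: (@leq_trans #|below j|); last by rewrite -ltnS.
  apply: proper_card.
  have kj := Eb _ _ Ekj; have /eqP kj' := Estrict _ _ Ekj.
  apply/properP; split; last by exists k; rewrite !inE ?kj ?kj' // eqxx andbF.
  apply/subsetP => t; rewrite !inE => /andP[tk tk']; rewrite (gle_trans tk kj).
  apply: contra kj' => /eqP tj; apply/eqP; apply: gle_anti => //.
  by rewrite -tj.
have QP : Q *m P = 1%:M by apply/eqP; rewrite eq_sym -subr_eq0 -/E E0.
apply: linear_inj => c /PE c0; apply: crd_inj => i; rewrite crd0.
transitivity (mulc (Q *m P) (crd c) i).
  rewrite QP /mulc (bigD1 i) //= !mxE eqxx mul1r big1 ?addr0 // => j ji.
  by rewrite !mxE eq_sym (negbTE ji) mul0r.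
rewrite /mulc; transitivity (\sum_k Q i k * mulc P (crd c) k).
  rewrite /mulc; under eq_bigr => j _ do rewrite mxE big_distrl /=.
  rewrite exchange_big /=; apply: eq_bigr => k _; rewrite big_distrr /=.
  by apply: eq_bigr => j _; rewrite mulrA.
by rewrite big1 // => k _; rewrite c0 mulr0.
Qed.

End Basis.

(** * The standard basis and the submodule generated from below *)

Section Standard.
Variables (n : nat) (l : 'I_n -> grade).

Section Vanishing.
Variable W : grade -> 'I_n -> bool.
Hypothesis WE : forall y z i, gle y z -> W z i -> ~~ W y i -> ~~ gle (l i) y.
(** By the condition on [W], a coordinate required to vanish at [z] but not at [y] is zero at [y]
    anyway, so these spaces form a submodule. One choice of [W] separates a standard generator from
    the others, another one bounds [Isub] from above. *)
Definition van_pred z : {pred freemod l z} := fun v => [forall i, W z i ==> (crd v i == 0)].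
Arguments van_pred z : clear implicits.
Lemma van_predP z (v : freemod l z) :
  reflect (forall i, W z i -> crd v i = 0) (v \in van_pred z).
Proof.
by apply: (iffP forallP) => h i; [move=> wi; move: (h i); rewrite wi => /eqP|
  apply/implyP => /h ->].
Qed.
Lemma van_closed z : submod_closed (van_pred z).
Proof.
split=> [|a u v /van_predP hu /van_predP hv]; apply/van_predP => i wi.
  exact: crd0.
by rewrite crd_linear hu // hv // mulr0 addr0.
Qed.
HB.instance Definition _ z :=
  GRing.isSubmodClosed.Build K (freemod l z) (van_pred z) (van_closed z).
Lemma van_tr y z (h : gle y z) v : v \in van_pred y -> btr h v \in van_pred z.
Proof.
move=> /van_predP hv; apply/van_predP => i wi; rewrite crd_tr.
by have [wy|wy] := boolP (W y i); [apply: hv|apply: crd_supp (WE h wi wy)].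
Qed.
Definition vanishing : bsub (freemod l) := @Bsub _ (freemod l) van_pred van_tr.
End Vanishing.

Definition std : hfam (freemod l) n := @Hfam _ (freemod l) n l (fun i => of_crd l (l i) (delta i)).

Lemma std_fam z (v : freemod l z) : fam_mor std z v = v.
Proof.
apply: crd_inj => k; rewrite /= /fam_fun crd_sum big_mkcond /=.
rewrite (bigD1 k) //= big1 ?addr0 => [|i ik]; case: ifP => [iz|/negbT nz] //.
- by rewrite crdZ (xmulE iz) crd_tr crd_of_crd gle_refl /delta eqxx mulr1.
- by rewrite crd_supp.
- by rewrite crdZ (xmulE iz) crd_tr crd_of_crd /delta eq_sym (negbTE ik) if_same mulr0.
Qed.

Lemma std_basis : is_basis std.
Proof.
split=> [z v|A /properP[_ [i _ iA]] gA].
  rewrite -(std_fam v) -(of_crdK v); apply: (@fam_mem _ _ std _ _ _ setT) => j.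
    by move=> _; apply/asboolP => S; apply; constructor.
  by rewrite inE.
have WE (y z : grade) (j : 'I_n) :
  gle y z -> j == i -> ~~ (j == i) -> ~~ gle (l j) y by move=> _ ->.
have /asboolP/(_ (vanishing WE)) h := gA (l i) (std i).
have /van_predP/(_ i (eqxx i)) : std i \in vanishing WE (l i).
  apply: h => y w [j jA]; apply/van_predP => k /eqP->.
  rewrite crd_of_crd /delta; case: eqP => [ij|_]; last by rewrite if_same.
  by move: iA; rewrite ij jA.
by rewrite crd_of_crd gle_refl /delta eqxx => /eqP; rewrite oner_eq0.
Qed.

(** A multiple of a generator of grade below [z] comes from below, whereas the coordinates at
    generators of grade exactly [z] vanish on everything that does. Minimality and Betti numbers can
    thus be read off the labels. *)
Lemma Isub_std z (v : freemod l z) :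
  (v \in Isub (freemod l) z) <-> (forall i, l i = z -> crd v i = 0).
Proof.
have WE (x y : grade) (j : 'I_n) :
    gle x y -> l j == y -> ~~ (l j == x) -> ~~ gle (l j) x.
  move=> xy /eqP ->; apply: contra => yx; apply/eqP; exact: gle_anti.
split=> [/asboolP/(_ (vanishing WE)) h i liz|v0].
  have /van_predP : v \in vanishing WE z; last by apply; apply/eqP.
  apply: h => y w [x [hx [u [xy ->]]]]; apply/van_predP => j /eqP lj.
  rewrite crd_tr crd_supp // lj; apply/negP => yx.
  by case/andP: xy => /eqP; case; apply: gle_anti.
rewrite -(std_fam v).
have -> : fam_mor std z v = \sum_(i | gle (l i) z) crd v i *: xmul z (std i) by [].
rewrite rpred_sum // => i iz; have [liz|liz] := eqVneq (l i) z.
  by rewrite v0 // scale0r rpred0.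
rewrite rpredZ //; apply/asboolP => S; apply; exists (l i), iz, (std i); split; last exact: xmulE.
by rewrite /glt liz iz.
Qed.

Definition top_fun z k (e : 'I_k -> 'I_n) (v : freemod l z) : 'rV[K]_k :=
  \row_t crd v (e t).
Lemma top_linear z k e : linear (@top_fun z k e).
Proof. by move=> a u v; apply/rowP => t; rewrite !mxE crd_linear. Qed.
HB.instance Definition _ z k e :=
  GRing.isLinear.Build K (freemod l z) 'rV[K]_k _ (@top_fun z k e) (@top_linear z k e).

Lemma freemod_betti z : has_dim (bquot (Isub (freemod l)) z) #|[pred i | l i == z]|.
Proof.
pose e := fun t : 'I_#|[pred i | l i == z]| => enum_val t.
apply: (@has_dim_quot (freemod l z) (Isub (freemod l) z) _ (top_fun (z:=z) e)) => [v|w].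
  split=> [/rowP v0|/Isub_std v0].
    apply/Isub_std => i /eqP lz; have zi : i \in [pred i | l i == z] by [].
    by have := v0 (enum_rank_in zi i); rewrite !mxE /e enum_rankK_in.
  apply/rowP => t; rewrite !mxE v0 //; have := enum_valP t; rewrite inE.
  by move/eqP.
pose c i := \sum_(t | e t == i) w 0 t.
exists (of_crd l z c); apply/rowP => t; rewrite mxE crd_of_crd.
have /eqP lz : l (e t) == z by have := enum_valP t; rewrite inE.
rewrite lz gle_refl /c (big_pred1 t) // => s.
by rewrite /= (inj_eq enum_val_inj).
Qed.

End Standard.

(** * Minimal resolutions of length two given by matrices *)

Section Resolution.
Variables (m n r : nat) (rl : 'I_m -> grade) (cl : 'I_n -> grade) (ul : 'I_r -> grade).
Variables (A : 'M[K]_(m, n)) (U : 'M[K]_(n, r)).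
Hypothesis hA : forall i j, A i j <> 0 -> gle (rl i) (cl j) /\ rl i <> cl j.
Hypothesis hU : forall i j, U i j <> 0 -> gle (cl i) (ul j) /\ cl i <> ul j.
Hypothesis AU : forall i j, mulc A (fun k => U k j) i = 0.
Hypothesis kerA : forall z (v : freemod cl z), (forall i, mulc A (crd v) i = 0) ->
  exists w : freemod ul z, forall i, crd v i = mulc U (crd w) i.
Hypothesis injU : forall d, (forall i, mulc U d i = 0) -> forall j, d j = 0.

Definition no_lab (i : 'I_0) : grade := (0, 0).
Definition zero_mor k (l : 'I_k -> grade) : bmor (freemod no_lab) (freemod l).
Proof.
by apply: (@mxmor k 0 l no_lab 0) => i j; rewrite mxE.
Defined.

Definition res_mod (i : nat) : bipmod K :=
  match i with 0 => freemod rl | 1 => freemod cl | 2 => freemod ul | _ => freemod no_lab end.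
Definition res_diff (i : nat) : bmor (res_mod i.+1) (res_mod i) :=
  match i return bmor (res_mod i.+1) (res_mod i) with
  | 0 => mxmor (fun i j h => (hA (i:=i) (j:=j) h).1)
  | 1 => mxmor (fun i j h => (hU (i:=i) (j:=j) h).1)
  | 2 => zero_mor ul
  | _ => zero_mor no_lab
  end.
Definition res_chain : bchain K := @Bchain K res_mod res_diff.

Lemma freemod0_zero z (v : freemod no_lab z) : v = 0.
Proof. by apply: crd_inj => -[]. Qed.

Lemma mulcA a b c (A' : 'M[K]_(a, b)) (B' : 'M[K]_(b, c)) d i :
  mulc A' (mulc B' d) i = \sum_j mulc A' (fun k => B' k j) i * d j.
Proof.
rewrite /mulc; under eq_bigr => j _ do rewrite big_distrr /=.
rewrite exchange_big /=; apply: eq_bigr => j _; rewrite big_distrl /=.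
by apply: eq_bigr => k _; rewrite mulrA.
Qed.

(** At grade [z], a generator of grade [z] can only receive contributions from source generators of
    grade at most [z], but a nonzero entry makes the source grade strictly larger. *)
Lemma strict_Isub a b (la : 'I_a -> grade) (lb : 'I_b -> grade) (B : 'M[K]_(a, b))
  (hB : forall i j, B i j <> 0 -> gle (la i) (lb j) /\ la i <> lb j) z (v : freemod lb z) :
  mxmor (fun i j h => (hB i j h).1) z v \in Isub (freemod la) z.
Proof.
apply/Isub_std => i liz; rewrite /= crd_mxmor; last first.
  by move=> ? ? /hB[].
rewrite /mulc big1 // => j _; have [->|/eqP/hB[le ne]] := eqVneq (B i j) 0.
  by rewrite mul0r.
rewrite crd_supp ?mulr0 //; apply/negP => jz; apply: ne.
by apply: gle_anti => //; rewrite liz.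
Qed.

Lemma res_minimal : is_minimal res_chain.
Proof.
move=> [|[|i]] z v /im_mem[u ->]; [exact: strict_Isub|exact: strict_Isub|].
by case: i u v => [|i] u v; rewrite [u]freemod0_zero linear0 rpred0.
Qed.

Lemma res_resolution M : biso (bcoker (res_diff 0)) M -> is_resolution res_chain M.
Proof.
move=> iM; split=> //.
- by case=> [|[|[|i]]]; apply: freemod_free.
- case=> [|[|i]] z v; split.
  + move=> /im_mem[u ->]; apply/ker_mem; apply: crd_inj => i.
    rewrite crd0 /= crd_mxmor; last by move=> ? ? /hA[].
    transitivity (mulc A (mulc U (crd u)) i).
      by apply: eq_bigr => j _; rewrite crd_mxmor // => ? ? /hU[].
    by rewrite mulcA big1 // => j _; rewrite AU mul0r.
  + move=> /ker_mem v0; have [i|w wE] := @kerA z v.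
      by rewrite -(crd_mxmor (rl := rl)) ?[mxmor_fun _ _ _]v0 ?crd0 // => ? ? /hA[].
    apply/im_mem; exists w; apply: crd_inj => i.
    by rewrite wE /= crd_mxmor // => ? ? /hU[].
  + move=> /im_mem[u ->]; apply/ker_mem; by rewrite [u]freemod0_zero !linear0.
  + move=> /ker_mem v0; apply/im_mem; exists 0; rewrite linear0; apply: crd_inj => j.
    rewrite crd0; apply: injU => i.
    by rewrite -(crd_mxmor (rl := cl)) ?[mxmor_fun _ _ _]v0 ?crd0 // => ? ? /hU[].
  + move=> /im_mem[u ->]; apply/ker_mem.
    by case: i v u => [|i] _ u; rewrite [u]freemod0_zero !linear0.
  + move=> _; apply/im_mem; exists 0; rewrite linear0.
    by case: i v => [|i] v; rewrite [v]freemod0_zero.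
Qed.

Lemma res_minimal_presentation M : biso (bcoker (res_diff 0)) M ->
  is_minimal_presentation rl cl A M.
Proof.
move=> iM; exists res_chain, (std cl), (std rl); split=> //.
- exact: res_resolution.
- exact: res_minimal.
- by split; apply: std_basis.
- move=> j; split=> [i /= nz|].
    by rewrite mxE; case: (A i j =P 0) => // /hA[]; rewrite (negbTE nz).
  transitivity (fam_mor (std rl) (cl j) (of_crd rl (cl j) (fun i => col j A i 0))).
    rewrite std_fam /= /mxmor_fun; congr of_crd; apply/funext => i.
    rewrite mxE /mulc -[RHS](sum_delta (A i)); apply: eq_bigr => k _.
    congr (_ * _); rewrite crd_of_crd /delta; case: eqP => [->|_].
      by rewrite gle_refl.
    by rewrite if_same.
  by apply: eq_bigr => i iz; rewrite crd_of_crd iz.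
Qed.

Lemma res_betti M z : biso (bcoker (res_diff 0)) M ->
  [/\ is_betti M 0 z #|[pred i | rl i == z]|,
      is_betti M 1 z #|[pred i | cl i == z]| &
      is_betti M 2 z #|[pred i | ul i == z]| ].
Proof.
move=> iM; have R := res_resolution iM.
by split; exists res_chain; split; try exact: R; try exact: res_minimal;
  apply: freemod_betti.
Qed.

End Resolution.

End Modules.

(** * From the reduced matrices to resolutions *)

Section Correctness.
Local Open Scope ring_scope.

Section Selection.
Variables (K : fieldType) (p : nat -> bool) (n : nat).
Local Notation k := (size (sel p n)).
Local Notation rho t := (nth 0%N (sel p n) t).

Lemma sum_sel (psi : nat -> K) :
  (forall i, (i < n)%N -> ~~ p i -> psi i = 0) ->
  \sum_(i < n) psi i = \sum_(t < k) psi (rho t).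
Proof.
move=> h; rewrite -(big_mkord xpredT (fun t => psi (rho t))) -(big_nth 0%N xpredT).
rewrite big_filter -(big_mkord xpredT) [RHS]big_mkcond /index_iota subn0.
rewrite big_seq [RHS]big_seq; apply: eq_bigr => i; rewrite mem_iota => /= ii.
by case: ifP => // /negbT/h ->.
Qed.

(** Extension by zero, from positions in the list of selected indices to all indices. *)
Definition spread (c : 'I_k -> K) (i : nat) : K :=
  \sum_(t < k) (if rho t == i then c t else 0).

Lemma spread_rho c (t : 'I_k) : spread c (rho t) = c t.
Proof.
rewrite /spread (bigD1 t) //= eqxx big1 ?addr0 // => s st.
case: eqP => // /(sel_inj (ltn_ord s) (ltn_ord t)) E.
by case/eqP: st; apply: val_inj.
Qed.

Lemma spread_out (c : 'I_k -> K) i : (i < n)%N -> ~~ p i -> spread c i = 0.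
Proof.
move=> ii pi; rewrite /spread big1 // => t _; case: eqP => // E.
by have [_] := sel_nth (ltn_ord t); rewrite E (negbTE pi).
Qed.

Lemma spread_in (c : 'I_k -> K) i : (i < n)%N -> spread c i <> 0 ->
  exists2 t : 'I_k, rho t = i & c t <> 0.
Proof.
move=> ii ci; have pi : p i.
  by apply: contraT => /(spread_out c ii) E; case: ci.
have [t tk tE] := sel_mem ii pi; exists (Ordinal tk) => //.
by rewrite -(spread_rho c) /= tE.
Qed.

Lemma app_spread (A : nat -> nat -> K) c i : app n A (spread c) i = \sum_(t < k) A i (rho t) * c t.
Proof.
rewrite /app (sum_sel (psi := fun j => A i j * spread c j)).
  by apply: eq_bigr => t _; rewrite spread_rho.
by move=> j jn pj; rewrite spread_out // mulr0.
Qed.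

Lemma app_sel (A : nat -> nat -> K) c i : (forall j, (j < n)%N -> c j <> 0 -> p j) ->
  app n A c i = \sum_(t < k) A i (rho t) * c (rho t).
Proof.
move=> h; rewrite /app (sum_sel (psi := fun j => A i j * c j)) // => j jn pj.
by have [->|/eqP/(h j jn)] := eqVneq (c j) 0; rewrite ?mulr0 // (negbTE pj).
Qed.
End Selection.

Section Extension.
Variable K : fieldType.
(** Programs index by natural numbers and modules by ordinals; these total extensions translate,
    with irrelevant values out of range. *)
Definition ext1 n (l : 'I_n -> grade) (i : nat) : grade :=
  if insub i is Some i' then l i' else (0, 0).
Definition ext2 m n (A : 'M[K]_(m, n)) (i j : nat) : K :=
  if insub i is Some i' then if insub j is Some j' then A i' j' else 0 else 0.
Definition extc n (c : 'I_n -> K) (i : nat) : K :=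
  if insub i is Some i' then c i' else 0.
Lemma ext1E n l (i : 'I_n) : ext1 l i = l i. Proof. by rewrite /ext1 valK. Qed.
Lemma ext2E m n A (i : 'I_m) (j : 'I_n) : ext2 A i j = A i j.
Proof. by rewrite /ext2 !valK. Qed.
Lemma extcE n c (i : 'I_n) : extc c i = c i. Proof. by rewrite /extc valK. Qed.
Lemma app_ext2 m n (A : 'M[K]_(m, n)) c (i : 'I_m) :
  app n (ext2 A) c i = mulc A (fun j => c j) i.
Proof. by apply: eq_bigr => j _; rewrite ext2E. Qed.
End Extension.

Lemma sup_crd (K : fieldType) n (l : 'I_n -> grade) z (c : freemod K l z) i :
  crd c i <> 0 -> gle (l i) z.
Proof. by case: (boolP (gle (l i) z)) => // /crd_supp ->. Qed.

Section Represented.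
Variables (K : fieldType) (X Y : bipmod K) (nX nY : nat).
Variables (phi : bmor X Y) (BX : hfam X nX) (BY : hfam Y nY) (A : 'M[K]_(nY, nX)).
Hypothesis rep : represents phi BX BY A.

Lemma represents_gle i j : A i j <> 0 -> gle (hgr BY i) (hgr BX j).
Proof.
have [h _] := rep j; case: (boolP (gle _ _)) => // /h; by rewrite mxE.
Qed.

Lemma represents_fam z (c : freemod K (hgr BX) z) :
  phi z (fam_mor BX z c) = fam_mor BY z (mxmor represents_gle z c).
Proof.
rewrite {1}/fam_mor /= {1}/fam_fun linear_sum /=.
transitivity (fam_mor BY z (\sum_(j | gle (hgr BX j) z)
    crd c j *: of_crd (hgr BY) z (fun i => A i j))).
  rewrite linear_sum; apply: eq_bigr => j jz /=.
  rewrite !linearZ /=; congr (_ *: _).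
  rewrite (xmulE jz) bmap_tr (is_coord_fam (rep j)) -bmap_tr; congr (fam_mor _ _ _).
  apply: crd_inj => i; rewrite crd_tr !crd_of_crd mxE.
  case: ifP => [ij|/negbT ij]; first by rewrite (gle_trans ij jz).
  by case: ifP => // _; case: (A i j =P 0) => // /represents_gle; rewrite (negbTE ij).
congr (fam_mor _ _ _); apply: crd_inj => i; rewrite crd_sum /= crd_of_crd.
rewrite big_mkcond /= /mulc; case: ifP => iz; last first.
  by rewrite big1 // => j _; case: ifP; rewrite ?crdZ ?crd_of_crd ?iz ?mulr0.
apply: eq_bigr => j _; case: ifP => [jz|/negbT jz]; last by rewrite crd_supp // mulr0.
by rewrite crdZ crd_of_crd iz mulrC.
Qed.

End Represented.

Section Main.
Variables (K : fieldType) (nX nY nZ : nat).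
Variables (f : bigraded_mx K nY nX) (g : bigraded_mx K nZ nY).
Let x := ext1 (clab f).
Let y := ext1 (clab g).

Lemma clab_sorted m n (A : bigraded_mx K m n) : sorted_labels n (ext1 (clab A)).
Proof.
move=> i j ij jn; have ii : (i < n)%N by lia.
rewrite -[i]/(val (Ordinal ii)) -[j]/(val (Ordinal jn)) !ext1E.
exact: clab_colex.
Qed.

(** * From FI-Reps to matrices *)

Section FromFIRep.
Variables (X Y Z : bipmod K) (phi : bmor X Y) (gam : bmor Y Z).
Variables (BX : hfam X nX) (BY : hfam Y nY) (BZ : hfam Z nZ).
Hypotheses (Xf : bfree X) (Yf : bfree Y) (Zf : bfree Z).
Hypotheses (bX : is_basis BX) (bY : is_basis BY) (bZ : is_basis BZ).
Hypotheses (lX : hgr BX =1 clab f) (lY : hgr BY =1 clab g).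
Hypotheses (rf : represents phi BX BY f) (rg' : represents gam BY BZ g).
Hypothesis gf0 : forall z v, gam z (phi z v) = 0.

Lemma FIRep_gle i j : (i < nY)%N -> (j < nX)%N -> ext2 f i j <> 0 -> gle (y i) (x j).
Proof.
move=> ii jn; rewrite -[i]/(val (Ordinal ii)) -[j]/(val (Ordinal jn)).
rewrite ext2E /x /y !ext1E -lX -lY; exact: represents_gle rf _ _.
Qed.

(** Evaluating the composite at the [j]-th basis element of [X] gives column [j] of the matrix
    product as coordinates of zero, and [fam_mor BZ] is injective by [basis_iso]. *)
Lemma FIRep_gf l j : (l < nZ)%N -> (j < nX)%N ->
  app nY (ext2 g) ((ext2 f)^~ j) l = 0.
Proof.
move=> ln jn; suff H (l' : 'I_nZ) (j' : 'I_nX) :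
    app nY (ext2 g) ((ext2 f)^~ j') l' = 0 by exact: (H (Ordinal ln) (Ordinal jn)).
move: l' j' => {ln jn}l {}j; rewrite app_ext2.
have := gf0 (fam_mor BX _ (std K (hgr BX) j)).
rewrite (represents_fam rf) (represents_fam rg') => gf.
have := bij_inj (basis_iso Zf bZ (hgr BX j)).
move=> /(_ _ 0 (etrans gf (esym (linear0 _)))) /(congr1 (fun v => crd v l)).
rewrite crd0 /= crd_mxmor => [|? ?]; last exact: represents_gle rg' _ _.
move=> E; rewrite -[RHS]E /mulc; apply: eq_bigr => i _; congr (_ * _).
rewrite crd_mxmor => [|? ?]; last exact: represents_gle rf _ _.
rewrite ext2E /mulc -[LHS](sum_delta (f i)); apply: eq_bigr => k _.
congr (_ * _); rewrite crd_of_crd; case: ifP => // /negbT.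
by rewrite /delta; case: eqP => // ->; rewrite gle_refl.
Qed.

(** * The cokernel of the computed presentation is the homology *)

Section Resolved.
Variables (h U V : nat -> nat -> K) (p0 p1 p2 : nat -> bool) (w u : nat -> grade).
Hypothesis Res : resolved nZ nY nX (ext2 g) (ext2 f) y x h U p0 p1 p2 w u V.

Local Notation m := (size (sel p0 nY)).
Local Notation n := (size (sel p1 nX)).
Local Notation r := (size (sel p2 nX)).
Local Notation rho t := (nth 0%N (sel p0 nY) t).
Local Notation kap t := (nth 0%N (sel p1 nX) t).
Local Notation ups t := (nth 0%N (sel p2 nX) t).

Definition rl (t : 'I_m) : grade := w (rho t).
Definition cl (s : 'I_n) : grade := x (kap s).
Definition ul (q : 'I_r) : grade := u (ups q).
Definition presA : 'M[K]_(m, n) := \matrix_(t, s) h (rho t) (kap s).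
Definition presU : 'M[K]_(n, r) := \matrix_(s, q) U (kap s) (ups q).
Definition presV : 'M[K]_(nY, m) := \matrix_(k, t) V k (rho t).

Lemma presA_strict t s : presA t s <> 0 -> gle (rl t) (cl s) /\ rl t <> cl s.
Proof.
rewrite mxE => hts; have [ii pi] := sel_nth (ltn_ord t).
have [jn pj] := sel_nth (ltn_ord s).
by have [] := rh Res ii jn hts.
Qed.

Lemma presU_strict s q : presU s q <> 0 -> gle (cl s) (ul q) /\ cl s <> ul q.
Proof.
rewrite mxE => Usq; have [jn pj] := sel_nth (ltn_ord s).
have [qn pq] := sel_nth (ltn_ord q); have [H _] := rU Res qn pq.
by have [] := H _ jn Usq.
Qed.

Lemma presV_gle k t : presV k t <> 0 -> gle (hgr BY k) (rl t).
Proof.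
rewrite mxE => Vkt; have [ii pi] := sel_nth (ltn_ord t).
have [H _] := rV Res ii pi; have := H k (ltn_ord k) Vkt.
by rewrite /y ext1E lY.
Qed.

Lemma mulc_presV (c : 'I_m -> K) (k : 'I_nY) : mulc presV c k = app nY V (spread c) k.
Proof. by rewrite app_spread; apply: eq_bigr => t _; rewrite mxE. Qed.

Lemma mulc_presA (c : 'I_n -> K) (t : 'I_m) :
  mulc presA c t = app nX h (spread c) (rho t).
Proof. by rewrite app_spread; apply: eq_bigr => s _; rewrite mxE. Qed.

Lemma mulc_presU (c : 'I_r -> K) (s : 'I_n) :
  mulc presU c s = app nX U (spread c) (kap s).
Proof. by rewrite app_spread; apply: eq_bigr => q _; rewrite mxE. Qed.

Lemma spread_supported k (q : nat -> bool) (l : nat -> grade) z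
    (c : freemod K (fun t : 'I_(size (sel q k)) => l (nth 0%N (sel q k) t)) z) :
  supported k l q z (spread (crd c)).
Proof.
move=> i ii /(spread_in ii)[t tE ct]; rewrite -tE; split.
  by have [] := sel_nth (ltn_ord t).
exact: (sup_crd ct).
Qed.

Lemma app_h_out e i : (i < nY)%N -> ~~ p0 i -> app nX h e i = 0.
Proof.
move=> ii pi; rewrite /app big1 // => j _.
have [->|/eqP hij] := eqVneq (h i j) 0; first by rewrite mul0r.
by have [pi' _ _] := rh Res ii (ltn_ord j) hij; rewrite pi' in pi.
Qed.

Lemma presAU s q : mulc presA (fun k => presU k q) s = 0.
Proof.
have [qn pq] := sel_nth (ltn_ord q); have [H1 H2] := rU Res qn pq.
have [ii pi] := sel_nth (ltn_ord s).
rewrite -(H2 _ ii) (app_sel (p := p1)).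
  by apply: eq_bigr => k _; rewrite !mxE.
by move=> j jn Uj; have [] := H1 j jn Uj.
Qed.

Lemma presA_ker z (v : freemod K cl z) : (forall i, mulc presA (crd v) i = 0) ->
  exists w' : freemod K ul z, forall i, crd v i = mulc presU (crd w') i.
Proof.
move=> v0; have [|d sd dE] := rker Res (@spread_supported nX p1 x z v).
  move=> i ii; have [pi|pi] := boolP (p0 i); last exact: app_h_out.
  have [t tm tE] := sel_mem ii pi.
  by have := v0 (Ordinal tm); rewrite mulc_presA /= tE.
exists (of_crd ul z (fun q => d (ups q))) => s.
have [jn pj] := sel_nth (ltn_ord s).
rewrite -(spread_rho (crd v) s) dE // (app_sel (p := p2)).
  apply: eq_bigr => q _; rewrite mxE crd_of_crd; case: ifP => // /negbT nq.
  have [qn pq] := sel_nth (ltn_ord q).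
  have [->|/eqP dq] := eqVneq (d (ups q)) 0; first by rewrite mulr0.
  by have [_] := sd _ qn dq; rewrite (negbTE nq).
by move=> j jn' /(sd j jn')[].
Qed.

Lemma presU_inj (d : 'I_r -> K) : (forall i, mulc presU d i = 0) -> forall j, d j = 0.
Proof.
move=> d0 j; rewrite -(spread_rho d j); apply: (rinj Res); last first.
  by have [] := sel_nth (ltn_ord j).
move=> i ii; have [pi|pi] := boolP (p1 i).
  have [s sn sE] := sel_mem ii pi.
  by have := d0 (Ordinal sn); rewrite mulc_presU /= sE.
rewrite app_spread big1 // => q _; have [qn pq] := sel_nth (ltn_ord q).
have [->|/eqP Uiq] := eqVneq (U i (ups q)) 0; first by rewrite mul0r.
have [H _] := rU Res qn pq; have [pi' _ _] := H i ii Uiq.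
by rewrite pi' in pi.
Qed.

Definition gens : bmor (freemod K rl) Y := bmor_comp (fam_mor BY) (mxmor presV_gle).

Lemma gens_ker z v : gens z v \in bker gam z.
Proof.
apply/ker_mem; rewrite /gens /= /bmor_comp_fun /=.
rewrite [gam z _](represents_fam rg') -[RHS](linear0 (fam_mor BZ z)).
congr (fam_mor _ _ _); apply: crd_inj => l; rewrite crd0 /= crd_mxmor => [|? ?];
  last exact: represents_gle rg' _ _.
transitivity (mulc g (mulc presV (crd v)) l).
  apply: eq_bigr => k _; rewrite crd_mxmor // => ? ?; exact: presV_gle.
rewrite mulcA big1 // => t _; have [ii pi] := sel_nth (ltn_ord t).
have [_ H] := rV Res ii pi; have := H l (ltn_ord l).
rewrite app_ext2 => E; rewrite [mulc _ _ _](_ : _ = 0) ?mul0r // -[RHS]E.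
by apply: eq_bigr => k _; rewrite mxE.
Qed.

(** The augmentation of the resolution: each generator goes to the class of the cycle given by its
    column of [V]. Its kernel comes from [rrel] and its surjectivity from [rsurj]. *)
Definition to_homology : bmor (freemod K rl) (bhomology phi gam) :=
  bmor_comp (bproj _) (cores (T := bker gam) gens_ker).

Lemma crd_gens z (v : freemod K rl z) k : crd (mxmor presV_gle z v) k = app nY V (spread (crd v)) k.
Proof. by rewrite -mulc_presV /= crd_mxmor // => ? ?; exact: presV_gle. Qed.

Lemma crd_phi z (c : freemod K (hgr BX) z) k :
  crd (mxmor (represents_gle rf) z c) k = app nX (ext2 f) (extc (crd c)) k.
Proof.
rewrite /= crd_mxmor => [|? ?]; last exact: represents_gle rf _ _.
by rewrite app_ext2; apply: eq_bigr => j _; rewrite extcE.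
Qed.

Lemma extc_supported k (l : 'I_k -> grade) (l' : nat -> grade) z (c : freemod K l z) :
  (forall i : 'I_k, l' i = l i) -> supported k l' predT z (extc (crd c)).
Proof.
move=> ll i ii; rewrite -[i]/(val (Ordinal ii)) extcE ll => ci.
by split=> //; apply: sup_crd ci.
Qed.

Lemma xE (i : 'I_nX) : x i = hgr BX i. Proof. by rewrite /x ext1E lX. Qed.
Lemma yE (i : 'I_nY) : y i = hgr BY i. Proof. by rewrite /y ext1E lY. Qed.

Lemma of_crd_supported k (l : 'I_k -> grade) (l' : nat -> grade) q z (c : nat -> K) (i : 'I_k) :
  (forall i : 'I_k, l' i = l i) -> supported k l' q z c ->
  crd (of_crd l z (fun i : 'I_k => c i)) i = c i.
Proof.
move=> ll sc; rewrite crd_of_crd -ll; case: ifP => // /negbT nz.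
have [//|/eqP ci] := eqVneq (c i) 0.
by have [_] := sc i (ltn_ord i) ci; rewrite (negbTE nz).
Qed.

Lemma gens_im z (v : freemod K rl z) : (gens z v \in bim phi z) <->
  exists2 d, supported nX x predT z d &
    forall k, (k < nY)%N -> app nY V (spread (crd v)) k = app nX (ext2 f) d k.
Proof.
split=> [/im_mem[a aE]|[d sd dE]].
  have [c cE] := generates_surj bX.1 a; exists (extc (crd c)).
    exact: extc_supported xE.
  move: aE; rewrite -cE (represents_fam rf) /gens /= => /(bij_inj (basis_iso Yf bY z)).
  move=> E k kn; rewrite -[k]/(val (Ordinal kn)) -crd_gens -crd_phi; congr crd.
  exact: E.
apply/im_mem; exists (fam_mor BX z (of_crd _ z (fun i : 'I_nX => d i))).
rewrite (represents_fam rf) /gens /= /bmor_comp_fun /=; congr fam_fun.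
apply: crd_inj => k; rewrite [LHS]crd_gens [RHS]crd_phi dE //.
apply: app_ext => j jn; rewrite -[j]/(val (Ordinal jn)) extcE.
by rewrite (of_crd_supported _ xE sd).
Qed.

Lemma to_homology_ker z v : (to_homology z v = 0) <->
  v \in bim (res_diff presA_strict presU_strict 0) z.
Proof.
have -> : (to_homology z v = 0) <-> gens z v \in bim phi z.
  rewrite /to_homology /= /bmor_comp_fun /= /bproj_fun -[0](linear0 (lproj _)).
  by rewrite lproj_eq subr0.
rewrite gens_im; have sv := @spread_supported nY p0 w z v; rewrite (rrel Res sv).
split=> [[e se eE]|/im_mem[a ->]].
  apply/im_mem; exists (of_crd cl z (fun s => e (kap s))); apply: crd_inj => t.
  rewrite /= crd_mxmor => [|? ?]; last by case/presA_strict.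
  have [ii pi] := sel_nth (ltn_ord t).
  rewrite -(spread_rho (crd v) t) eE // (app_sel (p := p1)); last first.
    by move=> j jn /(se j jn)[].
  apply: eq_bigr => s _; rewrite mxE crd_of_crd; case: ifP => // /negbT ns.
  have [jn pj] := sel_nth (ltn_ord s).
  have [->|/eqP es] := eqVneq (e (kap s)) 0; first by rewrite mulr0.
  by have [_] := se _ jn es; rewrite (negbTE ns).
exists (spread (crd a)); first exact: spread_supported.
move=> i ii; have [pi|pi] := boolP (p0 i); last first.
  by rewrite spread_out // app_h_out.
have [t tm tE] := sel_mem ii pi.
rewrite -[in LHS]tE -[t]/(val (Ordinal tm)) spread_rho /= crd_mxmor => [|? ?];
  last by case/presA_strict.
by rewrite mulc_presA /= tE.
Qed.

Lemma to_homology_surj z b : exists v, to_homology z v = b.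
Proof.
rewrite -[b]lreprK; set a := lrepr b; have /ker_mem a0 : val a \in bker gam z := valP a.
have [c cE] := generates_surj bY.1 (val a).
have gc i : mulc g (crd c) i = 0.
  move: a0; rewrite -cE (represents_fam rg') -[0](linear0 (fam_mor BZ z)).
  move=> /(bij_inj (basis_iso Zf bZ z)) /(congr1 (fun v => crd v i)).
  rewrite crd0 /= crd_mxmor // => ? ?; exact: represents_gle rg' _ _.
have [|v [d [sv sd E]]] := rsurj Res (@extc_supported _ _ _ z c yE).
  move=> l ln; rewrite -[l]/(val (Ordinal ln)) app_ext2 -[RHS](gc (Ordinal ln)).
  by apply: eq_bigr => k _; rewrite extcE.
pose v' := of_crd rl z (fun t => v (rho t)); exists v'.
rewrite /to_homology /= /bmor_comp_fun /= /bproj_fun; apply/lproj_eq.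
suff H : gens z v' - val a \in bim phi z by exact: H.
pose d' := of_crd (hgr BX) z (fun j : 'I_nX => d j).
(* By [rsurj] the cycle is a combination of generators plus the boundary of [d], so the difference
   is minus that boundary. *)
apply/im_mem; exists (- fam_mor BX z d').
rewrite linearN /= (represents_fam rf) -cE /gens /= /bmor_comp_fun /=.
rewrite -[fam_fun c]/(fam_mor BY z c) -[X in X - _]/(fam_mor BY z (mxmor presV_gle z v')).
rewrite -linearB -linearN; congr (fam_mor BY z _); apply: crd_inj => k.
rewrite crdD -[- c]scaleN1r crdZ -[- mxmor_fun _ _ _]scaleN1r crdZ !mulN1r.
rewrite crd_gens [crd (mxmor_fun _ _ _) k]crd_phi.
have := E k (ltn_ord k); rewrite extcE => ->.
have -> : app nY V (spread (crd v')) k = app nY V v k.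
  rewrite app_spread (app_sel (p := p0)) => [|i ii /(sv i ii)[] //].
  apply: eq_bigr => t _; congr (_ * _); rewrite crd_of_crd; case: ifP => // /negbT nt.
  have [ii pi] := sel_nth (ltn_ord t).
  have [//|/eqP vt] := eqVneq (v (rho t)) 0.
  by have [_] := sv _ ii vt; rewrite (negbTE nt).
rewrite [app nX _ (extc _) _](app_ext _ (d := d)); last first.
  move=> j jn; rewrite -[j]/(val (Ordinal jn)) extcE.
  by rewrite (of_crd_supported _ xE sd).
by rewrite opprD addrA subrr sub0r.
Qed.

Lemma resolved_coker M : biso M (bhomology phi gam) ->
  biso (bcoker (res_diff presA_strict presU_strict 0)) M.
Proof.
move=> iM; apply: biso_trans (biso_sym iM).
exact: bquot_iso to_homology_ker to_homology_surj.
Qed.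

End Resolved.
End FromFIRep.

Section FromResolved.
Variables (M : bipmod K) (h U V : nat -> nat -> K).
Variables (p0 p1 p2 : nat -> bool) (w u : nat -> grade).
Hypothesis fgM : is_FIRep f g M.
Hypothesis Res : resolved nZ nY nX (ext2 g) (ext2 f) y x h U p0 p1 p2 w u V.

Theorem resolved_presentation :
  is_minimal_presentation (@rl p0 w) (@cl p1) (presA h p0 p1) M.
Proof.
have [X [Y [Z [phi [gam [BX [BY [BZ]]]]]]]] := fgM.
case=> [[Xf Yf Zf] [[bX bY bZ] [[lX lY] [[rf rg'] [gf iM]]]]].
apply: (res_minimal_presentation (presAU Res) (presA_ker Res) (presU_inj Res)
  (resolved_coker Yf Zf bX bY bZ lX lY rf rg' Res iM)).
Qed.

Theorem resolved_betti z :
  [/\ is_betti M 0 z #|[pred i | @rl p0 w i == z]|,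
      is_betti M 1 z #|[pred i | @cl p1 i == z]| &
      is_betti M 2 z #|[pred i | @ul p2 u i == z]| ].
Proof.
have [X [Y [Z [phi [gam [BX [BY [BZ]]]]]]]] := fgM.
case=> [[Xf Yf Zf] [[bX bY bZ] [[lX lY] [[rf rg'] [gf iM]]]]].
apply: (res_betti (presAU Res) (presA_ker Res) (presU_inj Res) z
  (resolved_coker Yf Zf bX bY bZ lX lY rf rg' Res iM)).
Qed.

End FromResolved.
End Main.

End Correctness.

(** * Main theorem *)

(** Before any address is formed, register 9 receives one more than the sum of the three sizes, a
    strict bound on every dimension. *)
Definition program (c : hcmd) : cmd :=
  Seq (ISet (INum 9) (IAdd (IAdd (IAdd (IGet (INum 0)) (IGet (INum 1)))
        (IGet (INum 2))) (INum 1)))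
    (comp (resolve;; c)).

(** * Running the programs on an input *)

Section Run.
Variables (K : fieldType) (nX nY nZ : nat).
Variables (f : bigraded_mx K nY nX) (g : bigraded_mx K nZ nY) (M : bipmod K).
Variables (s : state K) (S : nat).
Local Notation N := (nX + nY + nZ + 1).
Hypothesis fgM : is_FIRep f g M.
Hypothesis sin : is_input f g s.
Hypothesis hS : 200 * (N * N) <= S.

Lemma run_program c (Q : hst K -> Prop) : wf (resolve;; c) ->
  (forall H, resolved_state nX nY nZ (ext2 g) (ext2 f) (ext1 (clab g)) (ext1 (clab f)) H ->
     rg H 9 = N -> wp N S c Q H) ->
  exists (s' : state K) t H',
    [/\ exec S (program c) s s' t, t <= cost N (program c), rep N S H' s' & Q H'].
Proof.
move=> wfc hc; have N0 : 0 < N by lia.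
have [iE [fE gE] _ [xE yE] _] := sin.
have NS : 64 + N < S by nia.
have [e0 [e1 e2]] : imem s 0 = nX /\ imem s 1 = nY /\ imem s 2 = nZ by rewrite !iE.
pose s1 : state K := State (upd (imem s) 9 N) (kmem s) (lmem s).
have x1 : exec S (ISet (INum 9) (IAdd (IAdd (IAdd (IGet (INum 0)) (IGet (INum 1)))
    (IGet (INum 2))) (INum 1))) s s1 12.
  have h v : v <= 64 + N -> word S v = Some v.
    by move=> vN; rewrite /word; have -> : v < S by lia.
  apply: (@ExecISet _ _ _ (INum 9) (IAdd (IAdd (IAdd (IGet (INum 0))
    (IGet (INum 1))) (IGet (INum 2))) (INum 1))).
    by rewrite /= h.
  by rewrite /=; do ?[rewrite h ?e0 ?e1 ?e2 /=; last lia].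
(* Every area is read off the initial memory, so that [rep] holds by construction; only the bound on
   the integer cells uses the form of the input. *)
pose H := HSt (imem s1) (fun a i => imem s1 (64 + a + 3 * N + 16 * i))
  (fun x => imem s1 (64 + x)) (kmem s1)
  (fun q i j => kmem s1 (N * N + q + 8 * (j * N + i))) (lmem s1)
  (fun a i => lmem s1 (a + 6 * N + 8 * i)).
have r1 : rep N S H s1.
  split=> //; split=> //= a; rewrite /upd; case: eqP => _; first by lia.
  by rewrite iE; case: a => [|[|[|[|a]]]] /=; lia.
have [X [Y [Z [phi [gam [BX [BY [BZ]]]]]]]] := fgM.
case=> [[Xf Yf Zf] [[bX bY bZ] [[lX lY] [[rf rg'] [gf iM]]]]].
have /wp_frame W : wp N S (resolve;; c) Q H.
  apply: wp_seq; apply: wp_use.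
    apply: (@resolve_spec _ _ _ N0 hS nX nY nZ _ H (ext2 g) (ext2 f)
      (ext1 (clab g)) (ext1 (clab f))).
    - by lia.
    - by split.
    - move=> i j ii jn; rewrite -[i]/(val (Ordinal ii)) -[j]/(val (Ordinal jn)).
      by rewrite ext2E -fE.
    - move=> i j ii jn; rewrite -[i]/(val (Ordinal ii)) -[j]/(val (Ordinal jn)).
      by rewrite ext2E -gE.
    - move=> j jn; rewrite -[j]/(val (Ordinal jn)) ext1E -xE /= add0n mul2n.
      by rewrite addn1.
    - move=> j jn; rewrite -[j]/(val (Ordinal jn)) ext1E -yE /= !mul2n.
      by rewrite addn1.
    - exact: clab_sorted.
    - exact: clab_sorted.
    - exact: FIRep_gle lX lY rf.
    - by move=> l j; apply: (FIRep_gf Zf bZ rf rg' gf).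
  move=> H1 sm R1; apply: hc => //.
  by rewrite (sameR sm).
have [s' [t [H' [x2 t2 r2 [q2 _]]]]] := wp_sound N0 hS wfc W r1.
exists s', (12 + t), H'; split=> //; first exact: ExecSeq x1 x2.
Qed.

End Run.

Lemma card_sel (p q : nat -> bool) n :
  #|[pred t : 'I_(size (sel p n)) | q (nth 0 (sel p n) t)]| =
  count_below (fun i => p i && q i) n.
Proof.
rewrite -sum1_card /=.
rewrite -(big_mkord (fun t => q (nth 0 (sel p n) t)) (fun=> 1)).
rewrite -(big_nth 0 q (fun=> 1)) sum1_count /count_below count_filter.
by apply: eq_count => i /=; rewrite andbC.
Qed.

Section Outputs.
Variables (K : fieldType) (N S : nat) (M : bipmod K) (s : state K) (H : hst K).
Hypothesis hS : 200 * (N * N) <= S.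
Hypothesis Hs : rep N S H s.

Lemma low_lab_at b k (l : nat -> grade) : low_lab H b k l -> b + 2 * k <= 6 * N ->
  lab_at s b (fun t : 'I_k => l t).
Proof.
move=> hl bN j; have [_ _ _ hll _] := Hs; have [l1 l2] := hl j (ltn_ord j).
have jk := ltn_ord j; rewrite -!mul2n -[(b + _).+1]addn1 !hll; try by lia.
by rewrite l1 l2; case: (l j).
Qed.

Lemma tallied_betti (p : nat -> bool) (l : nat -> grade) o n : o < 3 -> n < N ->
  tallied N p l H o n ->
  (forall z, is_betti M o z #|[pred t : 'I_(size (sel p n)) | l (nth 0 (sel p n) t) == z]|) ->
  let k := imem s (3 * o) in
  let vbase := imem s (3 * o).+1 in let gbase := imem s (3 * o).+2 in
  exists gr : 'I_k -> grade,
    [/\ lab_at s gbase gr, injective gr,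
        vbase + k <= S /\ gbase + k.*2 <= S,
        forall j : 'I_k, is_betti M o (gr j) (imem s (vbase + j))
      & forall z, (forall j, gr j != z) -> is_betti M o z 0].
Proof.
move=> o3 nN [[t1 t2 t3] t4 t5] B; have [[hr hli _ _ _] _ _ hll _] := Hs.
rewrite !hr ?t1 ?t2 ?t3; try by lia.
set rr := sel (first_label p l) n in t1 t4 t5 *.
have szr : size rr <= n := size_sel _ _.
have {}B z : is_betti M o z (count_below (fun i => p i && (l i == z)) n).
  by rewrite -card_sel.
have first j : j < size rr -> nth 0 rr j < n /\ first_label p l (nth 0 rr j).
  exact: sel_nth.
exists (fun j : 'I_(size rr) => l (nth 0 rr j)); split.
- by apply: (low_lab_at (l := fun j => l (nth 0 rr j)) t5); nia.
- move=> i j E; apply: val_inj; apply: (sel_inj (ltn_ord i) (ltn_ord j)).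
  have [in' fi] := first i (ltn_ord i); have [jn fj] := first j (ltn_ord j).
  have H2 a b : a < b -> first_label p l b -> p a -> l a = l b -> False.
    move=> ab /andP[_ /eqP c0] pa lab; move: c0; rewrite /count_below => /eqP.
    rewrite -leqn0 leqNgt -has_count => /hasPn/(_ a).
    by rewrite mem_iota ab /same_label pa lab eqxx => /(_ isT).
  case: (ltngtP (nth 0 (sel (first_label p l) n) i)
                (nth 0 (sel (first_label p l) n) j)) => // lt.
    by case: (H2 _ _ lt fj (andP fi).1 E).
  by case: (H2 _ _ lt fi (andP fj).1 (esym E)).
- by split; nia.
- move=> j; have jn := ltn_ord j.
  have -> : imem s (64 + o * N + j) = li H (o * N + j).
    by rewrite -addnA hli //; nia.
  by rewrite t4 //; apply: B.
move=> z hz; suff <- : count_below (fun i => p i && (l i == z)) n = 0 by apply: B.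
apply/eqP; rewrite /count_below -leqn0 leqNgt -has_count; apply/hasPn => i0.
rewrite mem_iota /= add0n => i0n; apply/negP => Pi0.
(* The least index with label [z] is a first occurrence, so [z] would be in the list. *)
have ex : exists i, p i && (l i == z) by exists i0.
case: (ex_minnP ex) => a /andP[pa /eqP la] amin.
have fa : first_label p l a.
  rewrite /first_label pa /= /count_below -leqn0 leqNgt -has_count.
  apply/hasPn => b; rewrite mem_iota /= add0n => ba; apply/negP.
  by rewrite /same_label la => /amin; lia.
have an : a < n by apply: leq_ltn_trans (amin _ Pi0) i0n.
have [k kr kE] := sel_mem an fa.
by have := hz (Ordinal kr); rewrite /= -/rr in kE *; rewrite kE la eqxx.
Qed.

End Outputs.

Section Correct.
Variables (K : fieldType) (nX nY nZ : nat).
Variables (f : bigraded_mx K nY nX) (g : bigraded_mx K nZ nY) (M : bipmod K).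
Variables (s : state K) (S : nat).
Local Notation N := (nX + nY + nZ + 1).
Hypothesis fgM : is_FIRep f g M.
Hypothesis sin : is_input f g s.
Hypothesis hS : 200 * (N * N) <= S.

Lemma presentation_correct : exists (s' : state K) t,
  [/\ exec S (program write_presentation) s s' t,
      t <= cost N (program write_presentation) & outputs_presentation S s' M].
Proof.
have N0 : 0 < N by lia.
have hN : nX + nY + nZ < N by lia.
pose Q (H' : hst K) := exists h U V p0 p1 p2 w u,
  let m := size (sel p0 nY) in let n := size (sel p1 nX) in
  resolved nZ nY nX (ext2 g) (ext2 f) (ext1 (clab g)) (ext1 (clab f)) h U p0 p1 p2 w u V /\
  [/\ [/\ rg H' 0 = m, rg H' 1 = n, rg H' 2 = 0, rg H' 3 = 2 * nX & rg H' 4 = 0],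
      forall t s, t < m -> s < n ->
        lk H' (s * m + t) = h (nth 0 (sel p0 nY) t) (nth 0 (sel p1 nX) s),
      low_lab H' (2 * nX) m (fun t => w (nth 0 (sel p0 nY) t)) &
      low_lab H' 0 n (fun s => ext1 (clab f) (nth 0 (sel p1 nX) s))].
have [||s' [t [H' [x2 t2 r2 q2]]]] := @run_program K nX nY nZ f g M s S fgM sin hS
    write_presentation Q.
- by vm_compute.
- move=> H [dH hx [U [V R]]] e9; apply: wp_conseq.
    apply: (write_presentation_spec N0 hS hN dH (p0 := fun i => ar H 3 i != 0)
      (p1 := fun i => ar H 4 i != 0) (w := fun i => (lb H 4 i, lb H 5 i)) _ _ _ hx) => //.
  move=> H' W; exists (mt H 0), U, V, (fun i => ar H 3 i != 0), (fun i => ar H 4 i != 0).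
  exists (fun i => ar H 5 i != 0), (fun i => (lb H 4 i, lb H 5 i)).
  by exists (fun i => (lb H 6 i, lb H 7 i)).
exists s', t; split=> //.
have {q2}[h [U [V [p0 [p1 [p2 [w [u [R [[q0 q1 q2 q3 q4] Lk Lw Lx]]]]]]]]]] := q2.
have szY := size_sel p0 nY; have szX := size_sel p1 nX.
have [[hr _ _ _ _] hlk _ _ _] := r2.
rewrite /outputs_presentation !hr // q0 q1 q2 q3 q4.
exists (presA nX nY h p0 p1), (rl w), (cl f (p1 := p1)).
split.
- split; last by nia.
  move=> i j; have ii := ltn_ord i; have jn := ltn_ord j.
  rewrite add0n hlk; last by nia.
  by rewrite Lk // mxE.
- split; last by nia.
  by apply: (low_lab_at hS r2 Lw); nia.
- split; last by nia.
  by apply: (low_lab_at hS r2 Lx); nia.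
exact: resolved_presentation fgM R.
Qed.

Lemma betti_correct : exists (s' : state K) t,
  [/\ exec S (program write_betti) s s' t,
      t <= cost N (program write_betti) & outputs_betti S s' M].
Proof.
have N0 : 0 < N by lia.
have hN : nX + nY + nZ < N by lia.
pose Q (H' : hst K) := exists h U V p0 p1 p2 w u,
  resolved nZ nY nX (ext2 g) (ext2 f) (ext1 (clab g)) (ext1 (clab f)) h U p0 p1 p2 w u V /\
  [/\ tallied N p0 w H' 0 nY, tallied N p1 (ext1 (clab f)) H' 1 nX
    & tallied N p2 u H' 2 nX].
have [||s' [t [H' [x2 t2 r2 q2]]]] := @run_program K nX nY nZ f g M s S fgM sin hS
    write_betti Q.
- by vm_compute.
- move=> H [dH hx [U [V R]]] e9; apply: wp_conseq.
    apply: (write_betti_spec N0 hS hN dH e9 (p0 := fun i => ar H 3 i != 0)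
      (p1 := fun i => ar H 4 i != 0) (p2 := fun i => ar H 5 i != 0)
      (w := fun i => (lb H 4 i, lb H 5 i)) (u := fun i => (lb H 6 i, lb H 7 i))
      _ _ _ hx) => //.
  move=> H' W; exists (mt H 0), U, V, (fun i => ar H 3 i != 0), (fun i => ar H 4 i != 0).
  exists (fun i => ar H 5 i != 0), (fun i => (lb H 4 i, lb H 5 i)).
  by exists (fun i => (lb H 6 i, lb H 7 i)).
exists s', t; split=> //.
have {q2}[h [U [V [p0 [p1 [p2 [w [u [R [T0 T1 T2]]]]]]]]]] := q2.
have B z := resolved_betti fgM R z.
have [nXN nYN] : nX < N /\ nY < N by lia.
case=> [|[|[|]]] // _.
- by apply: (tallied_betti hS r2 _ nYN T0) => // z; case: (B z).
- by apply: (tallied_betti hS r2 _ nXN T1) => // z; case: (B z).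
- by apply: (tallied_betti hS r2 _ nXN T2) => // z; case: (B z).
Qed.

End Correct.

Lemma sum_squares_le a b c : (a + b + c + 1) * (a + b + c + 1) <=
  4 * (a ^ 2 + b ^ 2 + c ^ 2 + 1).
Proof.
have h p q : p * q + p * q <= p * p + q * q.
  by have := (nat_Cauchy p q).1; rewrite -!mulnn mul2n -addnn.
rewrite -!mulnn !(mulnDl, mulnDr, muln1, mul1n).
have := h a b; have := h a c; have := h b c; have := h a 1; have := h b 1.
have := h c 1; rewrite !muln1 ![b * a]mulnC ![c * a]mulnC ![c * b]mulnC; lia.
Qed.

(** Two levels of (p + q)^3 <= 4 (p^3 + q^3), hence the factor 16. *)
Lemma sum_cubes_le a b c : (a + b + c + 1) ^ 3 <= 16 * (a ^ 3 + b ^ 3 + c ^ 3 + 1).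
Proof.
have h p q : (p + q) ^ 3 <= 4 * (p ^ 3 + q ^ 3).
  wlog pq : p q / p <= q.
    by case/orP: (leq_total p q) => pq /(_ _ _ pq); rewrite // addnC [_ ^ 3 + _]addnC.
  rewrite -(subnK pq) !expnS !expn0 !muln1; set d := (q - p)%N.
  rewrite !(mulnDl, mulnDr); nia.
have h1 := h (a + b) (c + 1); have h2 := h a b; have h3 := h c 1; rewrite exp1n in h3.
by rewrite -[a + b + c + 1]addnA; lia.
Qed.

(** One constant must serve both memory and time: the first summand covers the capacity through
    [sum_squares_le], the second one the cost through [sum_cubes_le]. *)
Lemma bounds_le k nX nY nZ (c := (4 * 200 + 16 * k)%N) (N := (nX + nY + nZ + 1)%N) :
  (200 * (N * N) <= c * (nX ^ 2 + nY ^ 2 + nZ ^ 2 + 1))%N /\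
  (k * N ^ 3 <= c * (nX ^ 3 + nY ^ 3 + nZ ^ 3 + 1))%N.
Proof.
rewrite /c mulnDl [in X in _ /\ X]mulnDl; split.
  apply: leq_trans (leq_addr _ _); rewrite [4 * 200]mulnC -mulnA leq_mul2l.
  exact: sum_squares_le.
apply: leq_trans (leq_addl _ _); rewrite [16 * k]mulnC -mulnA leq_mul2l.
by rewrite sum_cubes_le orbT.
Qed.

Lemma cubic_cost P : deg P = 3 ->
  exists k, forall N, 0 < N -> (cost N P <= k * N ^ 3)%N.
Proof. by move=> d3; exists (coef P) => N N0; rewrite -d3; apply: cost_coef. Qed.

Theorem mainTheorem1 (K : fieldType) :
  (exists (P : cmd) (c : nat),
     forall (nX nY nZ : nat)
       (f : bigraded_mx K nY nX) (g : bigraded_mx K nZ nY) (M : bipmod K)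
       (s : state K),
       is_FIRep f g M -> is_input f g s ->
       let S := (c * (nX ^ 2 + nY ^ 2 + nZ ^ 2 + 1))%N in
       exists (s' : state K) (t : nat),
         exec S P s s' t /\
         (t <= c * (nX ^ 3 + nY ^ 3 + nZ ^ 3 + 1))%N /\
         outputs_presentation S s' M) /\
  (exists (P : cmd) (c : nat),
     forall (nX nY nZ : nat)
       (f : bigraded_mx K nY nX) (g : bigraded_mx K nZ nY) (M : bipmod K)
       (s : state K),
       is_FIRep f g M -> is_input f g s ->
       let S := (c * (nX ^ 2 + nY ^ 2 + nZ ^ 2 + 1))%N in
       exists (s' : state K) (t : nat),
         exec S P s s' t /\
         (t <= c * (nX ^ 3 + nY ^ 3 + nZ ^ 3 + 1))%N /\
         outputs_betti S s' M).
Proof.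
(* The condition [deg P = 3] is settled by computation; the depth three is that of a column
   operation, within the scan of the rows, within the loop over the columns. *)
have [k hk] : exists k, forall N, 0 < N ->
  (cost N (program write_presentation) <= k * N ^ 3)%N by apply: cubic_cost.
have [l hl] : exists l, forall N, 0 < N ->
  (cost N (program write_betti) <= l * N ^ 3)%N by apply: cubic_cost.
split.
- exists (program write_presentation), (4 * 200 + 16 * k)%N.
  move=> nX nY nZ f g M s fgM sin S; have [hS ht] := bounds_le k nX nY nZ.
  have [s' [t [x2 t2 o2]]] := presentation_correct fgM sin hS.
  exists s', t; split=> //; split=> //.
  by apply: leq_trans t2 (leq_trans (hk _ _) ht); rewrite addn1.
- exists (program write_betti), (4 * 200 + 16 * l)%N.
  move=> nX nY nZ f g M s fgM sin S; have [hS ht] := bounds_le l nX nY nZ.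
  have [s' [t [x2 t2 o2]]] := betti_correct fgM sin hS.
  exists s', t; split=> //; split=> //.
  by apply: leq_trans t2 (leq_trans (hl _ _) ht); rewrite addn1.
Qed.
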